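(* Let $\Omega\subset\mathbb{R}^2$, $\Omega\neq\mathbb{R}^2$, be a domain, where $\mathbb{R}^2$ is identified with $\mathbb{C}$. Suppose that there is a number $\theta\in[\pi/2,\pi]$ such that for each $w\in\Omega^c=\mathbb{R}^2\setminus\Omega$ one can find $\phi_w\in(-\pi,\pi]$ with $$\Omega\subset K_\theta(w,\phi_w).$$ Then for any $u\in C^1_0(\Omega)$ the Hardy inequality $$\int_\Omega|\nabla u|^2\,d\mathbf{x}\ \ge\ r^2\int_\Omega\frac{|u|^2}{\delta(\mathbf{x})^2}\,d\mathbf{x}$$ holds with $$r=\frac{\pi}{4\theta}.$$
   Context: A domain is a nonempty open connected set. $C^1_0(\Omega)$ is the space of continuously differentiable (real- or complex-valued) functions with compact support in $\Omega$. The distance to the boundary is $\delta(\mathbf{x})=\inf_{\mathbf{y}\in\Omega^c}|\mathbf{y}-\mathbf{x}|$, where $\Omega^c=\mathbb{R}^2\setminus\Omega$. The argument is normalized by $\arg\zeta\in(-\pi,\pi]$. For $\theta\in[0,\pi]$, $K_\theta=\{z\in\mathbb{C}:|\arg z|<\theta\}$ is the open sector with vertex $0$ (the vertex is not included), symmetric about the real axis, with angle $2\theta$ at the vertex. For a set $\Lambda\subset\mathbb{C}$, $w\in\mathbb{C}$ and $\phi\in(-\pi,\pi]$, $\Lambda(w,\phi)=e^{i\phi}\Lambda+w=\{z\in\mathbb{C}:e^{-i\phi}(z-w)\in\Lambda\}$. *)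

(* Defs.v *)
From HB Require Import structures.
From mathcomp Require Import all_boot all_order all_algebra.
From mathcomp Require Export complex.
From mathcomp Require Import all_classical all_reals all_analysis.
Import Order.TTheory GRing.Theory Num.Theory.
Import numFieldNormedType.Exports.

Set Implicit Arguments.
Unset Strict Implicit.
Unset Printing Implicit Defensive.

Local Open Scope classical_set_scope.
Local Open Scope ring_scope.
Local Open Scope complex_scope.

(** Points of the plane are pairs [R * R], which carry the product topology and
    the product measure; [toC] is the identification of the plane with [R[i]]. *)
Definition toC {R : realType} (x : R * R) : R[i] := x.1 +i* x.2.

Definition cabs {R : realType} (z : R[i]) : R := ComplexField.Normc.normc z.

Definition cis {R : realType} (t : R) : R[i] := cos t +i* sin t.

(** Only meaningful for [z != 0], where [carg_polar] and [cargP] below apply. *)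
Definition carg {R : realType} (z : R[i]) : R :=
  get [set t | (- pi < t <= pi) /\ z = (cabs z)%:C * cis t].

Definition sector {R : realType} (theta : R) : set R[i] :=
  [set z | z != 0 /\ `|carg z| < theta].

(** The set $\Lambda(w,\phi) = e^{i\phi}\Lambda + w$. *)
Definition moved {R : realType} (L : set R[i]) (w : R[i]) (phi : R) : set R[i] :=
  [set z | L (cis (- phi) * (z - w))].

Definition is_domain {R : realType} (Omega : set (R * R)) : Prop :=
  [/\ Omega !=set0, open Omega & connected Omega].

(** The distance is Euclidean, unlike the (maximum) norm of the product [R * R]. *)
Definition bdist {R : realType} (Omega : set (R * R)) (x : R * R) : R :=
  inf [set cabs (toC y - toC x) | y in ~` Omega].

Definition C1_on {R : realType} (Omega : set (R * R)) (f : R * R -> R) : Prop :=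
  forall x, Omega x ->
    [/\ differentiable f x,
        {for x, continuous (fun y => 'D_(1, 0) f y)} &
        {for x, continuous (fun y => 'D_(0, 1) f y)}].

Definition re {R : realType} (u : R * R -> R[i]) (x : R * R) : R := complex.Re (u x).
Definition im {R : realType} (u : R * R -> R[i]) (x : R * R) : R := complex.Im (u x).

(** Functions on [Omega] are represented by total functions whose values off
    [Omega] are irrelevant; hence the support only involves points of [Omega]. *)
Definition supp_in {R : realType} (Omega : set (R * R)) (u : R * R -> R[i]) :
    set (R * R) :=
  closure (Omega `&` [set x | u x != 0]).

Definition C1_0 {R : realType} (Omega : set (R * R)) (u : R * R -> R[i]) : Prop :=
  [/\ C1_on Omega (re u), C1_on Omega (im u),
      compact (supp_in Omega u) & supp_in Omega u `<=` Omega].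

Definition cpartial {R : realType} (v : R * R) (u : R * R -> R[i]) (x : R * R) :
    R[i] :=
  'D_v (re u) x +i* 'D_v (im u) x.

(** $|\nabla u|^2 = |\partial_1 u|^2 + |\partial_2 u|^2$ *)
Definition grad_sq {R : realType} (u : R * R -> R[i]) (x : R * R) : R :=
  cabs (cpartial (1, 0) u x) ^+ 2 + cabs (cpartial (0, 1) u x) ^+ 2.

Definition leb2 {R : realType} := ((@lebesgue_measure R) \x (@lebesgue_measure R))%E.

Section arg.
Context {R : realType}.
Implicit Types (z : R[i]) (r t : R).

Let cabs_polar r t : 0 <= r -> cabs (r%:C * cis t) = r.
Proof.
move=> r0; rewrite /cabs /cis /=; simpc => /=.
by rewrite !exprMn -mulrDr cos2Dsin2 mulr1 sqrtr_sqr ger0_norm.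
Qed.

Let cis_inj (s t : R) : - pi < s <= pi -> - pi < t <= pi -> cis s = cis t -> s = t.
Proof.
have absP (x : R) : - pi < x <= pi -> `|x| \in `[0, pi : R].
  move=> /andP[x1 x2]; rewrite in_itv /= normr_ge0 /= ler_norml x2 andbT.
  exact: ltW.
have pos (x : R) : - pi < x <= pi -> 0 <= x -> 0 <= sin x.
  by move=> /andP[_ x2] x0; apply: sin_ge0_pi; rewrite x0.
have neg (x : R) : - pi < x <= pi -> x < 0 -> sin x < 0.
  move=> /andP[x1 _] x0; rewrite -oppr_gt0 -sinN; apply: sin_gt0_pi.
  by rewrite oppr_gt0 x0 ltrNl.
move=> hs ht ecs; have ec := congr1 (@complex.Re R) ecs.
have es := congr1 (@complex.Im R) ecs; rewrite /= in ec es.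
have e : `|s| = `|t|.
  by apply: (cos_inj (absP _ hs) (absP _ ht)); rewrite !cos_norm.
have [s0|s0] := leP 0 s; have [t0|t0] := leP 0 t.
- by move: e; rewrite !ger0_norm.
- by have := pos _ hs s0; rewrite es leNgt neg.
- by have := pos _ ht t0; rewrite -es leNgt neg.
- by move: e; rewrite !ltr0_norm// => /oppr_inj.
Qed.

Lemma cargP z : z != 0 -> (- pi < carg z <= pi) /\ z = (cabs z)%:C * cis (carg z).
Proof.
move=> z0; suff [t ht] : exists t : R, (- pi < t <= pi) /\ z = (cabs z)%:C * cis t.
  exact: (@getPex _ [set s | (- pi < s <= pi) /\ z = (cabs z)%:C * cis s]
           (ex_intro _ t ht)).
case: z z0 => a b z0; set n := cabs _.
have n0 : 0 < n.
  rewrite lt_neqAle /n /cabs /= sqrtr_ge0 andbT eq_sym sqrtr_eq0 -ltNge.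
  rewrite lt_neqAle addr_ge0 ?sqr_ge0// andbT eq_sym paddr_eq0 ?sqr_ge0//.
  by rewrite !sqrf_eq0; rewrite eq_complex /= in z0.
have n2 : a ^+ 2 + b ^+ 2 = n ^+ 2.
  by rewrite /n /cabs /= sqr_sqrtr// addr_ge0 ?sqr_ge0.
have [c1 c2] : -1 <= a / n /\ a / n <= 1.
  apply/andP; rewrite -ler_norml normrM normfV (gtr0_norm n0) ler_pdivrMr// mul1r.
  by rewrite -(gtr0_norm n0) -ler_sqr ?nnegrE// !real_normK ?num_real// -n2 lerDl sqr_ge0.
have ca : n * cos (acos (a / n)) = a.
  by rewrite acosK ?in_itv/= ?c1// mulrC divfK ?gt_eqF.
have sa : n * sin (acos (a / n)) = `|b|.
  rewrite sin_acos ?c1// -[X in X * _](gtr0_norm n0) -sqrtr_sqr -sqrtrM ?sqr_ge0//.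
  rewrite mulrBr mulr1 -exprMn mulrC divfK ?gt_eqF// -n2 addrAC subrr add0r.
  by rewrite sqrtr_sqr.
have p0 := pi_gt0 R.
case: (lerP 0 b) => b0.
  exists (acos (a / n)); split.
    rewrite acos_lepi ?c1// andbT (lt_le_trans _ (acos_ge0 _)) ?c1//.
    by rewrite oppr_lt0.
  by rewrite /cis; simpc; rewrite ca sa ger0_norm.
exists (- acos (a / n)); split.
  rewrite ltrN2 acos_ltpi ?c2 ?andbT /=; last first.
    rewrite lt_neqAle c1 andbT; apply/eqP => e; move: sa.
    by rewrite -e acosN1 sinpi mulr0 => /esym/eqP; rewrite normr_eq0 lt_eqF.
  by rewrite (le_trans _ (ltW p0))// oppr_le0 acos_ge0 ?c1.
rewrite /cis cosN sinN; simpc; rewrite ca sa.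
by rewrite (ltr0_norm b0) opprK.
Qed.

Lemma carg_polar r t : 0 < r -> - pi < t <= pi -> carg (r%:C * cis t) = t.
Proof.
move=> r0 ht; have z0 : r%:C * cis t != 0.
  apply/eqP => e; have := cabs_polar t (ltW r0); rewrite e /cabs /=.
  by rewrite expr0n addr0 sqrtr0 => /eqP; rewrite lt_eqF.
have [h] := cargP z0; rewrite cabs_polar ?ltW// => /mulfI e.
apply/esym/cis_inj => //; apply: e.
by rewrite eq_complex /= eqxx andbT gt_eqF.
Qed.
End arg.

(* Main.v *)
Require Import Defs.
From HB Require Import structures.
From mathcomp Require Import all_boot all_order all_algebra.
From mathcomp Require Import all_classical all_reals all_analysis.
From mathcomp Require Import ring lra.
Import Order.TTheory GRing.Theory Num.Theory.
Import numFieldNormedType.Exports.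

Set Implicit Arguments.
Unset Strict Implicit.
Unset Printing Implicit Defensive.

Local Open Scope classical_set_scope.
Local Open Scope ring_scope.
Local Open Scope complex_scope.

(** The sector condition provides logarithms of [z - w] on [Omega] for every omitted [w], so the
    proof of the Riemann mapping theorem can be run on [Omega]: injective holomorphic maps into
    the unit disc, with inverse [F], are improved by Koebe's square-root step until the image
    contains the disc of radius [r], for a given [r < 1]. Composing [F] with the power
    [(e^(-i phi) (z - w))^(pi / (2 theta))], which takes the sector into the right half-plane,
    the Schwarz-Pick lemma yields, as [r] tends to [1],
    [pi / (4 theta) <= |w - x| |f'(x)| / (1 - |f(x)|^2)] for all [w] outside [Omega].
    The gradient [Y] of [log (1 - |f|^2) / 2] satisfies
    [- div Y - |Y|^2 = |f'|^2 (2 - |f|^2) / (1 - |f|^2)^2 >= (|f'| / (1 - |f|^2))^2],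
    and integrating [|grad u - u Y|^2 >= 0] by parts bounds the integral of
    [(- div Y - |Y|^2) |u|^2] by that of [|grad u|^2]. *)

(** Neither contour integrals nor normal families enter: holomorphic means twice strictly
    differentiable, the maximum principle rests on a second-derivative test, and a map whose
    derivative at [z0] is nearly the largest replaces the extremal one, so that no limit of maps is
    taken. The price is that the map changes with [r]; hence [1 - |f|^2] must be bounded below on
    the support of [u] uniformly over all competing maps ([admissible_bound]). The main obstacle is
    simple connectedness. Koebe's step needs a logarithm of [f - a] for a value [a] omitted by [f],
    while the sectors only concern points omitted by the domain. It is obtained by continuation
    along the homotopy [(f z - t a) / (z - F (t a))]; this is why [F] is kept on the whole disc and
    why each map carries a logarithm of [f z / (z - z0)]. In the constant, [pi / (2 theta)] is the
    exponent of the power, and the remaining factor 1/2 comes from the half-plane form of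
    Schwarz-Pick, [|p'| (1 - |z|^2) <= 2 Re p]. *)

Arguments cabs {R} z : simpl never.

(** * Modulus and convergence *)

Section Cabs.
Context {R : realType}.
Implicit Types (z w : R[i]) (r : R).

Lemma normr_cabs z : `|z| = (cabs z)%:C. Proof. by []. Qed.

Lemma cabsE z : cabs z = Num.sqrt (complex.Re z ^+ 2 + complex.Im z ^+ 2).
Proof. by case: z. Qed.

Lemma cabs_ge0 z : 0 <= cabs z. Proof. by rewrite cabsE sqrtr_ge0. Qed.

Lemma cabs0 : cabs (0 : R[i]) = 0. Proof. exact: ComplexField.Normc.normc0. Qed.
Lemma cabs1 : cabs (1 : R[i]) = 1. Proof. exact: ComplexField.Normc.normc1. Qed.
Lemma cabsM z w : cabs (z * w) = cabs z * cabs w.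
Proof. exact: ComplexField.Normc.normcM. Qed.
Lemma cabsV z : cabs z^-1 = (cabs z)^-1. Proof. exact: ComplexField.Normc.normcV. Qed.
Lemma cabsX z n : cabs (z ^+ n) = cabs z ^+ n.
Proof. by elim: n => [|n ih]; rewrite ?expr0 ?cabs1// !exprS cabsM ih. Qed.
Lemma cabs_eq0 z : (cabs z == 0) = (z == 0).
Proof.
apply/eqP/eqP => [|->]; last exact: cabs0.
exact: ComplexField.Normc.eq0_normc.
Qed.
Lemma cabs_gt0 z : (0 < cabs z) = (z != 0).
Proof. by rewrite lt_neqAle cabs_ge0 andbT eq_sym cabs_eq0. Qed.
Lemma cabsN z : cabs (- z) = cabs z.
Proof. by apply: complexI; rewrite -!normr_cabs normrN. Qed.
Lemma cabsB z w : cabs (z - w) = cabs (w - z).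
Proof. by rewrite -cabsN opprB. Qed.
Lemma cabsD z w : cabs (z + w) <= cabs z + cabs w.
Proof. by rewrite -lecR rmorphD /= -!normr_cabs ler_normD. Qed.
Lemma cabs_distD w z1 z2 : cabs (z1 - z2) <= cabs (z1 - w) + cabs (w - z2).
Proof. by rewrite (le_trans _ (cabsD _ _))// addrA subrK. Qed.
Lemma cabs_triB z w : cabs z - cabs w <= cabs (z - w).
Proof. by rewrite lerBlDr (le_trans _ (cabsD _ _))// subrK. Qed.
Lemma cabs_real r : cabs r%:C = `|r|.
Proof. by rewrite cabsE /= expr0n addr0 sqrtr_sqr. Qed.
Lemma cabs_realp r : 0 <= r -> cabs r%:C = r.
Proof. by move=> r0; rewrite cabs_real ger0_norm. Qed.
Lemma cabs_i : cabs ('i : R[i]) = 1.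
Proof. by rewrite cabsE /= expr0n expr1n add0r sqrtr1. Qed.
Lemma cabs_conj z : cabs (conjc z) = cabs z.
Proof. by case: z => x y; rewrite !cabsE /= sqrrN. Qed.
Lemma cabs_sq z : cabs z ^+ 2 = complex.Re z ^+ 2 + complex.Im z ^+ 2.
Proof. by rewrite cabsE sqr_sqrtr// addr_ge0 ?sqr_ge0. Qed.
Lemma Re_le_cabs z : `|complex.Re z| <= cabs z.
Proof. by rewrite cabsE -[leLHS]sqrtr_sqr ler_wsqrtr// lerDl sqr_ge0. Qed.
Lemma Im_le_cabs z : `|complex.Im z| <= cabs z.
Proof. by rewrite cabsE -[leLHS]sqrtr_sqr ler_wsqrtr// lerDr sqr_ge0. Qed.
Lemma cabs_le_ReIm z : cabs z <= `|complex.Re z| + `|complex.Im z|.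
Proof.
rewrite [in leLHS](complexE z) (le_trans (cabsD _ _))//.
by rewrite cabsM cabs_i mul1r !cabs_real.
Qed.

Lemma cReD z w : complex.Re (z + w) = complex.Re z + complex.Re w.
Proof. by case: z; case: w. Qed.
Lemma cImD z w : complex.Im (z + w) = complex.Im z + complex.Im w.
Proof. by case: z; case: w. Qed.
Lemma cReN z : complex.Re (- z) = - complex.Re z. Proof. by case: z. Qed.
Lemma cImN z : complex.Im (- z) = - complex.Im z. Proof. by case: z. Qed.
Lemma cReM z w : complex.Re (z * w) =
  complex.Re z * complex.Re w - complex.Im z * complex.Im w.
Proof. by case: z; case: w. Qed.
Lemma cImM z w : complex.Im (z * w) =
  complex.Re z * complex.Im w + complex.Im z * complex.Re w.
Proof. by case: z; case: w. Qed.

End Cabs.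

Section Topology.
Context {R : realType}.
Implicit Types (z w l : R[i]) (r e : R).

(* The canonical topology of [R[i]] as a [numFieldType] has radii in [R[i]];
   the filter below has real radii. *)
Definition cnbhs z : set_system R[i] :=
  [set A | exists2 e : R, 0 < e & forall w, cabs (w - z) < e -> A w].

Global Instance cnbhs_filter z : ProperFilter (cnbhs z).
Proof.
split; first by move=> [e e0 /(_ z)]; rewrite subrr cabs0; exact.
split; first by exists 1.
- move=> P Q [d d0 dP] [e e0 eQ]; exists (Num.min d e).
    by rewrite lt_min d0.
  by move=> w; rewrite lt_min => /andP[/dP ? /eQ].
- by move=> P Q PQ [e e0 eP]; exists e => // w /eP /PQ.
Qed.

Lemma near_cnbhs z e : 0 < e -> \forall w \near cnbhs z, cabs (w - z) < e.
Proof. by move=> e0; exists e. Qed.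

Definition ccvg {T : Type} (F : set_system T) (f : T -> R[i]) l :=
  forall e, 0 < e -> \forall x \near F, cabs (f x - l) < e.

Section ccvg.
Context {T : Type} {F : set_system T} {FF : Filter F}.
Implicit Types f g : T -> R[i].

Lemma ccvg_near f l (A : set R[i]) :
  ccvg F f l -> cnbhs l A -> \forall x \near F, A (f x).
Proof. by move=> fl [e e0 eA]; apply: filterS (fl _ e0) => x; exact: eA. Qed.

Lemma ccvg_comp (h : R[i] -> R[i]) f l m :
  ccvg F f l -> ccvg (cnbhs l) h m -> ccvg F (h \o f) m.
Proof. by move=> fl hl e e0; exact: ccvg_near fl (hl e e0). Qed.

Lemma cvg_ccvg (U : topologicalType) (h : R[i] -> U) f l (m : U) :
  ccvg F f l -> h @ cnbhs l --> m -> h (f x) @[x --> F] --> m.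
Proof. by move=> fl hl A /hl hA; exact: ccvg_near fl hA. Qed.

Lemma ccvg_cst l : ccvg F (fun=> l) l.
Proof. by move=> e e0; near=> x; rewrite subrr cabs0. Unshelve. all: by end_near. Qed.

Lemma ccvg_lip f g l m (k : R) : 0 < k ->
  (\forall x \near F, cabs (g x - m) <= k * cabs (f x - l)) ->
  ccvg F f l -> ccvg F g m.
Proof.
move=> k0 gf fl e e0; near=> x.
apply: (@le_lt_trans _ _ (k * cabs (f x - l))); first by near: x.
by rewrite mulrC -ltr_pdivlMr//; near: x; apply: fl; rewrite divr_gt0.
Unshelve. all: by end_near. Qed.

Lemma ccvgD f g l m : ccvg F f l -> ccvg F g m -> ccvg F (fun x => f x + g x) (l + m).
Proof.
move=> fl gm e e0; have e20 : 0 < e / 2 by rewrite divr_gt0.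
near=> x; rewrite opprD addrACA (le_lt_trans (cabsD _ _))// [e]splitr ltrD//.
  by near: x; exact: fl.
by near: x; exact: gm.
Unshelve. all: by end_near. Qed.

Lemma ccvgN f l : ccvg F f l -> ccvg F (fun x => - f x) (- l).
Proof.
apply: (@ccvg_lip _ _ _ _ 1) => //; near=> x.
by rewrite -opprD cabsN mul1r.
Unshelve. all: by end_near. Qed.

Lemma ccvgB f g l m : ccvg F f l -> ccvg F g m -> ccvg F (fun x => f x - g x) (l - m).
Proof. by move=> fl /ccvgN; exact: ccvgD. Qed.

Lemma ccvg_cabs f l : ccvg F f l -> cabs (f x) @[x --> F] --> cabs l.
Proof.
move=> fl; apply/cvgrPdist_lt => e e0; near=> x.
apply: (@le_lt_trans _ _ (cabs (f x - l))); last by near: x; exact: fl.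
by rewrite ler_norml lerNl opprB cabs_triB cabsB cabs_triB.
Unshelve. all: by end_near. Qed.

Lemma ccvgM f g l m : ccvg F f l -> ccvg F g m -> ccvg F (fun x => f x * g x) (l * m).
Proof.
move=> fl gm e e0.
set k := cabs l + 1 + cabs m; have k0 : 0 < k.
  by rewrite /k -addrA addrCA ltr_wpDr// addr_ge0 ?cabs_ge0.
have ek : 0 < e / (2 * k) by rewrite divr_gt0// mulr_gt0.
near=> x.
have -> : f x * g x - l * m = f x * (g x - m) + (f x - l) * m by ring.
apply: (le_lt_trans (cabsD _ _)); rewrite !cabsM.
have fx : cabs (f x) <= k.
  have : cabs (f x - l) < 1 by near: x; exact: fl.
  have := cabs_triB (f x) l; have := cabs_ge0 m; rewrite /k; lra.
have mk : cabs m <= k by have := cabs_ge0 l; rewrite /k; lra.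
have gx : cabs (g x - m) < e / (2 * k) by near: x; exact: gm.
have fx' : cabs (f x - l) < e / (2 * k) by near: x; exact: fl.
have E : e = k * (e / (2 * k)) + (e / (2 * k)) * k by field; rewrite gt_eqF.
rewrite [ltRHS]E; apply: ltr_leD.
  by rewrite (le_lt_trans (ler_wpM2r (cabs_ge0 _) fx))// ltr_pM2l.
by rewrite ler_pM ?cabs_ge0// ltW.
Unshelve. all: by end_near. Qed.

Lemma ccvgV f l : l != 0 -> ccvg F f l -> ccvg F (fun x => (f x)^-1) l^-1.
Proof.
move=> l0 fl; have cl : 0 < cabs l by rewrite cabs_gt0.
apply: (@ccvg_lip _ _ _ _ (2 / cabs l ^+ 2)) (fl).
  by rewrite divr_gt0// exprn_gt0.
near=> x.
have fx : cabs l / 2 < cabs (f x).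
  have : cabs (f x - l) < cabs l / 2 by near: x; apply: fl; rewrite divr_gt0.
  by have := cabs_triB l (f x); rewrite cabsB; lra.
have fx0 : f x != 0 by rewrite -cabs_gt0 (lt_trans _ fx)// divr_gt0.
have -> : (f x)^-1 - l^-1 = (l - f x) * (f x)^-1 * l^-1 by field; rewrite fx0 l0.
rewrite !cabsM !cabsV cabsB.
have -> : 2 / cabs l ^+ 2 * cabs (f x - l) =
    cabs (f x - l) * (2 / cabs l) * (cabs l)^-1 by field; rewrite gt_eqF.
rewrite ler_wpM2r ?invr_ge0 ?cabs_ge0// ler_wpM2l ?cabs_ge0//.
by rewrite -[leRHS]invf_div lef_pV2 ?posrE ?divr_gt0// ?cabs_gt0// ltW.
Unshelve. all: by end_near. Qed.

Lemma ccvg_Re f l : ccvg F f l -> complex.Re (f x) @[x --> F] --> complex.Re l.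
Proof.
move=> fl; apply/cvgrPdist_lt => e e0; near=> x.
rewrite -cReN -cReD (le_lt_trans (Re_le_cabs _))// cabsB.
by near: x; exact: fl.
Unshelve. all: by end_near. Qed.

Lemma ccvg_Im f l : ccvg F f l -> complex.Im (f x) @[x --> F] --> complex.Im l.
Proof.
move=> fl; apply/cvgrPdist_lt => e e0; near=> x.
rewrite -cImN -cImD (le_lt_trans (Im_le_cabs _))// cabsB.
by near: x; exact: fl.
Unshelve. all: by end_near. Qed.

Lemma ccvg_ReIm (f1 f2 : T -> R) (l1 l2 : R) :
  f1 @ F --> l1 -> f2 @ F --> l2 -> ccvg F (fun x => f1 x +i* f2 x) (l1 +i* l2).
Proof.
move=> /cvgrPdist_lt h1 /cvgrPdist_lt h2 e e0.
have e20 : 0 < e / 2 by rewrite divr_gt0.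
near=> x; rewrite [e]splitr; apply: le_lt_trans (cabs_le_ReIm _) _.
by apply: ltrD; rewrite /= distrC; near: x; [exact: h1|exact: h2].
Unshelve. all: by end_near. Qed.

Lemma ccvg_real (f1 : T -> R) (l1 : R) :
  f1 @ F --> l1 -> ccvg F (fun x => (f1 x)%:C) l1%:C.
Proof. by move=> h; apply: ccvg_ReIm => //; exact: cvg_cst. Qed.

End ccvg.

Lemma ccvg_id z : ccvg (cnbhs z) id z.
Proof. by move=> e e0; exact: near_cnbhs. Qed.

Lemma ccvg_eq_unique {T} (F : set_system T) {FF : ProperFilter F} (f : T -> R[i]) l m :
  ccvg F f l -> ccvg F f m -> l = m.
Proof.
move=> fl fm; apply/eqP; rewrite -subr_eq0 -cabs_eq0 eq_le cabs_ge0 andbT.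
apply/ler_addgt0Pr => e e0; rewrite add0r; have e20 : 0 < e / 2 by rewrite divr_gt0.
have [x []] := @filter_ex _ F _ _ (filterI (fl _ e20) (fm _ e20)).
by have := cabs_distD (f x) l m; rewrite (cabsB l (f x)); lra.
Qed.

Definition ofC z : R * R := (complex.Re z, complex.Im z).
Lemma ofCK : cancel ofC toC. Proof. by case. Qed.
Lemma toCK : cancel toC ofC. Proof. by case. Qed.

Lemma ccvg_toC (x : R * R) : ccvg (nbhs x) toC (toC x).
Proof. have h1 : (fst : R * R -> R) @ nbhs x --> x.1 by exact: cvg_fst.
have h2 : (snd : R * R -> R) @ nbhs x --> x.2 by exact: cvg_snd.
exact: (@ccvg_ReIm _ (nbhs x) (nbhs_filter x) _ _ _ _ h1 h2).
Qed.

Lemma cvg_ofC z : ofC @ cnbhs z --> ofC z.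
Proof.
exact: (cvg_pair (ccvg_Re (ccvg_id z)) (ccvg_Im (ccvg_id z))).
Qed.

Lemma nbhs_toC (x : R * R) (A : set R[i]) :
  cnbhs (toC x) A -> nbhs x (toC @^-1` A).
Proof. by move=> hA; exact: (ccvg_near (ccvg_toC x) hA). Qed.

Lemma cnbhs_ofC (x : R * R) (A : set (R * R)) :
  nbhs x A -> cnbhs (toC x) (ofC @^-1` A).
Proof. by move=> hA; apply: cvg_ofC; rewrite toCK. Qed.

End Topology.

(** * Strict complex derivatives *)

Section StrictDerivative.
Context {R : realType}.
Implicit Types (f g h : R[i] -> R[i]) (z w l m : R[i]).

Definition cnbhs2 z : set_system (R[i] * R[i]) := filter_prod (cnbhs z) (cnbhs z).

Global Instance cnbhs2_filter z : ProperFilter (cnbhs2 z).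
Proof. exact: filter_prod_proper. Qed.

(* Strict differentiability: [f x - f y = q (x, y) * (x - y)] with [q] tending to
   the derivative as both points tend to [z]; it makes derivatives continuous. *)
Definition sder f z l := exists2 q : R[i] * R[i] -> R[i], ccvg (cnbhs2 z) q l &
  \forall p \near cnbhs2 z, f p.1 - f p.2 = q p * (p.1 - p.2).

Lemma ccvg_fst2 f z l : ccvg (cnbhs z) f l -> ccvg (cnbhs2 z) (f \o fst) l.
Proof.
move=> fl e e0; exists ([set x | cabs (f x - l) < e], setT) => /=.
  by split; [exact: fl|exact: filterT].
by move=> [x y] /= [].
Qed.

Lemma ccvg_snd2 f z l : ccvg (cnbhs z) f l -> ccvg (cnbhs2 z) (f \o snd) l.
Proof.
move=> fl e e0; exists (setT, [set x | cabs (f x - l) < e]) => /=.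
  by split; [exact: filterT|exact: fl].
by move=> [x y] /= [].
Qed.

Lemma near_fst2 z (A : set R[i]) : cnbhs z A -> \forall p \near cnbhs2 z, A p.1.
Proof. by move=> h; exists (A, setT) => /=; [split => //; exact: filterT|move=> [x y] []]. Qed.
Lemma near_snd2 z (A : set R[i]) : cnbhs z A -> \forall p \near cnbhs2 z, A p.2.
Proof. by move=> h; exists (setT, A) => /=; [split => //; exact: filterT|move=> [x y] []]. Qed.

(** This is how a strict derivative gets used: its quotient [q] is evaluated along two moving points
    that both tend to [z]. *)
Lemma ccvg_pair2 (T : Type) (F : set_system T) {FF : Filter F} (f1 f2 : T -> R[i]) z (q : R[i] * R[i] -> R[i]) l :
  ccvg F f1 z -> ccvg F f2 z -> ccvg (cnbhs2 z) q l -> ccvg F (fun x => q (f1 x, f2 x)) l.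
Proof.
move=> h1 h2 ql e /ql [[A B] /= [hA hB] AB].
by apply: filterS2 (ccvg_near h1 hA) (ccvg_near h2 hB) => x Ax Bx; apply: (AB (f1 x, f2 x)).
Qed.

Lemma near_pair2 (T : Type) (F : set_system T) {FF : Filter F} (f1 f2 : T -> R[i]) z (P : set (R[i] * R[i])) :
  ccvg F f1 z -> ccvg F f2 z -> cnbhs2 z P -> \forall x \near F, P (f1 x, f2 x).
Proof.
move=> h1 h2 [[A B] /= [hA hB] AB].
by apply: filterS2 (ccvg_near h1 hA) (ccvg_near h2 hB) => x Ax Bx; apply: (AB (f1 x, f2 x)).
Qed.

Lemma cnbhs_singleton z (A : set R[i]) : cnbhs z A -> A z.
Proof. by move=> [e e0]; apply; rewrite subrr cabs0. Qed.

Lemma ccvg_pairz z (q : R[i] * R[i] -> R[i]) l :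
  ccvg (cnbhs2 z) q l -> ccvg (cnbhs z) (fun x => q (x, z)) l.
Proof.
apply: (ccvg_pair2 (f1 := id) (f2 := fun=> z)); first exact: ccvg_id.
exact: ccvg_cst.
Qed.

Lemma near_pairz z (P : set (R[i] * R[i])) :
  cnbhs2 z P -> \forall x \near cnbhs z, P (x, z).
Proof.
apply: (near_pair2 (f1 := id) (f2 := fun=> z)); first exact: ccvg_id.
exact: ccvg_cst.
Qed.

Lemma sder_ccvg f z l : sder f z l -> ccvg (cnbhs z) f (f z).
Proof.
move=> [q ql fq].
have /= fqz := near_pairz fq.
have qz := ccvg_pairz ql.
have cz l' : ccvg (cnbhs z) (fun=> l') l' by exact: ccvg_cst.
have := ccvgD (cz (f z)) (ccvgM qz (ccvgB (@ccvg_id _ z) (cz z))).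
rewrite subrr mulr0 addr0 => H e e0; near=> x.
have -> : f x = f z + q (x, z) * (x - z) by rewrite -(near fqz x)// addrC subrK.
by near: x; exact: H.
Unshelve. all: by end_near. Qed.

Lemma sder_near f g z l : (\forall x \near cnbhs z, f x = g x) -> sder f z l -> sder g z l.
Proof.
move=> fg [q ql fq]; exists q => //; near=> p.
rewrite -(near (near_fst2 fg) p)// -(near (near_snd2 fg) p)//.
by near: p.
Unshelve. all: by end_near. Qed.

Lemma ccvg_comp2 (f : R[i] -> R[i]) z w (q : R[i] * R[i] -> R[i]) l :
  ccvg (cnbhs z) f w -> ccvg (cnbhs2 w) q l ->
  ccvg (cnbhs2 z) (fun p => q (f p.1, f p.2)) l.
Proof.
by move=> fz; apply: ccvg_pair2; [exact: (ccvg_fst2 fz)|exact: (ccvg_snd2 fz)].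
Qed.

Lemma near_comp2 (f : R[i] -> R[i]) z w (P : set (R[i] * R[i])) :
  ccvg (cnbhs z) f w -> cnbhs2 w P -> \forall p \near cnbhs2 z, P (f p.1, f p.2).
Proof.
by move=> fz; apply: near_pair2; [exact: (ccvg_fst2 fz)|exact: (ccvg_snd2 fz)].
Qed.

Lemma sder_cst c z : sder (fun=> c) z 0.
Proof. by exists (fun=> 0); [exact: ccvg_cst|near=> p; rewrite subrr mul0r]. Unshelve. all: by end_near. Qed.

Lemma sder_id z : sder id z 1.
Proof. by exists (fun=> 1); [exact: ccvg_cst|near=> p; rewrite mul1r]. Unshelve. all: by end_near. Qed.

Lemma sderD f g z l m : sder f z l -> sder g z m -> sder (fun x => f x + g x) z (l + m).
Proof.
move=> [q ql fq] [r rm gr]; exists (fun p => q p + r p); first exact: ccvgD.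
near=> p; rewrite mulrDl -(near fq p)// -(near gr p)//; ring.
Unshelve. all: by end_near. Qed.

Lemma sderM f g z l m : sder f z l -> sder g z m ->
  sder (fun x => f x * g x) z (l * g z + f z * m).
Proof.
move=> Df Dg; move: (Df) (Dg) => [q ql fq] [r rm gr].
exists (fun p => q p * (g \o snd) p + (f \o fst) p * r p).
  apply: ccvgD; apply: ccvgM => //.
    by apply: ccvg_snd2; exact: sder_ccvg Dg.
  by apply: ccvg_fst2; exact: sder_ccvg Df.
near=> p; rewrite mulrDl mulrAC -(near fq p)// -mulrA -(near gr p)//=; ring.
Unshelve. all: by end_near. Qed.

Lemma sderMl c f z l : sder f z l -> sder (fun x => c * f x) z (c * l).
Proof. by move=> /(sderM (sder_cst c z)); rewrite mul0r add0r. Qed.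

Lemma sderN f z l : sder f z l -> sder (fun x => - f x) z (- l).
Proof.
move=> /(sderMl (-1)); rewrite mulN1r; apply: sder_near.
by near=> x; rewrite mulN1r.
Unshelve. all: by end_near. Qed.

Lemma sderB f g z l m : sder f z l -> sder g z m -> sder (fun x => f x - g x) z (l - m).
Proof. by move=> Df /sderN; exact: sderD. Qed.

Lemma sder_comp f g z l m : sder f z l -> sder g (f z) m -> sder (g \o f) z (m * l).
Proof.
move=> Df; move: (Df) => [q ql fq] [r rm gr].
have fz := sder_ccvg Df.
exists (fun p => r (f p.1, f p.2) * q p).
  by apply: ccvgM => //; exact: ccvg_comp2 fz rm.
have gr' := near_comp2 fz gr.
near=> p; rewrite -mulrA -(near fq p)//=.
by have /= := near gr' p; apply.
Unshelve. all: by end_near. Qed.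

Lemma ccvg_neq0 (T : Type) (F : set_system T) {FF : Filter F} (f : T -> R[i]) l :
  l != 0 -> ccvg F f l -> \forall x \near F, f x != 0.
Proof.
rewrite -cabs_gt0 => l0 /ccvg_cabs h.
by apply: filterS (cvgr_gt (cabs l) h _ l0) => x; rewrite cabs_gt0.
Qed.

Lemma sderV f z l : f z != 0 -> sder f z l -> sder (fun x => (f x)^-1) z (- l / f z ^+ 2).
Proof.
move=> fz0 Df; move: (Df) => [q ql fq].
have fz := sder_ccvg Df.
have f1 := ccvg_fst2 fz; have f2 := ccvg_snd2 fz.
exists (fun p => - q p * ((f p.1)^-1 * (f p.2)^-1)).
  by rewrite expr2 invfM; apply: ccvgM; [exact: ccvgN|apply: ccvgM; exact: ccvgV].
have fn0 : \forall x \near cnbhs z, f x != 0 by exact: ccvg_neq0 fz0 fz.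
near=> p.
have p1 : f p.1 != 0 by near: p; exact: (near_fst2 fn0).
have p2 : f p.2 != 0 by near: p; exact: (near_snd2 fn0).
rewrite mulrAC mulNr -(near fq p)//; field.
by rewrite p1 p2.
Unshelve. all: by end_near. Qed.

(** The strict quotient of [g] at [(L x, L y)] tends to [m != 0], so near [z] it can be divided out.
    Continuity of the branch [L] replaces an inverse function theorem. *)
Lemma sder_lift g p L z l m : m != 0 -> ccvg (cnbhs z) L (L z) ->
  (\forall x \near cnbhs z, g (L x) = p x) ->
  sder p z l -> sder g (L z) m -> sder L z (l / m).
Proof.
move=> m0 Lz gL [q ql pq] [r rm gr].
have rL := ccvg_comp2 Lz rm; have grL := near_comp2 Lz gr.
exists (fun p => q p * (r (L p.1, L p.2))^-1).
  by apply: ccvgM => //; exact: ccvgV.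
near=> x.
have r0 : r (L x.1, L x.2) != 0 by near: x; exact: ccvg_neq0 rL.
apply: (mulfI r0); have /= <- := near grL x; last by [].
rewrite (near (near_fst2 gL) x)// (near (near_snd2 gL) x)// (near pq x)//.
by field.
Unshelve. all: by end_near. Qed.

Lemma near_neq z (A : set R[i]) : cnbhs z A -> exists2 x, x != z & A x.
Proof.
move=> [e e0 eA]; exists (z + (e / 2)%:C).
  by rewrite -subr_eq0 addrAC subrr add0r -cabs_gt0 cabs_realp; lra.
by apply: eA; rewrite addrAC subrr add0r cabs_realp; lra.
Qed.

Lemma sder_unique f z l m : sder f z l -> sder f z m -> l = m.
Proof.
move=> [q ql fq] [r rm fr].
have fq' := near_pairz fq; have fr' := near_pairz fr.
have ql' := ccvg_pairz ql; have rm' := ccvg_pairz rm.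
apply/eqP; rewrite -subr_eq0 -cabs_eq0 eq_le cabs_ge0 andbT.
apply/ler_addgt0Pr => e e0; rewrite add0r.
have e20 : 0 < e / 2 by rewrite divr_gt0.
have [x xz [[h1 h2] [h3 h4]]] :=
  near_neq (filterI (filterI fq' fr') (filterI (ql' _ e20) (rm' _ e20))).
have E : q (x, z) = r (x, z).
  have xz0 : x - z != 0 by rewrite subr_eq0.
  by apply: (mulIf xz0); rewrite /= in h1 h2; rewrite -h1 -h2.
have := cabs_distD (q (x, z)) l m; rewrite (cabsB l (q (x, z))).
by rewrite /= {1}E in h3 h4 *; rewrite -E in h3 h4 *; lra.
Qed.

(** The quotient that is strict at [z] also serves at nearby points [x]: off the diagonal it agrees
    with the quotient at [x], whose limit is [f1 x]. *)
Lemma sder_cvg_deriv f (f1 : R[i] -> R[i]) z :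
  (\forall x \near cnbhs z, sder f x (f1 x)) -> ccvg (cnbhs z) f1 (f1 z).
Proof.
move=> Df e e0; have e20 : 0 < e / 2 by rewrite divr_gt0.
have [q ql fq] := cnbhs_singleton Df.
have [[A B] /= [[a a0 hA] [b b0 hB]] AB] := filterI fq (ql _ e20).
have c0 : 0 < Num.min a b by rewrite lt_min a0.
move: Df => [d d0 Df].
exists (Num.min d (Num.min a b)); first by rewrite lt_min d0.
move=> x; rewrite !lt_min => /and3P[/Df [r rm fr] xa xb].
have fr' := near_pairz fr; have rm' := ccvg_pairz rm.
have nA : cnbhs x A.
  exists (a - cabs (x - z)); first by rewrite subr_gt0.
  move=> y yx; apply: hA; apply: le_lt_trans (cabs_distD x _ _) _.
  by rewrite -ltrBrDr.
have [y yx [Ay [h1 h2]]] := near_neq (filterI nA (filterI fr' (rm' _ e20))).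
have [] := AB (y, x) (conj Ay (hB _ xb)) => /= h3 h4.
have E : q (y, x) = r (y, x).
  have yx0 : y - x != 0 by rewrite subr_eq0.
  by apply: (mulIf yx0); rewrite /= in h1; rewrite -h1 -h3.
rewrite /= -E in h2.
have := cabs_distD (q (y, x)) (f1 x) (f1 z); rewrite (cabsB (f1 x) (q (y, x))).
by lra.
Qed.

Lemma sderX f z l n : sder f z l -> sder (fun x => f x ^+ n) z (n%:R * f z ^+ n.-1 * l).
Proof.
move=> Df; elim: n => [|n ih].
  by rewrite mul0r mul0r; apply: sder_near (sder_cst 1 z); near=> x; rewrite expr0.
have := sderM Df ih; rewrite /=.
have -> : l * f z ^+ n + f z * (n%:R * f z ^+ n.-1 * l) = n.+1%:R * f z ^+ n * l.
  case: n {ih} => [|n]; first by rewrite expr0; ring.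
  by rewrite /= exprS -[in RHS]natr1; ring.
by apply: sder_near; near=> x; rewrite exprS.
Unshelve. all: by end_near. Qed.

End StrictDerivative.

(** * Holomorphic functions *)

Section Holomorphic.
Context {R : realType}.
Implicit Types (f g h : R[i] -> R[i]) (z w l m : R[i]) (U V : set R[i]).

Definition copen U := forall z, U z -> cnbhs z U.

Definition cder f z : R[i] := xget 0 [set l | sder f z l].

Lemma cder_eq f z l : sder f z l -> cder f z = l.
Proof.
move=> Df; apply: (sder_unique _ Df).
exact: (@xgetPex _ 0 [set l | sder f z l] (ex_intro _ l Df)).
Qed.

(* Two strict derivatives are all that is needed of a holomorphic function. *)
Definition hol U f := forall z, U z ->
  sder f z (cder f z) /\ sder (cder f) z (cder (cder f) z).

Lemma hol_intro U f (f1 : R[i] -> R[i]) : copen U ->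
  (forall z, U z -> sder f z (f1 z)) ->
  (forall z, U z -> exists l, sder f1 z l) -> hol U f.
Proof.
move=> oU Df Df1 z Uz.
have E : \forall x \near cnbhs z, f1 x = cder f x.
  by apply: filterS (oU _ Uz) => x Ux; rewrite (cder_eq (Df _ Ux)).
split; first by rewrite (cder_eq (Df _ Uz)); exact: Df.
have [l /(sder_near E) h] := Df1 _ Uz.
by rewrite (cder_eq h).
Qed.

Lemma hol_sder U f z : hol U f -> U z -> sder f z (cder f z).
Proof. by move=> h /h []. Qed.

Lemma hol_sder2 U f z : hol U f -> U z -> sder (cder f) z (cder (cder f) z).
Proof. by move=> h /h []. Qed.

Lemma hol_ccvg U f z : hol U f -> U z -> ccvg (cnbhs z) f (f z).
Proof. by move=> h Uz; exact: (sder_ccvg (hol_sder h Uz)). Qed.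

Lemma holS U V f : U `<=` V -> hol V f -> hol U f.
Proof. by move=> UV h z /UV /h. Qed.

Lemma hol_congr U f g : copen U -> (forall z, U z -> f z = g z) -> hol U f -> hol U g.
Proof.
move=> oU fg hf; apply: (@hol_intro _ _ (cder f)) => // z Uz.
  apply: sder_near (hol_sder hf Uz).
  by apply: filterS (oU _ Uz) => x /fg.
by eexists; exact: hol_sder2 hf Uz.
Qed.

Lemma copenT : copen setT. Proof. by move=> z _; exact: filterT. Qed.

Lemma hol_cst U c : copen U -> hol U (fun=> c).
Proof.
move=> oU; apply: (@hol_intro _ _ (fun=> 0)) => // z Uz; first exact: sder_cst.
by exists 0; exact: sder_cst.
Qed.

Lemma hol_id U : copen U -> hol U id.
Proof.
move=> oU; apply: (@hol_intro _ _ (fun=> 1)) => // z Uz; first exact: sder_id.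
by exists 0; exact: sder_cst.
Qed.

Lemma holD U f g : copen U -> hol U f -> hol U g -> hol U (fun x => f x + g x).
Proof.
move=> oU hf hg; apply: (@hol_intro _ _ (fun x => cder f x + cder g x)) => // z Uz.
  by apply: sderD; [exact: hol_sder hf Uz|exact: hol_sder hg Uz].
by eexists; apply: sderD; [exact: hol_sder2 hf Uz|exact: hol_sder2 hg Uz].
Qed.

Lemma holM U f g : copen U -> hol U f -> hol U g -> hol U (fun x => f x * g x).
Proof.
move=> oU hf hg.
apply: (@hol_intro _ _ (fun x => cder f x * g x + f x * cder g x)) => // z Uz.
  by apply: sderM; [exact: hol_sder hf Uz|exact: hol_sder hg Uz].
eexists; apply: sderD; apply: sderM.
- exact: hol_sder2 hf Uz.
- exact: hol_sder hg Uz.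
- exact: hol_sder hf Uz.
- exact: hol_sder2 hg Uz.
Qed.

Lemma holN U f : copen U -> hol U f -> hol U (fun x => - f x).
Proof.
move=> oU hf; have := holM oU (hol_cst (-1) oU) hf.
by apply: hol_congr => // z _; rewrite mulN1r.
Qed.

Lemma holB U f g : copen U -> hol U f -> hol U g -> hol U (fun x => f x - g x).
Proof. by move=> oU hf hg; apply: holD => //; exact: holN. Qed.

Lemma holX U f n : copen U -> hol U f -> hol U (fun x => f x ^+ n).
Proof.
move=> oU hf; elim: n => [|n ih].
  by apply: hol_congr (hol_cst 1 oU) => // z _; rewrite expr0.
by apply: hol_congr (holM oU hf ih) => // z _; rewrite exprS.
Qed.

Lemma holV U f : copen U -> (forall z, U z -> f z != 0) -> hol U f ->
  hol U (fun x => (f x)^-1).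
Proof.
move=> oU f0 hf.
apply: (@hol_intro _ _ (fun x => - cder f x * ((f x) ^+ 2)^-1)) => // z Uz.
  by apply: sderV; [exact: f0|exact: hol_sder hf Uz].
have Df := hol_sder hf Uz.
eexists; apply: sderM; first by apply: sderN; exact: hol_sder2 hf Uz.
by apply: sderV; [rewrite expf_neq0// f0|exact: sderX Df].
Qed.

Lemma hol_comp U V f g : copen U -> (forall z, U z -> V (f z)) ->
  hol U f -> hol V g -> hol U (g \o f).
Proof.
move=> oU UV hf hg.
apply: (@hol_intro _ _ (fun x => (cder g \o f) x * cder f x)) => // z Uz.
  by apply: sder_comp; [exact: hol_sder hf Uz|exact: hol_sder hg (UV _ Uz)].
eexists; apply: sderM; last exact: hol_sder2 hf Uz.
by apply: sder_comp; [exact: hol_sder hf Uz|exact: hol_sder2 hg (UV _ Uz)].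
Qed.

Lemma cder_comp U V f g z : (forall z, U z -> V (f z)) ->
  hol U f -> hol V g -> U z -> cder (g \o f) z = cder g (f z) * cder f z.
Proof.
move=> UV hf hg Uz; apply: cder_eq.
by apply: sder_comp; [exact: hol_sder hf Uz|exact: hol_sder hg (UV _ Uz)].
Qed.

(** Serves for logarithms, with [g] the exponential, and for square roots, with [g] the square: a
    continuous branch is already holomorphic. *)
Lemma hol_lift U V g p L : copen U -> (forall z, U z -> V (L z)) ->
  hol U p -> hol V g -> (forall z, U z -> cder g (L z) != 0) ->
  (forall z, U z -> ccvg (cnbhs z) L (L z)) ->
  (forall z, U z -> g (L z) = p z) -> hol U L.
Proof.
move=> oU UV hp hg g0 Lc gL.
have DL z : U z -> sder L z (cder p z / cder g (L z)).
  move=> Uz; apply: (sder_lift (g := g) (p := p)) => //.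
  - exact: g0.
  - exact: Lc.
  - by apply: filterS (oU _ Uz) => x; exact: gL.
  - exact: hol_sder hp Uz.
  - exact: hol_sder hg (UV _ Uz).
apply: (@hol_intro _ _ (fun z => cder p z * ((cder g \o L) z)^-1)) => // z Uz.
eexists; apply: sderM; first exact: hol_sder2 hp Uz.
apply: sderV; first exact: g0.
by apply: sder_comp; [exact: DL|exact: hol_sder2 hg (UV _ Uz)].
Qed.

End Holomorphic.

(** * The complex exponential *)

Section Exponential.
Context {R : realType}.
Implicit Types (z w : R[i]) (x y t : R).

Definition cexp z : R[i] := (expR (complex.Re z))%:C * cis (complex.Im z).

Lemma cisD x y : cis (x + y) = cis x * cis y.
Proof. by rewrite /cis cosD sinD; simpc; rewrite [_ + sin x * _]addrC. Qed.
Lemma cis0 : cis 0 = 1 :> R[i]. Proof. by rewrite /cis cos0 sin0. Qed.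
Lemma cabs_cis t : cabs (cis t) = 1.
Proof. by rewrite cabsE /= cos2Dsin2 sqrtr1. Qed.
Lemma cexp0 : cexp 0 = 1. Proof. by rewrite /cexp /= expR0 cis0 mulr1. Qed.
Lemma cexpD z w : cexp (z + w) = cexp z * cexp w.
Proof. by rewrite /cexp cReD cImD expRD rmorphM cisD mulrACA. Qed.
Lemma cabs_cexp z : cabs (cexp z) = expR (complex.Re z).
Proof. by rewrite cabsM cabs_cis mulr1 cabs_realp// expR_ge0. Qed.
Lemma cexp_neq0 z : cexp z != 0. Proof. by rewrite -cabs_gt0 cabs_cexp expR_gt0. Qed.
Lemma cexpN z : cexp (- z) = (cexp z)^-1.
Proof. by apply: (mulfI (cexp_neq0 z)); rewrite -cexpD subrr cexp0 mulfV ?cexp_neq0. Qed.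
Lemma derive_little_o (f : R -> R) (x l : R) : is_derive x 1 f l ->
  forall e, 0 < e -> \forall h \near 0, `|f (x + h) - f x - l * h| <= e * `|h|.
Proof.
move=> Df e e0.
have /derivable_nbhs : derivable f x 1 by [].
rewrite derive_val => /eqaddoP /(_ e e0).
apply: filterS => h.
rewrite -![(_ + _ : _ -> _) _]/(_ + _) -![(- _ : _ -> _) _]/(- _) /cst /=.
by rewrite scaler1 opprD addrA (addrC h) [h *: l]mulrC.
Qed.

Lemma cexp_quot : ccvg (cnbhs (0 : R[i]))
  (fun h => if h == 0 then 1 else (cexp h - 1) / h) 1.
Proof.
(* The error is split into six shares of [e / 6]: each of the real and imaginary parts costs two
   shares for the trigonometric error, multiplied by [expR x <= 2], and one for the exponential. *)
move=> e e0; have e60 : 0 < e / 6 by rewrite divr_gt0.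
have rex : complex.Re (h : R[i]) @[h --> cnbhs 0] --> (0 : R).
  exact: (ccvg_Re (ccvg_id 0)).
have imx : complex.Im (h : R[i]) @[h --> cnbhs 0] --> (0 : R).
  exact: (ccvg_Im (ccvg_id 0)).
have E1 := derive_little_o (is_derive_expR 0) e60.
have C1 := derive_little_o (is_derive_cos 0) e60.
have S1 := derive_little_o (is_derive_sin 0) e60.
have E2 : \forall x \near (0 : R), `|expR x - expR 0| < Num.min 1 (e / 6).
  have /cvgrPdist_lt := @continuous_expR R 0.
  move=> /(_ (Num.min 1 (e / 6))); rewrite lt_min e60 ltr01 => /(_ isT).
  by apply: filterS => x; rewrite distrC.
near=> h; have [_|h0] := eqVneq h 0; first by rewrite subrr cabs0.
have -> : (cexp h - 1) / h - 1 = (cexp h - 1 - h) / h by field; rewrite h0.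
rewrite cabsM cabsV ltr_pdivrMr ?cabs_gt0//.
set x := complex.Re h; set y := complex.Im h.
have xh : `|x| <= cabs h := Re_le_cabs h; have yh : `|y| <= cabs h := Im_le_cabs h.
have h1 : 0 < cabs h by rewrite cabs_gt0.
have : `|expR (0 + x) - expR 0 - expR 0 * x| <= e / 6 * `|x|.
  by rewrite /x; near: h; exact: (rex _ E1).
have : `|cos (0 + y) - cos 0 - (- sin 0) * y| <= e / 6 * `|y|.
  by rewrite /y; near: h; exact: (imx _ C1).
have : `|sin (0 + y) - sin 0 - (cos 0) * y| <= e / 6 * `|y|.
  by rewrite /y; near: h; exact: (imx _ S1).
have : `|expR x - expR 0| < Num.min 1 (e / 6).
  by rewrite /x; near: h; exact: (rex _ E2).
rewrite !add0r expR0 cos0 sin0 oppr0 mul0r !mul1r ?subr0 ?addr0 lt_min => /andP[F1 F2] S C E.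
apply: (le_lt_trans (cabs_le_ReIm _)).
have -> : complex.Re (cexp h - 1 - h) =
    expR x * (cos y - 1) + (expR x - 1 - x).
  by rewrite !cReD !cReN /cexp cReM /= -/x -/y; ring.
have -> : complex.Im (cexp h - 1 - h) =
    expR x * (sin y - y) + (expR x - 1) * y.
  by rewrite !cImD !cImN /cexp cImM /= -/x -/y; ring.
have X2 : `|expR x| <= 2.
  rewrite ger0_norm ?expR_ge0//; have := ler_norm (expR x - 1); lra.
have e6 : 0 <= e / 6 by lra.
have B1 : `|expR x * (cos y - 1)| <= 2 * (e / 6 * cabs h).
  by rewrite normrM ler_pM// (le_trans C)// ler_wpM2l.
have B2 : `|expR x - 1 - x| <= e / 6 * cabs h.
  by rewrite (le_trans E)// ler_wpM2l.
have B3 : `|expR x * (sin y - y)| <= 2 * (e / 6 * cabs h).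
  by rewrite normrM ler_pM// (le_trans S)// ler_wpM2l.
have B4 : `|(expR x - 1) * y| < e / 6 * cabs h.
  rewrite normrM (@le_lt_trans _ _ (`|expR x - 1| * cabs h))//.
    by rewrite ler_wpM2l.
  by rewrite ltr_pM2r.
have := ler_normD (expR x * (cos y - 1)) (expR x - 1 - x).
have := ler_normD (expR x * (sin y - y)) ((expR x - 1) * y).
have -> : e * cabs h = 6 * (e / 6 * cabs h) by field.
move: B1 B2 B3 B4; set k := e / 6 * cabs h; lra.
Unshelve. all: by end_near. Qed.

Lemma sder_cexp z : sder cexp z (cexp z).
Proof.
set q := fun h : R[i] => if h == 0 then 1 else (cexp h - 1) / h.
(* Continuity comes first because the strict quotient given below contains the factor [cexp p.2]. *)
have cz : ccvg (cnbhs z) cexp (cexp z).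
  have dz : ccvg (cnbhs z) (fun w => w - z) 0.
    rewrite -[X in ccvg _ _ X](subrr z).
    by apply: ccvgB; [exact: ccvg_id|exact: ccvg_cst].
  have q1 : ccvg (cnbhs z) (fun w => q (w - z)) 1.
    exact: ccvg_comp dz cexp_quot.
  have c1 (l : R[i]) : ccvg (cnbhs z) (fun=> l) l by exact: ccvg_cst.
  have H : ccvg (cnbhs z) (fun w => cexp z * (1 + (w - z) * q (w - z)))
      (cexp z * (1 + 0 * 1)).
    exact: ccvgM (c1 _) (ccvgD (c1 _) (ccvgM dz q1)).
  move: H; rewrite mul0r addr0 mulr1.
  have -> // : (fun w => cexp z * (1 + (w - z) * q (w - z))) = cexp.
  apply/funext => w; rewrite /q; case: eqVneq => [/eqP|h].
    by rewrite subr_eq0 => /eqP ->; rewrite subrr mul0r addr0 mulr1.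
  by rewrite mulrCA mulfV// mulr1 addrC subrK -cexpD addrC subrK.
exists (fun p => cexp p.2 * q (p.1 - p.2)); last first.
  near=> p; rewrite /q; case: eqVneq => [/eqP|h].
    by rewrite subr_eq0 => /eqP ->; rewrite !subrr mulr0.
  rewrite -mulrA divfK// mulrBr mulr1 -cexpD; congr (cexp _ - _); ring.
rewrite -[X in ccvg _ _ X]mulr1; apply: ccvgM; first exact: (ccvg_snd2 cz).
have i := @ccvg_id _ z.
have dz : ccvg (cnbhs2 z) (fun p => p.1 - p.2) 0.
  rewrite -[X in ccvg _ _ X](subrr z).
  by apply: ccvgB; [exact: (ccvg_fst2 i)|exact: (ccvg_snd2 i)].
exact: ccvg_comp dz cexp_quot.
Unshelve. all: by end_near. Qed.

Lemma cder_cexp z : cder cexp z = cexp z. Proof. exact: cder_eq (sder_cexp z). Qed.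

Lemma hol_cexp U : copen U -> hol U cexp.
Proof.
move=> oU; apply: (@hol_intro _ _ _ cexp) => // z _; first exact: sder_cexp.
by exists (cexp z); exact: sder_cexp.
Qed.

End Exponential.

(** * The principal logarithm on the slit plane *)

Section Logarithm.
Context {R : realType}.
Implicit Types (z w : R[i]) (x y t : R).

(* The plane without the half-line of nonpositive reals. *)
Definition slit : set R[i] := [set z | 0 < cabs z + complex.Re z].

(* The half-angle formula [arg z = 2 atan (y / (|z| + x))]. *)
Definition cLog z : R[i] :=
  ln (cabs z) +i* (2 * atan (complex.Im z / (cabs z + complex.Re z))).

Lemma slit_neq0 z : slit z -> z != 0.
Proof. by rewrite /slit /=; apply: contraTneq => ->; rewrite cabs0 addr0 ltxx. Qed.

Lemma Re_gt0_slit z : 0 < complex.Re z -> slit z.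
Proof. by move=> h; rewrite /slit /= ltr_wpDl ?cabs_ge0. Qed.

Lemma cLogK z : slit z -> cexp (cLog z) = z.
Proof.
move=> sz; have z0 := slit_neq0 sz.
have r0 : 0 < cabs z by rewrite cabs_gt0.
rewrite /cexp /= lnK ?posrE//; move: sz; rewrite /slit /=.
have := cabs_sq z; case: z z0 r0 => x y /= _; set r := cabs _ => r0 r2 s0.
set t := y / (r + x); set a := atan t.
have ca : cos a != 0.
  rewrite gt_eqF// cos_gt0_pihalf// atan_ltpi2 andbT.
  exact: atan_gtNpi2.
(* From [tan a = y / (r + x)] and [r^2 = x^2 + y^2], the sum [1 + tan^2 a] equals [2 r / (r + x)];
   doubling the angle then gives [x / r] and [y / r]. *)
have c2 : cos a ^+ 2 = (r + x) / (2 * r).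
  apply: invr_inj; rewrite cos2_tan2// atanK invf_div /t expr_div_n.
  apply: (@mulfI _ ((r + x) ^+ 2)); first by rewrite expf_neq0// gt_eqF.
  have -> : (r + x) ^+ 2 * (1 + y ^+ 2 / (r + x) ^+ 2) = r ^+ 2 + 2 * r * x + (x ^+ 2 + y ^+ 2).
    by field; rewrite gt_eqF.
  by rewrite -r2; field; rewrite gt_eqF.
have sc : sin a = t * cos a by rewrite -[t]atanK /tan divfK.
have E : cis (2 * a) = (x / r) +i* (y / r).
  rewrite mulr_natl /cis cos_mulr2n sin_mulr2n sc; congr (_ +i* _).
    by rewrite c2; field; rewrite gt_eqF.
  have -> : (cos a * (t * cos a)) *+ 2 = 2 * t * cos a ^+ 2 by rewrite -mulr_natl; ring.
  by rewrite c2 /t; field; rewrite !gt_eqF.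
by rewrite E; simpc; rewrite !(mulrC r) !divfK ?gt_eqF.
Qed.

Lemma Im_cLog z : - pi < complex.Im (cLog z) < pi.
Proof.
rewrite /=; set a := atan _.
have := atan_gtNpi2 (complex.Im z / (cabs z + complex.Re z)).
have := atan_ltpi2 (complex.Im z / (cabs z + complex.Re z)).
rewrite -/a => h1 h2; apply/andP; split; lra.
Qed.

Lemma Re_cLog z : complex.Re (cLog z) = ln (cabs z). Proof. by []. Qed.

Lemma cLog_polar z : slit z -> z = (cabs z)%:C * cis (complex.Im (cLog z)).
Proof.
move=> sz; rewrite -[LHS]cLogK// /cexp Re_cLog lnK// posrE cabs_gt0.
exact: slit_neq0.
Qed.

Lemma carg_cLog z : slit z -> carg z = complex.Im (cLog z).
Proof.
move=> sz; rewrite [in LHS](cLog_polar sz) carg_polar//.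
  by rewrite cabs_gt0 slit_neq0.
by case/andP: (Im_cLog z) => -> /ltW ->.
Qed.

(** [|z| + Re z = |z| (1 + cos (arg z))], which vanishes only for the argument [pi]. This links the
    argument used by the sectors with the slit plane. *)
Lemma carg_slit z : z != 0 -> `|carg z| < pi -> slit z.
Proof.
move=> z0 h; rewrite /slit /=; have [_ E] := cargP z0.
rewrite [X in _ + complex.Re X]E cReM /= mul0r subr0 -[X in X + _]mulr1 -mulrDr.
rewrite mulr_gt0 ?cabs_gt0//; move: h; rewrite -cos_norm => h.
rewrite -ltrBlDl sub0r -cospi; have p0 := pi_gt0 R.
by rewrite ltr_cos ?in_itv/= ?normr_ge0 ?(ltW h) ?lexx ?(ltW p0).
Qed.

(** The half-angle formula pays off here: it is one composition of continuous functions, without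
    cases by quadrant. *)
Lemma ccvg_cLog z : slit z -> ccvg (cnbhs z) cLog (cLog z).
Proof.
move=> sz; have z0 := slit_neq0 sz; have i := @ccvg_id _ z.
have cz : cabs x @[x --> cnbhs z] --> cabs z by exact: ccvg_cabs.
have rz : complex.Re x @[x --> cnbhs z] --> complex.Re z by exact: ccvg_Re.
have iz : complex.Im x @[x --> cnbhs z] --> complex.Im z by exact: ccvg_Im.
apply: ccvg_ReIm.
  have lz : {for cabs z, continuous (@ln R)}.
    by apply: continuous_ln; rewrite cabs_gt0.
  exact: continuous_cvg lz cz.
apply: cvgM; first exact: cvg_cst.
apply: (continuous_cvg _ (@continuous_atan R _)).
apply: cvgM => //; apply: cvgV; last exact: cvgD.
by rewrite gt_eqF.
Qed.

Lemma copen_slit : copen slit.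
Proof.
move=> z sz; have i := @ccvg_id _ z.
exact: (cvgr_gt _ (cvgD (ccvg_cabs i) (ccvg_Re i)) _ sz).
Qed.

Lemma hol_cLog : hol slit cLog.
Proof.
apply: (hol_lift (V := setT) (g := cexp) (p := id)) => //.
- exact: copen_slit.
- exact: hol_id copen_slit.
- exact: hol_cexp (@copenT R).
- by move=> z _; rewrite cder_cexp cexp_neq0.
- exact: ccvg_cLog.
- exact: cLogK.
Qed.

Lemma cder_cLog z : slit z -> cder cLog z = z^-1.
Proof.
move=> sz; apply: cder_eq.
rewrite -[z^-1]mul1r -[X in _ / X](cLogK sz).
apply: (sder_lift (g := cexp) (p := id)); rewrite ?cexp_neq0//.
- exact: ccvg_cLog.
- by apply: filterS (copen_slit sz) => x; exact: cLogK.
- exact: sder_id.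
- exact: sder_cexp.
Qed.

Lemma cLog_cexp w : - pi < complex.Im w < pi -> cLog (cexp w) = w.
Proof.
move=> /andP[w1 w2]; have c0 := cexp_neq0 w.
have A : carg (cexp w) = complex.Im w.
  by rewrite /cexp carg_polar ?expR_gt0// w1 ltW.
have sw : slit (cexp w) by apply: carg_slit => //; rewrite A ltr_norml w1.
have := carg_cLog sw; rewrite A; move=> E.
rewrite [LHS]complexE Re_cLog -E cabs_cexp expRK -complexE.
by [].
Qed.

Lemma cLogM z w : slit z -> slit w ->
  - pi < complex.Im (cLog z) + complex.Im (cLog w) < pi ->
  cLog (z * w) = cLog z + cLog w.
Proof.
move=> sz sw h; rewrite -[in LHS](cLogK sz) -[in LHS](cLogK sw) -cexpD.
by rewrite cLog_cexp// cImD.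
Qed.

Lemma Im_cLog_Re_gt0 z : 0 < complex.Re z -> `|complex.Im (cLog z)| < pi / 2.
Proof.
move=> z0; have sz := Re_gt0_slit z0.
rewrite -carg_cLog// ltNge; apply/negP => h.
have p0 := pi_gt0 R.
have [/andP[a1 a2] E] := cargP (slit_neq0 sz).
have ap : `|carg z| <= pi by rewrite ler_norml a2 ltW.
move: z0; rewrite [z in complex.Re z]E cReM /= mul0r subr0.
rewrite pmulr_rgt0 ?cabs_gt0 ?slit_neq0// -cos_norm -cos_pihalf.
rewrite ltr_cos ?in_itv/= ?normr_ge0 ?ap//; first by rewrite ltNge h.
by apply/andP; split; lra.
Qed.

End Logarithm.

(** * Holomorphic functions along real lines *)

Section Lines.
Context {R : realType}.
Implicit Types (f : R[i] -> R[i]) (z e l : R[i]) (s t : R).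

Lemma is_derive_line f z e l t : sder f (z + t%:C * e) l ->
  is_derive t 1 (fun s => complex.Re (f (z + s%:C * e))) (complex.Re (l * e)) /\
  is_derive t 1 (fun s => complex.Im (f (z + s%:C * e))) (complex.Im (l * e)).
Proof.
move=> [q ql fq]; set w := z + t%:C * e in ql fq.
have cw : ccvg (0 : R)^' (fun h : R => z + (h + t)%:C * e) w.
  have -> : w = z + (0 + t)%:C * e by rewrite add0r.
  apply: ccvgD; first exact: ccvg_cst.
  apply: ccvgM; last exact: ccvg_cst.
  apply: ccvg_real; apply: cvgD; last exact: cvg_cst.
  exact: cvg_within.
have cc : ccvg (0 : R)^' (fun h : R => w) w by exact: ccvg_cst.
have ql' : ccvg (0 : R)^' (fun h : R => q (z + (h + t)%:C * e, w)) l.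
  exact: ccvg_pair2 cw cc ql.
have qle : ccvg (0 : R)^' (fun h : R => q (z + (h + t)%:C * e, w) * e) (l * e).
  by apply: ccvgM ql' _; exact: ccvg_cst.
have fq' : \forall h \near (0 : R)^', f (z + (h + t)%:C * e) - f w =
    h%:C * (q (z + (h + t)%:C * e, w) * e).
  have H : \forall h \near (0 : R)^', f (z + (h + t)%:C * e) - f w =
      q (z + (h + t)%:C * e, w) * (z + (h + t)%:C * e - w).
    exact: near_pair2 cw cc fq.
  by apply: filterS H => h ->; rewrite /w rmorphD /=; ring.
(* [g] is the real or the imaginary part; only its compatibility with differences and real factors
   matters. *)
have E (g : R[i] -> R) : (forall x y, g (x - y) = g x - g y) ->
    (forall s x, g (s%:C * x) = s * g x) ->
    (fun h : R => g (q (z + (h + t)%:C * e, w) * e)) @ (0 : R)^' --> g (l * e) ->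
    is_derive t 1 (fun s => g (f (z + s%:C * e))) (g (l * e)).
  move=> gB gM cg.
  have cg2 : (fun h : R => h^-1 *: (((fun s => g (f (z + s%:C * e))) \o shift t)
      (h *: (1 : R)) - g (f (z + t%:C * e)))) @ (0 : R)^' --> g (l * e).
    apply: cvg_trans cg; apply: near_eq_cvg.
    have h0 : \forall h \near (0 : R)^', h != 0 by exact: nbhs_dnbhs_neq.
    apply: filterS2 fq' h0 => h fh h0.
    rewrite /= scaler1 -gB fh gM.
    by rewrite [h^-1 *: _]mulrA mulVf ?mul1r.
  split; first by apply/cvg_ex; exists (g (l * e)).
  exact: cvg_lim.
split; apply: E.
- by move=> x y; rewrite cReD cReN.
- by move=> s x; rewrite cReM /= mul0r subr0.
- exact: ccvg_Re.
- by move=> x y; rewrite cImD cImN.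
- by move=> s x; rewrite cImM /= mul0r addr0.
- exact: ccvg_Im.
Qed.

(** If [c > 0], the expansion of [df] at 0 with error [c / 2] makes [df] positive on some interval
    [(0, h)], and the mean value theorem then gives [f h > f 0]. *)
Lemma second_derivative_max (f df : R -> R) (d c : R) : 0 < d ->
  (forall t, t \in `]-d, d[ -> is_derive t 1 f (df t)) -> is_derive (0 : R) 1 df c ->
  (forall t, t \in `]-d, d[ -> f t <= f 0) -> c <= 0.
Proof.
move=> d0 Df Ddf fmax; rewrite leNgt; apply/negP => c0.
have i0 : (0 : R) \in `]-d, d[ by rewrite in_itv /= oppr_lt0 d0.
have df0 : df 0 = 0.
  have dm : - d <= d by lra.
  have H : is_derive (0 : R) 1 f 0.
    by apply: (derive1_at_max dm) => // t /Df ?; exact: ex_derive.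
  have H2 := Df 0 i0.
  by rewrite -(@derive_val _ _ _ _ _ _ _ H2) (@derive_val _ _ _ _ _ _ _ H).
have c20 : 0 < c / 2 by rewrite divr_gt0.
have /nbhs_ballP[r /= r0 hr] := derive_little_o Ddf c20.
have [h [h0 hd hr2]] : exists h : R, [/\ 0 < h, h <= d / 2 & h <= r / 2].
  exists (Num.min (d / 2) (r / 2)).
  by rewrite lt_min !divr_gt0// !ge_min !lexx orbT.
have ih t : 0 <= t <= h -> t \in `]-d, d[.
  move=> /andP[t1 t2]; rewrite in_itv /=; apply/andP; split; lra.
have D1 x : x \in `]0, h[ -> is_derive x 1 f (df x).
  rewrite in_itv /= => /andP[x1 x2]; apply: Df; apply: ih.
  by rewrite !ltW.
have C1 : {within `[0, h], continuous f}.
  apply: derivable_within_continuous => t; rewrite in_itv /= => /ih /Df ?.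
  exact: ex_derive.
have [x xh E] := MVT h0 D1 C1.
move: xh; rewrite in_itv /= => /andP[x1 x2].
have : `|df (0 + x) - df 0 - c * x| <= c / 2 * `|x|.
  apply: hr; rewrite /ball /= sub0r normrN gtr0_norm//; lra.
rewrite add0r df0 subr0 (gtr0_norm x1) ler_norml => /andP[A _].
have dx : 0 < df x by have := mulr_gt0 c20 x1; lra.
have fh : f h <= f 0 by apply: fmax; apply: ih; rewrite lexx ltW.
have := mulr_gt0 dx h0; move: E; rewrite subr0 => <-; lra.
Qed.

End Lines.

(** * Maximum modulus and the Schwarz lemma *)

Section MaximumModulus.
Context {R : realType}.
Implicit Types (k h : R[i] -> R[i]) (z e : R[i]) (U : set R[i]) (K : set (R * R)).

(** The Laplacian of [|k|^2 + eps |z|^2] is [4 |k'|^2 + 4 eps > 0]: in the sum of the second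
    derivatives along 1 and ['i] the terms in [k''] cancel, since ['i^2 = -1]. The summand with
    [eps] keeps it positive where [k' = 0]. *)
Lemma subharmonic_max U k z (eps d : R) : hol U k -> 0 < eps -> 0 < d ->
  (forall w, cabs (w - z) < d -> U w /\
     cabs (k w) ^+ 2 + eps * cabs w ^+ 2 <= cabs (k z) ^+ 2 + eps * cabs z ^+ 2) ->
  False.
Proof.
move=> hk e0 d0 H.
have S e : cabs e = 1 ->
  2 * (cabs (cder k z * e) ^+ 2 +
       complex.Re (k z) * complex.Re (cder (cder k) z * e * e) +
       complex.Im (k z) * complex.Im (cder (cder k) z * e * e) + eps) <= 0.
  move=> e1.
  have nz (t : R) : t \in `]-d, d[ -> cabs (z + t%:C * e - z) < d.
    rewrite in_itv /= => /andP[t1 t2].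
    by rewrite addrAC subrr add0r cabsM e1 mulr1 cabs_real ltr_norml t1.
  pose u t := complex.Re (k (z + t%:C * e)); pose v t := complex.Im (k (z + t%:C * e)).
  pose u1 t := complex.Re (cder k (z + t%:C * e) * e).
  pose v1 t := complex.Im (cder k (z + t%:C * e) * e).
  pose x t := complex.Re z + t * complex.Re e.
  pose y t := complex.Im z + t * complex.Im e.
  pose W t := u t ^+ 2 + v t ^+ 2 + eps * (x t ^+ 2 + y t ^+ 2).
  have WE t : W t = cabs (k (z + t%:C * e)) ^+ 2 + eps * cabs (z + t%:C * e) ^+ 2.
    by rewrite !cabs_sq !cReD !cImD !cReM !cImM /= !mul0r subr0 addr0.
  pose W1 t := 2 * (u t * u1 t + v t * v1 t + eps * (x t * complex.Re e + y t * complex.Im e)).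
  have Dx (t : R) : is_derive t 1 x (complex.Re e).
    by apply: is_derive_eq; rewrite /GRing.scale /=; ring.
  have Dy (t : R) : is_derive t 1 y (complex.Im e).
    by apply: is_derive_eq; rewrite /GRing.scale /=; ring.
  apply: (@second_derivative_max _ W W1 d) => //.
  - move=> t td; have [Uw _] := H _ (nz t td).
    have [Du Dv] := is_derive_line (hol_sder hk Uw).
    rewrite -/u -/v -/(u1 t) -/(v1 t) in Du Dv.
    apply: is_derive_eq; rewrite /W1 /GRing.scale /=; ring.
  - have [|Uw _] := H z; first by rewrite subrr cabs0.
    have z0 : z + (0 : R)%:C * e = z by rewrite mul0r addr0.
    have Uw' : U (z + (0 : R)%:C * e) by rewrite z0.
    have [Du Dv] := is_derive_line (hol_sder hk Uw').
    have [Du1 Dv1] : is_derive (0 : R) 1 u1 (complex.Re (cder (cder k) z * e * e)) /\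
                     is_derive (0 : R) 1 v1 (complex.Im (cder (cder k) z * e * e)).
      have D : sder (fun x => cder k x * e) (z + (0 : R)%:C * e) (cder (cder k) z * e).
        by have := sderM (hol_sder2 hk Uw') (sder_cst e _); rewrite mulr0 addr0 z0.
      exact: is_derive_line D.
    rewrite -/u -/v z0 in Du Dv.
    apply: is_derive_eq; rewrite /GRing.scale /= /u /v /u1 /v1 z0.
    have := cabs_sq (cder k z * e); have := cabs_sq e; rewrite e1 expr1n.
    move: (complex.Re (cder k z * e)) (complex.Im (cder k z * e)) => a b E1 ->.
    by rewrite !mulr0 !add0r -!expr2 -E1; ring.
  - by move=> t /nz /H[_]; rewrite !WE mul0r addr0.
have := S 1 cabs1; have := S 'i cabs_i.
rewrite -!mulrA !mulr1 !cabsM cabs_i !mulr1 -expr2 sqr_i mulrN1 cReN cImN.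
have := sqr_ge0 (cabs (cder k z)); lra.
Qed.

Lemma compact_ccvg_max K (g : R[i] -> R) : K !=set0 -> compact K ->
  (forall x, K x -> g @ cnbhs (toC x) --> g (toC x)) ->
  exists2 c, K c & forall x, K x -> g (toC x) <= g (toC c).
Proof.
move=> K0 cK gc.
have : {within K, continuous (g \o toC)}.
  apply: continuous_in_subspaceT => x /set_mem /gc gx.
  exact: cvg_ccvg (ccvg_toC x) gx.
move=> /(compact_EVT_max K0 cK)[c /set_mem Kc cmax].
by exists c => // x Kx; apply: cmax; rewrite inE.
Qed.

(** The alternative in the last hypothesis replaces a boundary of [K]. It lets [K] contain points
    where [k] is merely continuous, such as the puncture in the Schwarz lemma. *)
Lemma maximum_modulus K U k (M : R) : 0 <= M -> compact K -> hol U k -> copen U ->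
  (forall x, K x -> ccvg (cnbhs (toC x)) k (k (toC x))) ->
  (forall x, K x -> cabs (k (toC x)) <= M \/ (U (toC x) /\ nbhs x K)) ->
  forall x, K x -> cabs (k (toC x)) <= M.
Proof.
move=> M0 cK hk oU kc bd x0 Kx0; rewrite leNgt; apply/negP => Mx0.
have K0 : K !=set0 by exists x0.
have ii z : cabs @ cnbhs z --> cabs z by exact: ccvg_cabs (ccvg_id z).
have [b Kb bmax] := @compact_ccvg_max K (fun z => cabs z) K0 cK (fun x _ => ii (toC x)).
set B := cabs (toC b) in bmax.
have B1 : 0 < B ^+ 2 + 1 by rewrite ltr_wpDl// sqr_ge0.
have D0 : 0 < cabs (k (toC x0)) ^+ 2 - M ^+ 2.
  by rewrite subr_gt0 ltr_pXn2r// nnegrE// cabs_ge0.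
(* With this [eps] the perturbation stays below half of the excess [|k x0|^2 - M^2] on [K], so the
   perturbed maximum cannot sit at a point where [|k| <= M]. *)
pose eps := (cabs (k (toC x0)) ^+ 2 - M ^+ 2) / 2 / (B ^+ 2 + 1).
have e0 : 0 < eps by rewrite !divr_gt0.
have eB : eps * (B ^+ 2 + 1) = (cabs (k (toC x0)) ^+ 2 - M ^+ 2) / 2.
  by rewrite /eps divfK// gt_eqF.
have [c Kc cmax] : exists2 c, K c & forall x, K x ->
    cabs (k (toC x)) ^+ 2 + eps * cabs (toC x) ^+ 2 <=
    cabs (k (toC c)) ^+ 2 + eps * cabs (toC c) ^+ 2.
  apply: (@compact_ccvg_max K (fun z => cabs (k z) ^+ 2 + eps * cabs z ^+ 2)) => // x Kx.
  have kx : cabs (k w) @[w --> cnbhs (toC x)] --> cabs (k (toC x)).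
    exact: ccvg_cabs (kc x Kx).
  rewrite !expr2; apply: cvgD; first exact: cvgM.
  by apply: cvgM; [exact: cvg_cst|apply: cvgM; exact: ii].
have := cmax _ Kx0; have := bmax _ Kc.
have := cabs_ge0 (toC c); have := sqr_ge0 (cabs (toC x0)) => s0 c0 cB.
have cB2 : cabs (toC c) ^+ 2 <= B ^+ 2 by rewrite ler_pXn2r// nnegrE// cabs_ge0.
have ecB : eps * cabs (toC c) ^+ 2 <= eps * B ^+ 2 by rewrite ler_pM2l.
have es0 : 0 <= eps * cabs (toC x0) ^+ 2 by rewrite mulr_ge0// ltW.
have [cM|[Uc nK]] := bd _ Kc.
  have : cabs (k (toC c)) ^+ 2 <= M ^+ 2 by rewrite ler_pXn2r// nnegrE// cabs_ge0.
  move=> kM h; move: eB; rewrite mulrDr mulr1; lra.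
move=> _; have [d d0 hd] := filterI (oU _ Uc) (cnbhs_ofC nK).
apply: (subharmonic_max (z := toC c) (d := d) hk e0 d0) => w /hd[Uw Kw].
by split=> //; rewrite -[w]ofCK; exact: cmax.
Qed.

Definition disc (z : R[i]) (r : R) : set R[i] := [set w | cabs (w - z) < r].

Lemma copen_disc z r : copen (disc z r).
Proof.
move=> w wz; exists (r - cabs (w - z)); first by rewrite subr_gt0.
move=> x xw; rewrite /disc /= (le_lt_trans (cabs_distD w _ _))//.
by rewrite -ltrBrDr.
Qed.

Lemma copenI U V : copen U -> copen V -> copen (U `&` V).
Proof. by move=> oU oV z [/oU ? /oV ?]; exact: filterI. Qed.

Lemma copen_neq z : copen [set w | w != z].
Proof.
move=> w /= wz; exists (cabs (w - z)); first by rewrite cabs_gt0 subr_eq0.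
by move=> x; apply: contraTneq => ->; rewrite cabsB ltxx.
Qed.

Lemma compact_cdisc (r : R) : compact [set x : R * R | cabs (toC x) <= r].
Proof.
apply: (@subclosed_compact _ _ (`[- r, r]%classic `*` `[- r, r]%classic)).
- apply: (@closed_comp _ _ (cabs \o toC) [set t : R | t <= r]); last exact: closed_le.
  by move=> x _; exact: ccvg_cabs (ccvg_toC x).
- by apply: compact_setX; exact: segment_compact.
- move=> x /= xr; have := Re_le_cabs (toC x); have := Im_le_cabs (toC x).
  rewrite /= !in_itv /= !ler_norml => /andP[a1 a2] /andP[b1 b2].
  by split; apply/andP; split; lra.
Qed.

Lemma nbhs_cdisc (r : R) (x : R * R) : cabs (toC x) < r ->
  nbhs x [set x : R * R | cabs (toC x) <= r].
Proof.
move=> xr; have := @copen_disc 0 r (toC x); rewrite /disc /= subr0 => /(_ xr).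
by move=> /nbhs_toC; apply: filterS => y /=; rewrite subr0 => /ltW.
Qed.

Lemma bernoulli_ineq (a : R) n : 0 <= a -> 1 + n%:R * a <= (1 + a) ^+ n.
Proof.
move=> a0; elim: n => [|n ih]; first by rewrite mul0r addr0 expr0.
rewrite exprS -natr1; apply: (@le_trans _ _ ((1 + a) * (1 + n%:R * a))).
  rewrite -subr_ge0.
  have -> : (1 + a) * (1 + n%:R * a) - (1 + (n%:R + 1) * a) = n%:R * a ^+ 2 by ring.
  by rewrite mulr_ge0// sqr_ge0.
by rewrite ler_wpM2l// addr_ge0.
Qed.

(* Comparing [h ^ (n+1) / z ^ n] on a punctured disc, where its value at 0 is 0,
   avoids removing the singularity of [h z / z]. *)
Lemma schwarz (h : R[i] -> R[i]) (r : R) : hol (disc 0 r) h ->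
  (forall z, disc 0 r z -> cabs (h z) <= 1) -> h 0 = 0 ->
  forall z, disc 0 r z -> r * cabs (h z) <= cabs z.
Proof.
move=> hh h1 h0 z; rewrite /disc /= subr0 => zr.
have [->|z0] := eqVneq z 0; first by rewrite h0 cabs0 mulr0.
have cz0 : 0 < cabs z by rewrite cabs_gt0.
(* The maximum principle on [|w| <= s]: on the circle [|w| = s] the quotient [h^(n+1) / w^n] is at
   most [s^(-n)], and at 0 it is 0. *)
have main (s : R) n : cabs z < s -> s < r -> (0 < n)%N ->
    s ^+ n * cabs (h z) ^+ n.+1 <= cabs z ^+ n.
  move=> zs sr n0; have s0 : 0 < s := lt_trans cz0 zs.
  pose k w := h w ^+ n.+1 / w ^+ n.
  pose U : set R[i] := disc 0 r `&` [set w | w != 0].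
  have oU : copen U by apply: copenI; [exact: copen_disc|exact: copen_neq].
  have hU : hol U h by apply: holS hh => w [].
  have hk : hol U k.
    apply: holM => //; first exact: holX.
    apply: holV => //; first by move=> w [_ w0]; rewrite expf_neq0.
    by apply: holX => //; exact: hol_id.
  have k0 : k 0 = 0 by rewrite /k h0 expr0n /= mul0r.
  have M0 : 0 <= (s ^+ n)^-1 by rewrite invr_ge0 exprn_ge0// ltW.
  have Z : [set x | cabs (toC x) <= s] (ofC z) by rewrite /= ofCK ltW.
  have := @maximum_modulus [set x | cabs (toC x) <= s] U k _ M0 (@compact_cdisc s) hk oU _ _ _ Z.
  rewrite ofCK => H; have {H} : cabs (k z) <= (s ^+ n)^-1.
    apply: H => x /= xs.
    - have [->|x0] := eqVneq (toC x) 0; last first.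
        by apply: (hol_ccvg hk); split=> //; rewrite /disc /= subr0 (le_lt_trans xs).
      rewrite k0; have r0 : disc 0 r 0 by rewrite /disc /= subr0 cabs0 (lt_trans s0).
      have [q ql fq] := hol_sder hh r0.
      have fq' := near_pairz fq; rewrite /= in fq'.
      (* Near 0, [h w = q (w, 0) w], so the quotient is [h w * q (w, 0)^n], which tends to
         [h 0 * h'(0)^n = 0]. *)
      have hc : ccvg (cnbhs 0) (fun w => h w * q (w, 0) ^+ n) 0.
        suff : ccvg (cnbhs 0) (fun w => h w * q (w, 0) ^+ n) (h 0 * cder h 0 ^+ n).
          by rewrite h0 mul0r.
        apply: ccvgM; first exact: hol_ccvg hh r0.
        elim: n {n0 k hk k0 M0} => [|n ih].
          rewrite expr0; have -> : (fun w : R[i] => q (w, 0) ^+ 0) = (fun=> 1) by [].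
          exact: ccvg_cst.
        rewrite exprS; have -> : (fun w : R[i] => q (w, 0) ^+ n.+1) =
            (fun w => q (w, 0) * q (w, 0) ^+ n) by apply/funext => w; rewrite exprS.
        by apply: ccvgM => //; exact: ccvg_pairz.
      move=> e e0; near=> w.
      have [->|w0] := eqVneq w 0; first by rewrite k0 subrr cabs0.
      have E : h w = q (w, 0) * w by rewrite -[LHS]subr0 -[X in _ - X]h0 (near fq' w)// subr0.
      have -> : k w = h w * q (w, 0) ^+ n.
        by rewrite /k exprS {2}E exprMn mulrA mulfK// expf_neq0.
      by near: w; exact: hc.
    - have [->|x0] := eqVneq (toC x) 0; first by left; rewrite k0 cabs0.
      have [xs'|xs'] := ltP (cabs (toC x)) s; [right|left].
        split; last exact: nbhs_cdisc.
        by split=> //; rewrite /disc /= subr0 (le_lt_trans xs).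
      have xE : cabs (toC x) = s by apply/eqP; rewrite eq_le xs.
      rewrite /k cabsM cabsV !cabsX xE ler_piMl// exprn_ile1 ?cabs_ge0// h1//.
      by rewrite /disc /= subr0 xE.
  rewrite /k cabsM cabsV !cabsX ler_pdivrMr ?exprn_gt0// mulrC => H.
  by rewrite mulrC -ler_pdivlMr ?exprn_gt0.
rewrite leNgt; apply/negP => lt1.
have hz0 : 0 < cabs (h z).
  by rewrite lt_neqAle cabs_ge0 andbT; apply: contraTneq lt1 => <-; rewrite mulr0 -leNgt cabs_ge0.
have [s [zs sr sh]] : exists s, [/\ cabs z < s, s < r & cabs z < s * cabs (h z)].
  have lt2 : cabs z / cabs (h z) < r by rewrite ltr_pdivrMr.
  exists ((Num.max (cabs z) (cabs z / cabs (h z)) + r) / 2).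
  have : Num.max (cabs z) (cabs z / cabs (h z)) < r by rewrite gt_max zr.
  set m := Num.max _ _ => mr.
  have m1 : cabs z <= m by rewrite le_max lexx.
  have m2 : cabs z / cabs (h z) <= m by rewrite le_max lexx orbT.
  split; [lra|lra|rewrite -ltr_pdivrMr//; lra].
(* [1 + a] is the ratio of [s |h z|] to [|z|]. By [main], [(1 + a)^n |h z| <= 1] for every [n > 0],
   which Bernoulli's inequality refutes for large [n]. *)
pose a := s * cabs (h z) / cabs z - 1.
have a0 : 0 < a by rewrite subr_gt0 ltr_pdivlMr// mul1r.
have bound n : (0 < n)%N -> (1 + n%:R * a) * cabs (h z) <= 1.
  move=> n0; have := main s n zs sr n0.
  rewrite exprSr mulrA -exprMn.
  have -> : s * cabs (h z) = (1 + a) * cabs z by rewrite /a addrC subrK divfK ?gt_eqF.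
  rewrite exprMn mulrAC -[leRHS]mul1r ler_pM2r ?exprn_gt0//; apply: le_trans.
  by rewrite ler_wpM2r ?cabs_ge0// bernoulli_ineq// ltW.
have [n nP] : exists n : nat, (a * cabs (h z))^-1 < n%:R.
  by exists (Num.trunc (a * cabs (h z))^-1).+1; rewrite truncnS_gt.
have n0 : (0 < n)%N.
  by rewrite -(ltr_nat R); apply: lt_trans nP; rewrite invr_gt0 mulr_gt0.
have h3 : 1 < n%:R * (a * cabs (h z)).
  by rewrite -ltr_pdivrMr ?mulr_gt0// mul1r.
by have := bound n n0; rewrite mulrDl mul1r -mulrA; lra.
Unshelve. all: by end_near. Qed.

End MaximumModulus.

(** * Moebius and Cayley maps; the Schwarz-Pick lemma *)

Section SchwarzPick.
Context {R : realType}.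
Implicit Types (f h : R[i] -> R[i]) (z w b c : R[i]) (U : set R[i]).

Lemma cRe_conj z : complex.Re (conjc z) = complex.Re z. Proof. by case: z. Qed.
Lemma cIm_conj z : complex.Im (conjc z) = - complex.Im z. Proof. by case: z. Qed.

Lemma Re1_gt0 z : cabs z < 1 -> 0 < complex.Re (1 - z).
Proof. by move=> z1; rewrite cReD cReN /=; have := Re_le_cabs z; rewrite ler_norml => /andP[]; lra. Qed.

Lemma Re_gt0_neq0 z : 0 < complex.Re z -> z != 0.
Proof. by apply: contraTneq => ->; rewrite ltxx. Qed.

Lemma cabsM_lt1 z w : cabs z < 1 -> cabs w < 1 -> cabs (z * w) < 1.
Proof. by move=> z1 w1; rewrite cabsM mulr_ilt1 ?cabs_ge0. Qed.

Lemma mob_den b z : cabs b < 1 -> cabs z < 1 -> 0 < complex.Re (1 - (conjc b) * z).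
Proof. by move=> b1 z1; apply: Re1_gt0; apply: cabsM_lt1; rewrite ?cabs_conj. Qed.

Definition mob b z : R[i] := (z - b) / (1 - (conjc b) * z).

Lemma mob_cabs b z : cabs (1 - (conjc b) * z) ^+ 2 - cabs (z - b) ^+ 2 =
  (1 - cabs b ^+ 2) * (1 - cabs z ^+ 2).
Proof.
by rewrite !cabs_sq !(cReD, cImD, cReN, cImN, cReM, cImM, cRe_conj, cIm_conj) /=; ring.
Qed.

Lemma mob_lt1 b z : cabs b < 1 -> cabs z < 1 -> cabs (mob b z) < 1.
Proof.
move=> b1 z1; have d0 := Re_gt0_neq0 (mob_den b1 z1).
rewrite /mob cabsM cabsV ltr_pdivrMr ?cabs_gt0// mul1r.
rewrite -ltr_sqr ?nnegrE ?cabs_ge0// -subr_gt0 mob_cabs.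
by rewrite mulr_gt0// subr_gt0 expr_lt1// cabs_ge0.
Qed.

Lemma mobb b : mob b b = 0. Proof. by rewrite /mob subrr mul0r. Qed.
Lemma mob0 b : mob b 0 = - b. Proof. by rewrite /mob mulr0 subr0 divr1 sub0r. Qed.

Lemma conjcMself b : (conjc b) * b = (cabs b ^+ 2)%:C.
Proof. by rewrite cabs_sq; case: b => x y; simpc => /=; congr (_ +i* _); ring. Qed.

Lemma mobK b z : cabs b < 1 -> cabs z < 1 -> mob (- b) (mob b z) = z.
Proof.
move=> b1 z1; have d0 := Re_gt0_neq0 (mob_den b1 z1).
have d1 : 1 - (conjc b) * b != 0 by apply/Re_gt0_neq0/mob_den.
rewrite /mob rmorphN.
rewrite !opprK.
have -> : (z - b) / (1 - (conjc b) * z) + b = z * (1 - (conjc b) * b) / (1 - (conjc b) * z) by field.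
have E : 1 - - (conjc b) * ((z - b) / (1 - (conjc b) * z)) = (1 - (conjc b) * b) / (1 - (conjc b) * z) by field.
by rewrite E; field; rewrite d0 d1.
Qed.

Lemma mobNK b z : cabs b < 1 -> cabs z < 1 -> mob b (mob (- b) z) = z.
Proof. by move=> b1 z1; rewrite -{1}[b]opprK mobK// cabsN. Qed.

Definition udisc : set R[i] := [set z | cabs z < 1].

Lemma udiscE : udisc = disc 0 1.
Proof. by apply/seteqP; split => z; rewrite /udisc /disc /= subr0. Qed.

Lemma copen_udisc : copen udisc. Proof. by rewrite udiscE; exact: copen_disc. Qed.

Lemma hol_mob b : cabs b < 1 -> hol udisc (mob b).
Proof.
move=> b1; have oD := copen_udisc.
apply: holM => //; first by apply: holB => //; [exact: hol_id|exact: hol_cst].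
apply: holV => //; first by move=> z z1; exact/Re_gt0_neq0/mob_den.
apply: holB => //; first exact: hol_cst.
by apply: holM => //; [exact: hol_cst|exact: hol_id].
Qed.

Lemma cder_mob b z : cabs b < 1 -> cabs z < 1 ->
  cder (mob b) z = (1 - (conjc b) * b) / (1 - (conjc b) * z) ^+ 2.
Proof.
move=> b1 z1; have d0 := Re_gt0_neq0 (mob_den b1 z1).
apply: cder_eq.
have D1 : sder (fun z => z - b) z (1 - 0) := sderB (sder_id z) (sder_cst b z).
have D2 : sder (fun z => 1 - (conjc b) * z) z (0 - (conjc b) * 1).
  by apply: sderB; [exact: sder_cst|apply: sderMl; exact: sder_id].
have := sderM D1 (sderV (f := fun z => 1 - (conjc b) * z) d0 D2).
have -> // : (1 - 0) * (1 - (conjc b) * z)^-1 + (z - b) * (- (0 - (conjc b) * 1) / (1 - (conjc b) * z) ^+ 2) =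
  (1 - (conjc b) * b) / (1 - (conjc b) * z) ^+ 2 by field.
Qed.

Lemma schwarz_der h (r : R) : hol (disc 0 r) h -> 0 < r ->
  (forall z, disc 0 r z -> cabs (h z) <= 1) -> h 0 = 0 ->
  r * cabs (cder h 0) <= 1.
Proof.
move=> hh r0 h1 h0; have z0 : disc 0 r 0 by rewrite /disc /= subr0 cabs0.
have [q ql fq] := hol_sder hh z0.
have fq' := near_pairz fq; rewrite /= in fq'.
have ql' : cabs (q (x, 0)) @[x --> cnbhs 0] --> cabs (cder h 0).
  exact: ccvg_cabs (ccvg_pairz ql).
rewrite leNgt; apply/negP; rewrite -ltr_pdivrMl// mulr1 => lt1.
have A : \forall t \near cnbhs 0, r^-1 < cabs (q (t, 0)) by exact: cvgr_gt _ ql' _ lt1.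
have [z zn0 [[qz fz] zr]] := near_neq (filterI (filterI A fq') (copen_disc z0)).
have := schwarz hh h1 h0 zr; rewrite /= h0 !subr0 in fz; rewrite fz cabsM mulrA.
rewrite -[leRHS]mul1r ler_pM2r ?cabs_gt0// leNgt => /negP; apply.
by rewrite -ltr_pdivrMl// mulr1.
Qed.

(** The Schwarz lemma at 0, after a translation of the disc and followed by [mob b] with [b = f z],
    whose derivative at [b] is [1 / (1 - |b|^2)]. *)
Lemma schwarz_pick f z (r : R) : 0 < r -> hol (disc z r) f ->
  (forall w, disc z r w -> cabs (f w) < 1) ->
  r * cabs (cder f z) <= 1 - cabs (f z) ^+ 2.
Proof.
move=> r0 hf f1; have zz : disc z r z by rewrite /disc /= subrr cabs0.
set b := f z; have b1 : cabs b < 1 := f1 _ zz.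
pose t w := z + w.
have tD w : disc 0 r w -> disc z r (t w) by rewrite /disc /= subr0 /t addrAC subrr add0r.
have oD : copen (disc (0 : R[i]) r) by exact: copen_disc.
have ht : hol (disc 0 r) t by apply: holD => //; [exact: hol_cst|exact: hol_id].
have hft : hol (disc 0 r) (f \o t) by exact: hol_comp hf.
have fD w : disc 0 r w -> udisc ((f \o t) w) by move=> /tD /f1.
have hm := hol_mob b1.
have := @schwarz_der (mob b \o (f \o t)) r _ r0.
have t0 : t 0 = z by rewrite /t addr0.
move=> /(_ _)/wrap[|H]; first exact: hol_comp hm.
have {H} := H; move=> /(_ _)/wrap[|H].
  by move=> w /fD fw; rewrite ltW// mob_lt1.
have {H} := H; rewrite /= t0 -/b mobb => /(_ erefl).
have D0 : disc 0 r 0 by rewrite /disc /= subr0 cabs0.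
rewrite (cder_comp fD hft hm D0) (cder_comp tD ht hf D0) /= t0 -/b.
have -> : cder t 0 = 1.
  apply: cder_eq; rewrite -[1]add0r; apply: sderD; [exact: sder_cst|exact: sder_id].
rewrite mulr1 cder_mob// expr2 invfM mulrA mulfV ?mul1r; last first.
  exact/Re_gt0_neq0/mob_den.
have n0 : 0 < 1 - cabs b ^+ 2 by rewrite subr_gt0 expr_lt1// cabs_ge0.
rewrite conjcMself -(rmorph1 (real_complex R)) -rmorphB cabsM cabsV (cabs_realp (ltW n0)).
by rewrite mulrCA ler_pdivrMl// mulr1.
Qed.

(** The Cayley transform of the right half-plane to the disc, normalized to vanish at [c]. *)
Definition cay c z : R[i] := (z - c) / (z + (conjc c)).

Lemma cay_den c z : 0 < complex.Re c -> 0 < complex.Re z -> z + (conjc c) != 0.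
Proof. by move=> c0 z0; apply: Re_gt0_neq0; rewrite cReD cRe_conj addr_gt0. Qed.

Lemma cay_lt1 c z : 0 < complex.Re c -> 0 < complex.Re z -> cabs (cay c z) < 1.
Proof.
move=> c0 z0; have d0 := cay_den c0 z0.
rewrite /cay cabsM cabsV ltr_pdivrMr ?cabs_gt0// mul1r.
rewrite -ltr_sqr ?nnegrE ?cabs_ge0// -subr_gt0.
have -> : cabs (z + (conjc c)) ^+ 2 - cabs (z - c) ^+ 2 = 4 * complex.Re z * complex.Re c.
  by rewrite !cabs_sq !(cReD, cImD, cReN, cImN, cRe_conj, cIm_conj) /=; ring.
by rewrite !mulr_gt0.
Qed.

Definition hplane : set R[i] := [set z | 0 < complex.Re z].

Lemma copen_hplane : copen hplane.
Proof. by move=> z z0; exact: (cvgr_gt _ (ccvg_Re (ccvg_id z)) _ z0). Qed.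

Lemma hol_cay c : 0 < complex.Re c -> hol hplane (cay c).
Proof.
move=> c0; have oH := copen_hplane.
apply: holM => //; first by apply: holB => //; [exact: hol_id|exact: hol_cst].
apply: holV => //; first by move=> z z0; exact: cay_den.
by apply: holD => //; [exact: hol_id|exact: hol_cst].
Qed.

Lemma caycc c : cay c c = 0. Proof. by rewrite /cay subrr mul0r. Qed.

Lemma cder_cay c : 0 < complex.Re c -> cder (cay c) c = (c + (conjc c))^-1.
Proof.
move=> c0; have d0 := cay_den c0 c0; apply: cder_eq.
have D1 : sder (fun z => z - c) c (1 - 0) := sderB (sder_id c) (sder_cst c c).
have D2 : sder (fun z => z + (conjc c)) c (1 + 0) := sderD (sder_id c) (sder_cst _ c).
have := sderM D1 (sderV (f := fun z => z + (conjc c)) d0 D2).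
have -> // : (1 - 0) * (c + (conjc c))^-1 + (c - c) * (- (1 + 0) / (c + (conjc c)) ^+ 2) =
  (c + (conjc c))^-1 by field.
Qed.

Lemma cabs_cDconj c : 0 < complex.Re c -> cabs (c + (conjc c)) = 2 * complex.Re c.
Proof.
move=> c0; have -> : c + (conjc c) = (2 * complex.Re c)%:C.
  by case: c c0 => x y _; simpc; congr (_ +i* _); rewrite /=; ring.
by rewrite cabs_realp// mulr_ge0// ltW.
Qed.

(** Scaling by [r], the Moebius map that takes 0 to [b / r], and the Cayley map at [h b] turn [h]
    into a self-map of the disc fixing 0. Its derivative there is [h'(b) r (1 - |b|^2 / r^2)] over
    [2 Re (h b)], up to a factor of modulus 1. *)
Lemma schwarz_pick_hplane h (r : R) b : 0 < r -> hol (disc 0 r) h ->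
  (forall w, disc 0 r w -> 0 < complex.Re (h w)) -> disc 0 r b ->
  (r ^+ 2 - cabs b ^+ 2) * cabs (cder h b) <= 2 * r * complex.Re (h b).
Proof.
move=> r0 hh h0 br; have cb0 : 0 < complex.Re (h b) := h0 _ br.
pose g z : R[i] := r%:C * z.
have gD z : udisc z -> disc 0 r (g z).
  by rewrite /udisc /disc /g /= subr0 cabsM cabs_realp ?ltW// gtr_pMr.
have rC0 : r%:C != 0 :> R[i] by rewrite -cabs_gt0 cabs_realp ?ltW.
pose a : R[i] := b / r%:C.
have a1 : cabs a < 1.
  by rewrite /a cabsM cabsV cabs_realp ?ltW// ltr_pdivrMr// mul1r; move: br; rewrite /disc /= subr0.
have Na1 : cabs (- a) < 1 by rewrite cabsN.
pose F z := cay (h b) (h (g (mob (- a) z))).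
have oD := copen_udisc.
have hg : hol udisc g by apply: holM => //; [exact: hol_cst|exact: hol_id].
have hhg : hol udisc (h \o g) by exact: hol_comp hh.
have hgH z : udisc z -> hplane ((h \o g) z) by move=> /gD /h0.
have hcg : hol udisc (cay (h b) \o (h \o g)).
  by apply: hol_comp (hol_cay cb0).
have mD z : udisc z -> udisc (mob (- a) z) by move=> z1; exact: mob_lt1.
have hF : hol udisc F := hol_comp oD mD (hol_mob Na1) hcg.
have ga : g a = b by rewrite /g /a mulrC divfK.
have m0 : mob (- a) 0 = a by rewrite mob0 opprK.
have u0 : udisc 0 by rewrite /udisc /= cabs0.
have := @schwarz_der F 1; rewrite -udiscE => /(_ hF ltr01) H.
have {H} : 1 * cabs (cder F 0) <= 1.
  apply: H; last by rewrite /F m0 ga caycc.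
  by move=> z z1; rewrite ltW// cay_lt1//; apply: h0; apply: gD; exact: mD.
rewrite mul1r.
have -> : cder F 0 = cder (cay (h b) \o (h \o g)) a * cder (mob (- a)) 0.
  by have := cder_comp mD (hol_mob Na1) hcg u0; rewrite m0.
rewrite (cder_comp hgH hhg (hol_cay cb0) a1) (cder_comp gD hg hh a1) /= ga.
rewrite cder_cay// cder_mob// mulr0 subr0 expr1n divr1.
have -> : cder g a = r%:C.
  by apply: cder_eq; rewrite -[X in sder _ _ X]mulr1; apply: sderMl; exact: sder_id.
rewrite !cabsM cabsV cabs_cDconj// (cabs_realp (ltW r0)) conjcMself cabsN.
rewrite -(rmorph1 (real_complex R)) -rmorphB cabs_realp; last first.
  by rewrite subr_ge0 ltW// expr_lt1// cabs_ge0.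
rewrite /a cabsM cabsV (cabs_realp (ltW r0)).
have -> : 1 - (cabs b / r) ^+ 2 = (r ^+ 2 - cabs b ^+ 2) / r ^+ 2 by field; rewrite gt_eqF.
set k := cabs (cder h b); set p := complex.Re (h b).
have -> : (2 * p)^-1 * (k * r) * ((r ^+ 2 - cabs b ^+ 2) / r ^+ 2) =
    ((r ^+ 2 - cabs b ^+ 2) * k) / (2 * r * p) by field; rewrite !gt_eqF.
by rewrite ler_pdivrMr ?mulr_gt0// mul1r.
Qed.

End SchwarzPick.

(** * Continuation of logarithms along a homotopy *)

Section LogHomotopy.
Context {R : realType}.
Implicit Types (z w : R[i]) (U : set R[i]) (s t : R).

(** Only continuity is asked of the branch, as this is what a homotopy transports; [hol_lift] makes
    the square roots built from it holomorphic. *)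
Definition has_log U (p : R[i] -> R[i]) := exists2 L : R[i] -> R[i],
  (forall z, U z -> ccvg (cnbhs z) L (L z)) & (forall z, U z -> cexp (L z) = p z).

Lemma cLogM_Re_gt0 z w : 0 < complex.Re z -> 0 < complex.Re w ->
  cLog (z * w) = cLog z + cLog w.
Proof.
move=> z0 w0; apply: cLogM; [exact: Re_gt0_slit|exact: Re_gt0_slit|].
have := Im_cLog_Re_gt0 z0; have := Im_cLog_Re_gt0 w0; rewrite !ltr_norml.
by move=> /andP[? ?] /andP[? ?]; apply/andP; split; lra.
Qed.

Lemma ccvg_sum (T : Type) (F : set_system T) {FF : Filter F} n
    (f : nat -> T -> R[i]) (l : nat -> R[i]) :
  (forall i, (i < n)%N -> ccvg F (f i) (l i)) ->
  ccvg F (fun x => \sum_(0 <= i < n) f i x) (\sum_(0 <= i < n) l i).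
Proof.
elim: n => [|n ih] h.
  by rewrite big_nil; apply: (ccvg_lip (f := fun=> 0) (l := 0) (k := 1)) => //;
    [near=> x; rewrite big_nil subrr cabs0 mulr_ge0 ?cabs_ge0|exact: ccvg_cst].
have -> : (fun x => \sum_(0 <= i < n.+1) f i x) = (fun x => \sum_(0 <= i < n) f i x + f n x).
  by apply/funext => x; rewrite big_nat_recr.
rewrite big_nat_recr//=; apply: ccvgD; last exact: h.
by apply: ih => i /ltnW /h.
Unshelve. all: by end_near. Qed.

Variables (U : set R[i]) (P : R -> R[i] -> R[i]).
Hypothesis oU : copen U.
Hypothesis P0 : forall t z, 0 <= t <= 1 -> U z -> P t z != 0.
Hypothesis Pc : forall t z, 0 <= t <= 1 -> U z -> forall e : R, 0 < e ->
  exists2 d : R, 0 < d & forall s w, 0 <= s <= 1 -> `|s - t| < d ->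
    cabs (w - z) < d -> cabs (P s w - P t z) < e.

(** Time steps of length at most [d] are short enough at [z]: successive values of [P] then differ
    by a factor in the right half-plane, where [cLog] is continuous and additive. *)
Let fine (d : R) z := forall s t, 0 <= s <= 1 -> 0 <= t <= 1 -> `|s - t| <= d ->
  0 < complex.Re (P s z / P t z).

(** A Lebesgue number for [[0, 1]]: compactness makes the admissible step uniform in time and in a
    neighbourhood of [z]. *)
Let fine_near z : U z -> exists2 d : R, 0 < d & forall w, cabs (w - z) < d -> fine d w.
Proof.
move=> Uz.
have cI := @segment_compact R 0 1.
have /compact_near_coveringP cv := cI.
pose Pd (d t : R) := 0 <= t <= 1 -> forall s w, 0 <= s <= 1 ->
  `|s - t| <= d -> cabs (w - z) < d -> 0 < complex.Re (P s w / P t w).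
have H : \forall d \near (0 : R)^'+, `[0, 1]%classic `<=` Pd d.
  apply: cv.
  move=> t0 /=; rewrite in_itv /= => t01.
  have p0 : 0 < cabs (P t0 z) by rewrite cabs_gt0 P0.
  (* With the quarter, [P s w] and [P t w] differ by less than half of [|P t0 z|], while [|P t w|]
     exceeds three quarters of it; their quotient is thus at distance less than 1 from 1. *)
  have p40 : 0 < cabs (P t0 z) / 4 by rewrite divr_gt0.
  have [d d0 hd] := Pc t01 Uz p40.
  have d20 : 0 < d / 2 by rewrite divr_gt0.
  exists (ball t0 (d / 2), [set r | r < d / 2]) => /=.
    by split; [exact: nbhsx_ballx|exact: nbhs_right_lt].
  move=> [t r] /= [tt0 rd] t1 s w s1 st wz; rewrite /ball /= in tt0.
  have st0 : `|s - t0| < d.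
    by have := ler_distD t s t0; rewrite (distrC t t0); lra.
  have tt0' : `|t - t0| < d by rewrite distrC; lra.
  have wz' : cabs (w - z) < d by lra.
  have h1 := hd _ _ s1 st0 wz'; have h2 := hd _ _ t1 tt0' wz'.
  have h3 := cabs_triB (P t0 z) (P t w); rewrite cabsB in h3.
  have h4 := cabs_distD (P t0 z) (P t w) (P s w); rewrite (cabsB (P t0 z) (P s w)) in h4.
  have Pt0 : P t w != 0 by rewrite -cabs_gt0; lra.
  have -> : P s w / P t w = 1 - (P t w - P s w) / P t w by field.
  by apply: Re1_gt0; rewrite cabsM cabsV ltr_pdivrMr ?cabs_gt0// mul1r; lra.
have [d [hd d0]] : exists d : R, `[0, 1]%classic `<=` Pd d /\ 0 < d.
  near (0 : R)^'+ => d; exists d; split; last by [].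
  by near: d; exact: H.
exists d => // w wz s t s1 t1 st.
by apply: (hd t) => //; rewrite /= in_itv.
Unshelve. all: by end_near. Qed.

(** A logarithm of [P 1]: the product of the [N] successive quotients telescopes. *)
Let lift (N : nat) z (L0 : R[i] -> R[i]) := L0 z +
  \sum_(0 <= i < N) cLog (P (i.+1%:R / N%:R) z / P (i%:R / N%:R) z).

Let fracb (i N : nat) : (i <= N)%N -> (0 < N)%N -> 0 <= (i%:R / N%:R : R) <= 1.
Proof.
move=> iN N0; rewrite divr_ge0//= ler_pdivrMr ?ltr0n// mul1r ler_nat//.
Qed.

Let lift_exp (N n : nat) z L0 : (0 < N)%N -> (n <= N)%N -> U z -> fine N%:R^-1 z ->
  cexp (L0 z) = P 0 z ->
  cexp (L0 z + \sum_(0 <= i < n) cLog (P (i.+1%:R / N%:R) z / P (i%:R / N%:R) z)) =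
  P (n%:R / N%:R) z.
Proof.
move=> N0 nN Uz fz L0z; elim: n nN => [|n ih] nN.
  by rewrite big_nil addr0 mul0r.
rewrite big_nat_recr//= addrA cexpD ih ?(ltnW nN)// cLogK.
  by rewrite mulrC divfK// P0// fracb// ltnW.
apply/Re_gt0_slit/fz; rewrite ?fracb ?(ltnW nN)//.
by rewrite -mulrBl -natrB// subSnn mul1r ger0_norm ?invr_ge0.
Qed.

(** Each quotient is the product of the two at the half steps; both lie in the right half-plane, so
    [cLog] adds up. Dyadic subdivisions are used later so that any two have a common refinement
    reached by doubling. *)
Let lift_double (N : nat) z L0 : (0 < N)%N -> U z -> fine N%:R^-1 z ->
  lift (N.*2) z L0 = lift N z L0.
Proof.
move=> N0 Uz fz; rewrite /lift; congr (_ + _).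
have E (F : nat -> R[i]) n : \sum_(0 <= i < n.*2) F i =
    \sum_(0 <= i < n) (F i.*2 + F i.*2.+1).
  elim: n => [|n ih]; first by rewrite !big_nil.
  by rewrite doubleS !big_nat_recr//= ih addrA.
rewrite E; apply: eq_big_nat => i /andP[_ iN].
have NN : N%:R != 0 :> R by rewrite pnatr_eq0 -lt0n.
have e1 : i.*2%:R / N.*2%:R = i%:R / N%:R :> R.
  by rewrite -!muln2 !natrM; field.
have e2 : i.*2.+2%:R / N.*2%:R = i.+1%:R / N%:R :> R.
  by rewrite -doubleS -!muln2 !natrM; field.
have b2 : 0 <= (i.*2.+1%:R / N.*2%:R : R) <= 1.
  by apply: fracb; rewrite ?double_gt0// ltn_double.
have bi : 0 <= (i%:R / N%:R : R) <= 1 by rewrite fracb// ltnW.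
have bi1 : 0 <= (i.+1%:R / N%:R : R) <= 1 by rewrite fracb.
have iN0 : 0 < N%:R^-1 :> R by rewrite invr_gt0 ltr0n.
have m1 : i.*2.+1%:R / N.*2%:R - i%:R / N%:R = N%:R^-1 / 2 :> R.
  by rewrite -natr1 -!muln2 !natrM; field.
have m2 : i.+1%:R / N%:R - i.*2.+1%:R / N.*2%:R = N%:R^-1 / 2 :> R.
  by rewrite -!natr1 -!muln2 !natrM; field.
rewrite e1 e2 -cLogM_Re_gt0.
- by congr cLog; field; rewrite !P0.
- by apply: fz => //; rewrite m1 ger0_norm; lra.
- by apply: fz => //; rewrite m2 ger0_norm; lra.
Qed.

(** How fine a subdivision must be depends on the point. All sufficiently fine dyadic ones give the
    same value, so the local lifts fit together into one continuous branch. *)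
Lemma log_homotopy : has_log U (P 0) -> has_log U (P 1).
Proof.
move=> [L0 L0c L0E].
have finek z : U z -> exists k, forall w, cabs (w - z) < (2 ^ k)%:R^-1 -> fine (2 ^ k)%:R^-1 w.
  move=> /fine_near[d d0 hd].
  have [k hk] : exists k, (2 ^ k)%:R^-1 <= d.
    exists (Num.trunc d^-1).+1; rewrite invf_ple ?posrE ?ltr0n ?expn_gt0//.
    apply: (@le_trans _ _ (Num.trunc d^-1).+1%:R); first by rewrite ltW// truncnS_gt.
    by rewrite ler_nat ltnW// ltn_expl.
  exists k => w wz s t s1 t1 st; apply: (hd w (lt_le_trans wz hk)) => //.
  exact: le_trans hk.
have lift_stable z j k : U z -> fine (2 ^ j)%:R^-1 z -> (j <= k)%N ->
    lift (2 ^ k) z L0 = lift (2 ^ j) z L0.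
  move=> Uz fz; elim: k => [|k ih]; first by rewrite leqn0 => /eqP ->.
  rewrite leq_eqVlt => /orP[/eqP -> //|]; rewrite ltnS => jk.
  rewrite expnS mul2n lift_double ?expn_gt0// ?ih//.
  move=> s t s1 t1 st; apply: fz => //; apply: le_trans st _.
  by rewrite lef_pV2 ?posrE ?ltr0n ?expn_gt0// ler_nat leq_exp2l.
pose kz z := if pselect (U z) is left Uz then sval (cid (finek z Uz)) else 0%N.
have kzP z : U z -> forall w, cabs (w - z) < (2 ^ kz z)%:R^-1 -> fine (2 ^ kz z)%:R^-1 w.
  by rewrite /kz; case: pselect => // Uz _; case: cid.
have kz0 z : 0 < (2 ^ kz z)%:R^-1 :> R by rewrite invr_gt0 ltr0n expn_gt0.
have kzz z : U z -> fine (2 ^ kz z)%:R^-1 z by move=> Uz; apply: kzP; rewrite ?subrr ?cabs0.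
exists (fun z => lift (2 ^ kz z) z L0) => z Uz; last first.
  rewrite lift_exp ?expn_gt0//; [|exact: kzz|exact: L0E].
  by rewrite divff// pnatr_eq0 expn_eq0.
(* The choice [kz] need not be locally constant. Near [z], refining both [kz w] and [kz z] to their
   maximum shows that the lift coincides with the one having a fixed number of steps. *)
have E : \forall w \near cnbhs z, lift (2 ^ kz w) w L0 = lift (2 ^ kz z) w L0.
  have nz := near_cnbhs z (kz0 z).
  apply: filterS2 (oU Uz) nz => w Uw wz.
  rewrite -(lift_stable w (kz w) (maxn (kz w) (kz z)))//; last 2 first.
  - exact: kzz.
  - exact: leq_maxl.
  by apply: lift_stable => //; [exact: kzP wz|exact: leq_maxr].
have C : ccvg (cnbhs z) (fun w => lift (2 ^ kz z) w L0) (lift (2 ^ kz z) z L0).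
  apply: ccvgD; first exact: L0c.
  apply: ccvg_sum => i iN; set N := (2 ^ kz z)%N in iN *.
  have N0 : (0 < N)%N by rewrite expn_gt0.
  have PC t : 0 <= t <= 1 -> ccvg (cnbhs z) (P t) (P t z).
    move=> t1 e e0; have [d d0 hd] := Pc t1 Uz e0.
    by exists d => // w wz; apply: hd; rewrite ?subrr ?normr0.
  have b1 := fracb iN N0; have b0 := fracb (ltnW iN) N0.
  have rc : ccvg (cnbhs z) (fun w => P (i.+1%:R / N%:R) w / P (i%:R / N%:R) w)
      (P (i.+1%:R / N%:R) z / P (i%:R / N%:R) z).
    by apply: ccvgM; [exact: PC|apply: ccvgV; [exact: P0|exact: PC]].
  apply: (ccvg_comp rc); apply/ccvg_cLog/Re_gt0_slit/(kzz z Uz) => //.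
  by rewrite -mulrBl -natrB// subSnn mul1r ger0_norm ?invr_ge0.
move=> e e0; apply: filterS2 E (C e e0) => w -> .
by [].
Qed.

End LogHomotopy.

(** * Injective maps into the disc *)

Section HasLog.
Context {R : realType}.
Implicit Types (z w c e : R[i]) (U : set R[i]) (f g p q : R[i] -> R[i]).

Lemma cexp_surj c : c != 0 -> exists l, cexp l = c.
Proof.
move=> c0; have [_ E] := cargP c0; exists (ln (cabs c) +i* carg c).
by rewrite /cexp /= lnK ?posrE ?cabs_gt0// -E.
Qed.

Lemma has_log_cst U c : c != 0 -> has_log U (fun=> c).
Proof. by move=> /cexp_surj[l lE]; exists (fun=> l) => // z _; exact: ccvg_cst. Qed.

Lemma has_logM U p q : has_log U p -> has_log U q -> has_log U (fun z => p z * q z).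
Proof.
move=> [L Lc Lp] [M Mc Mq]; exists (fun z => L z + M z) => z Uz.
  by apply: ccvgD; [exact: Lc|exact: Mc].
by rewrite cexpD Lp// Mq.
Qed.

Lemma has_logV U p : has_log U p -> has_log U (fun z => (p z)^-1).
Proof.
move=> [L Lc Lp]; exists (fun z => - L z) => z Uz; first exact/ccvgN/Lc.
by rewrite cexpN Lp.
Qed.

Lemma has_log_slit U p : (forall z, U z -> ccvg (cnbhs z) p (p z)) ->
  (forall z, U z -> slit (p z)) -> has_log U p.
Proof.
move=> pc ps; exists (cLog \o p) => z Uz; last by rewrite /= cLogK//; exact: ps.
by apply: (ccvg_comp (pc z Uz)); apply: ccvg_cLog; exact: ps.
Qed.

Lemma has_log_congr U p q : (forall z, U z -> p z = q z) -> has_log U p -> has_log U q.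
Proof. by move=> pq [L Lc Lp]; exists L => // z Uz; rewrite Lp// pq. Qed.

End HasLog.

Section Admissible.
Context {R : realType}.
Implicit Types (z w c e : R[i]) (U : set R[i]) (f g F p q : R[i] -> R[i]).

(* Injective holomorphic maps of [U] into the unit disc, given together with a
   left inverse defined on the whole disc; the logarithm of [f z / (z - z0)] stands
   for the simple connectedness of [U]. *)
Definition admissible U z0 f F :=
  [/\ hol U f, forall z, U z -> udisc (f z), hol udisc F,
      forall z, U z -> F (f z) = z & f z0 = 0] /\
  [/\ forall z, U z -> \forall w \near cnbhs (f z), U (F w) /\ f (F w) = w &
      exists2 L : R[i] -> R[i], (forall z, U z -> ccvg (cnbhs z) L (L z)) &
        (forall z, U z -> f z = (z - z0) * cexp (L z))].

(** What the construction of conformal maps retains of the sector condition: after a rotation about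
    the omitted point, [cLog] is available on all of [U]. *)
Definition sees U w := exists2 e, cabs e = 1 & forall z, U z -> slit (e * (z - w)).

Lemma sees_log U w : sees U w -> has_log U (fun z => z - w).
Proof.
move=> [e e1 es]; have e0 : e != 0 by rewrite -cabs_gt0 e1.
have H : has_log U (fun z => e * (z - w)).
  apply: has_log_slit => // z Uz; apply: ccvgM; first exact: ccvg_cst.
  by apply: ccvgB; [exact: ccvg_id|exact: ccvg_cst].
have V0 : e^-1 != 0 by rewrite invr_eq0.
by apply: has_log_congr (has_logM (has_log_cst U V0) H) => z _; rewrite mulKf.
Qed.

Definition icay c z : R[i] := (c + (conjc c) * z) / (1 - z).

Lemma Re_icay_gt0 c z : 0 < complex.Re c -> udisc z -> 0 < complex.Re (icay c z).
Proof.
move=> c0 z1; have d0 := Re_gt0_neq0 (Re1_gt0 z1).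
have -> : icay c z = (c + (conjc c) * z) * (conjc (1 - z)) / ((conjc (1 - z)) * (1 - z)).
  rewrite /icay invfM mulrA mulfK//.
  by rewrite -cabs_gt0 cabs_conj cabs_gt0.
rewrite conjcMself -fmorphV [_ * _%:C]mulrC cReM /= mul0r subr0 mulr_gt0//.
  by rewrite invr_gt0 exprn_gt0// cabs_gt0.
have -> : complex.Re ((c + (conjc c) * z) * (conjc (1 - z))) =
    complex.Re c * (1 - cabs z ^+ 2).
  rewrite cabs_sq !(cReD, cImD, cReN, cImN, cReM, cImM, cRe_conj, cIm_conj) /=; ring.
by rewrite mulr_gt0// subr_gt0 expr_lt1// cabs_ge0.
Qed.

Lemma cayK c z : 0 < complex.Re c -> 0 < complex.Re z -> icay c (cay c z) = z.
Proof.
move=> c0 z0; have d0 := cay_den c0 z0.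
have d1 : c + (conjc c) != 0 := cay_den c0 c0.
have -> : icay c (cay c z) = (z * (c + (conjc c)) / (z + (conjc c))) / ((c + (conjc c)) / (z + (conjc c))).
  by rewrite /icay /cay; congr (_ / _); field.
by field; rewrite d0 d1.
Qed.

Lemma icayK c z : 0 < complex.Re c -> udisc z -> cay c (icay c z) = z.
Proof.
move=> c0 z1; have d0 := Re_gt0_neq0 (Re1_gt0 z1).
have d1 : c + (conjc c) != 0 := cay_den c0 c0.
have -> : cay c (icay c z) = (z * (c + (conjc c)) / (1 - z)) / ((c + (conjc c)) / (1 - z)).
  by rewrite /icay /cay; congr (_ / _); field.
by field; rewrite d0 d1.
Qed.

Lemma hol_icay c : hol udisc (icay c).
Proof.
have oD := @copen_udisc R; apply: holM => //.
  apply: holD => //; first exact: hol_cst.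
  by apply: holM => //; [exact: hol_cst|exact: hol_id].
apply: holV => //; first by move=> z z1; exact/Re_gt0_neq0/Re1_gt0.
by apply: holB => //; [exact: hol_cst|exact: hol_id].
Qed.

Definition csqrt z : R[i] := cexp (2^-1 * cLog z).

Lemma addr_half z : 2^-1 * z + 2^-1 * z = z :> R[i].
Proof. by field. Qed.

Lemma csqrtK z : slit z -> csqrt z ^+ 2 = z.
Proof. by move=> sz; rewrite expr2 /csqrt -cexpD addr_half cLogK. Qed.

Lemma Im_half z : complex.Im (2^-1 * z) = complex.Im z / 2.
Proof.
rewrite -[in RHS](addr_half z) cImD; lra.
Qed.

Lemma Re_csqrt_gt0 z : 0 < complex.Re (csqrt z).
Proof.
rewrite /csqrt; have := Im_half (cLog z); move: (2^-1 * cLog z) => h hz.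
rewrite /cexp cReM /= mul0r subr0 mulr_gt0 ?expR_gt0//.
apply: cos_gt0_pihalf; rewrite hz.
by have /andP[? ?] := Im_cLog z; apply/andP; split; lra.
Qed.

Lemma csqrt_sqr z : 0 < complex.Re z -> csqrt (z ^+ 2) = z.
Proof.
move=> z0; rewrite /csqrt expr2 cLogM_Re_gt0// mulrDr addr_half cLogK//.
exact: Re_gt0_slit.
Qed.

Lemma hol_csqrt : hol slit csqrt.
Proof.
have oS := @copen_slit R.
apply: (hol_comp (V := setT) (f := fun z => 2^-1 * cLog z) (g := cexp)) => //.
  by apply: holM => //; [exact: hol_cst|exact: hol_cLog].
by apply: hol_cexp; exact: copenT.
Qed.

(** The root [s] of the rotated [z - w0] takes values in the right half-plane, and a Cayley map
    carries them into the disc. Squaring inverts the root, which gives [F] on the whole disc. *)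
Lemma admissible_exists U z0 w0 : copen U -> U z0 -> sees U w0 ->
  exists f F, admissible U z0 f F.
Proof.
move=> oU Uz0 [e e1 es]; have e0 : e != 0 by rewrite -cabs_gt0 e1.
pose s z := csqrt (e * (z - w0)).
have sg z : 0 < complex.Re (s z) by exact: Re_csqrt_gt0.
set c := s z0; have c0 : 0 < complex.Re c by exact: sg.
have cc0 : 0 < complex.Re (conjc c) by rewrite cRe_conj.
pose F z := w0 + e^-1 * icay c z ^+ 2.
have ss z : U z -> s z ^+ 2 = e * (z - w0) by move=> Uz; rewrite csqrtK//; exact: es.
have hs : hol U s.
  apply: (hol_comp (V := slit) (f := fun z => e * (z - w0)) (g := csqrt)) => //.
    apply: holM => //; first exact: hol_cst.
    by apply: holB => //; [exact: hol_id|exact: hol_cst].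
  exact: hol_csqrt.
have oD := @copen_udisc R.
have hF : hol udisc F.
  apply: holD => //; first exact: hol_cst.
  apply: holM => //; first exact: hol_cst.
  by apply: holX => //; exact: hol_icay.
have FK z : U z -> F (cay c (s z)) = z.
  by move=> Uz; rewrite /F cayK// ss// mulKf// addrC subrK.
exists (cay c \o s), F; split; split => /=.
- by apply: (hol_comp (V := hplane)) => //; [move=> z _; exact: sg|exact: hol_cay].
- by move=> z Uz; apply: cay_lt1.
- exact: hF.
- exact: FK.
- exact: caycc.
- move=> z Uz; have D1 : udisc (cay c (s z)) by apply: cay_lt1.
  have FU : \forall w \near cnbhs (cay c (s z)), U (F w).
    by apply: (ccvg_near (hol_ccvg hF D1)); rewrite FK//; exact: oU.
  apply: filterS2 FU (oD _ D1) => w UF w1; split => //.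
  rewrite /s /F; have -> : e * (w0 + e^-1 * icay c w ^+ 2 - w0) = icay c w ^+ 2 by field.
  by rewrite csqrt_sqr ?icayK//; exact: Re_icay_gt0.
(* Since [s^2 - c^2 = e (z - z0)], this function is the map divided by [z - z0]. Both factors of its
   denominator lie in the right half-plane. *)
- have H : has_log U (fun z => e / ((s z + c) * (s z + (conjc c)))).
    have sc z : U z -> ccvg (cnbhs z) s (s z) by move=> Uz; exact: hol_ccvg hs Uz.
    apply: has_logM; first exact: has_log_cst.
    apply: has_logV; apply: has_logM; apply: has_log_slit => z Uz.
    - by apply: ccvgD; [exact: sc|exact: ccvg_cst].
    - by apply: Re_gt0_slit; rewrite cReD addr_gt0.
    - by apply: ccvgD; [exact: sc|exact: ccvg_cst].
    - by apply: Re_gt0_slit; rewrite cReD addr_gt0.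
  have [L Lc LE] := H; exists L => // z Uz; rewrite LE//.
  have E : s z ^+ 2 - c ^+ 2 = e * (z - z0) by rewrite !ss//; ring.
  have d1 : s z + c != 0 by apply: Re_gt0_neq0; rewrite cReD addr_gt0.
  have d2 : s z + (conjc c) != 0 by exact: cay_den.
  rewrite mulrA [_ * e]mulrC -E /cay; field.
  by rewrite d1 d2.
Qed.

End Admissible.

(** * The Koebe step *)

Section KoebeStep.
Context {R : realType}.
Implicit Types (z w c e a : R[i]) (U : set R[i]) (f g F p q : R[i] -> R[i]).

(** Membership of [w] in the image of [f], with [F w] as the only candidate preimage. The second
    clause matters because [F] need not be injective on the disc: the Koebe step composes it with a
    two-to-one map. *)
Definition visible U f F w := U (F w) /\ f (F w) = w.

Lemma visible_near U z0 f F w : admissible U z0 f F -> visible U f F w ->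
  \forall x \near cnbhs w, visible U f F x.
Proof. by move=> [_ [H _]] [Uw E]; have := H _ Uw; rewrite E. Qed.

Lemma visible_image U z0 f F z : admissible U z0 f F -> U z -> visible U f F (f z).
Proof. by move=> [[_ _ _ H _] _] Uz; split; rewrite H. Qed.

(** The first omitted point on the segment from 0 to [a]; it is omitted because visibility is an
    open condition. The visible half-open segment before it carries the homotopy of the Koebe
    step. *)
Lemma accessible_omitted U z0 f F a : U z0 -> admissible U z0 f F -> udisc a ->
  ~ visible U f F a -> exists b, [/\ cabs b <= cabs a, b != 0, ~ visible U f F b &
    forall s : R, 0 <= s < 1 -> visible U f F (s%:C * b)].
Proof.
move=> Uz0 adm a1 na; have [[_ _ _ _ f0] _] := adm.
have v0 : visible U f F 0 by rewrite -f0; exact: visible_image adm Uz0.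
pose T := [set t : R | 0 <= t /\ forall s, 0 <= s <= t -> visible U f F (s%:C * a)].
have T0 : T 0.
  by split=> // s; rewrite -eq_le => /eqP <-; rewrite mul0r.
have T1 : ubound T 1.
  move=> t [t0 ht]; rewrite leNgt; apply/negP => t1; apply: na.
  by have := ht 1; rewrite ler01 ltW// mul1r; exact.
have sT : has_sup T by split; [exists 0|exists 1].
set m := sup T.
have m0 : 0 <= m by apply: ub_le_sup => //; exists 1.
have m1 : m <= 1 by apply: ge_sup => //; exists 0.
have lt_m s : 0 <= s < m -> visible U f F (s%:C * a).
  move=> /andP[s0 sm]; have ms0 : 0 < m - s by rewrite subr_gt0.
  have [t [t0 ht] mt] := sup_adherent ms0 sT.
  by apply: ht; rewrite s0 ltW//; move: mt; rewrite -/m subKr.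
have nm : ~ visible U f F (m%:C * a).
  move=> /(visible_near adm)[d d0 hd].
  have : T (m + d / 2).
    split=> [|s /andP[s0 sm]]; first by rewrite addr_ge0// ltW// divr_gt0.
    have [sm'|ms] := ltP s m; first by apply: lt_m; rewrite s0.
    apply: hd; rewrite -mulrBl -rmorphB cabsM cabs_realp ?subr_ge0//.
    apply: (@le_lt_trans _ _ (s - m)); last lra.
    by rewrite ler_piMr ?subr_ge0// ltW.
  move=> Tm; have : m + d / 2 <= m by apply: ub_le_sup => //; exists 1.
  lra.
have mp : 0 < m.
  by rewrite lt_neqAle m0 andbT; apply/eqP => m00; apply: nm; rewrite -m00 mul0r.
have aN0 : a != 0 by apply: contra_notN na => /eqP ->.
exists (m%:C * a); split=> //.
- by rewrite cabsM cabs_realp// ler_piMl ?cabs_ge0.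
- by rewrite mulf_neq0// -cabs_gt0 cabs_realp.
- move=> s /andP[s0 s1]; rewrite mulrA -rmorphM; apply: lt_m.
  by rewrite mulr_ge0//= gtr_pMl.
Qed.

Lemma not_slit (v : R[i]) : ~ slit v -> exists2 r : R, 0 <= r & v = - r%:C.
Proof.
rewrite /slit /= => /negP; rewrite -leNgt; have := cabs_sq v; have := cabs_ge0 v.
case: v => x y /=; set c := cabs _ => c0 c2 h; have xc : x <= - c by lra.
have y0 : y ^+ 2 = 0.
  apply/eqP; rewrite eq_le sqr_ge0 andbT.
  have : c ^+ 2 <= x ^+ 2 by rewrite -[leRHS]sqrrN ler_pXn2r ?nnegrE//; lra.
  lra.
exists (- x); first lra.
by move/eqP: y0; rewrite sqrf_eq0 => /eqP ->; rewrite rmorphN opprK.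
Qed.

Section Step.
Variables (U : set R[i]) (z0 : R[i]) (f F : R[i] -> R[i]) (a : R[i]).
Hypothesis oU : copen U.
Hypothesis Uz0 : U z0.
Hypothesis Us : forall w, ~ U w -> sees U w.
Hypothesis adm : admissible U z0 f F.
Hypothesis a1 : udisc a.
Hypothesis a0 : a != 0.
Hypothesis na : ~ visible U f F a.
Hypothesis ra : forall s : R, 0 <= s < 1 -> visible U f F (s%:C * a).

Let hf : hol U f. Proof. by case: adm => -[]. Qed.
Let f1 z : U z -> udisc (f z). Proof. by case: adm => -[_ + _ _ _] _; apply. Qed.
Let hF : hol udisc F. Proof. by case: adm => -[]. Qed.
Let FK z : U z -> F (f z) = z. Proof. by case: adm => -[_ _ _ + _] _; apply. Qed.
Let f0 : f z0 = 0. Proof. by case: adm => -[]. Qed.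
Let fc z : U z -> ccvg (cnbhs z) f (f z). Proof. exact: hol_ccvg hf. Qed.

Let fNa z : U z -> f z != a.
Proof. by move=> Uz; apply/eqP => E; apply: na; rewrite -E; exact: visible_image adm Uz. Qed.

Let rD (s : R) : 0 <= s <= 1 -> udisc (s%:C * a).
Proof.
move=> /andP[s0 s1]; rewrite /udisc /= cabsM cabs_realp//.
by rewrite (le_lt_trans _ a1)// ler_piMl ?cabs_ge0.
Qed.

Let zeta (s : R) := F (s%:C * a).

Let zeta_cvg (s : R) : 0 <= s <= 1 -> ccvg (nbhs s) zeta (zeta s).
Proof.
move=> s01; apply: (ccvg_comp (f := fun s : R => s%:C * a)).
  by apply: ccvgM; [apply: ccvg_real; exact: cvg_id|exact: ccvg_cst].
exact: hol_ccvg hF (rD s01).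
Qed.

Let w := F a.

Let zeta1 : zeta 1 = w. Proof. by rewrite /zeta mul1r. Qed.

(** If [F a] were in [U], continuity of [f] along [zeta] as [s] increases to 1 would give
    [f (F a) = a], making [a] visible. Hence [Us] provides a logarithm of [z - w]. *)
Let wNU : ~ U w.
Proof.
move=> Uw; apply: na; split=> //.
have h1 : ccvg (1 : R)^'- (fun s => f (zeta s)) (f w).
  have zc : ccvg (1 : R)^'- zeta w.
    move=> e e0; have := @zeta_cvg 1 _ e e0; rewrite ler01 lexx => /(_ isT).
    by rewrite zeta1; exact: cvg_within.
  exact: ccvg_comp zc (fc Uw).
have h2 : ccvg (1 : R)^'- (fun s => f (zeta s)) a.
  have h3 : ccvg (1 : R)^'- (fun s : R => s%:C * a) a.
    rewrite -[X in ccvg _ _ X]mul1r; apply: ccvgM; last exact: ccvg_cst.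
    by apply: ccvg_real; exact: cvg_within.
  move=> e e0; near=> s.
  have -> : f (zeta s) = s%:C * a.
    by apply: (ra _).2; apply/andP; split; near: s;
      [exact: nbhs_left_ge|exact: nbhs_left_lt].
  by near: s; exact: h3.
exact: ccvg_eq_unique h1 h2.
Unshelve. all: by end_near. Qed.

(** The homotopy moves the value [t a] together with its preimage [zeta t], so that zero and pole
    cancel; the derivative fills the removable singularity. It joins [f z / (z - z0)] to
    [(f z - a) / (z - w)]. *)
Let P (t : R) z := if z == zeta t then cder f z else (f z - t%:C * a) / (z - zeta t).

Let cder_f_neq0 z : U z -> cder f z != 0.
Proof.
move=> Uz; apply/eqP => E.
have := cder_comp f1 hf hF Uz; rewrite E mulr0 => H.
have : cder (F \o f) z = 1.
  apply: cder_eq; apply: sder_near (sder_id z).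
  by apply: filterS (oU Uz) => x Ux; rewrite /= FK.
by rewrite H => /esym/eqP; rewrite oner_eq0.
Qed.

Let P_neq0 t z : 0 <= t <= 1 -> U z -> P t z != 0.
Proof.
move=> /andP[t0 t1] Uz; rewrite /P; case: (eqVneq z (zeta t)) => [_|zt]; first exact: cder_f_neq0.
rewrite mulf_neq0 ?invr_eq0 ?subr_eq0//.
move: t1; rewrite le_eqVlt => /orP[/eqP ->|t1]; first by rewrite mul1r fNa.
have [_ E] : visible U f F (t%:C * a) by apply: ra; rewrite t0.
by apply: contra zt => /eqP fz; rewrite /zeta -fz FK.
Qed.

(** Strictness of the derivative is essential here: when [z = zeta t], both the point and the
    singularity [zeta s] move at once. *)
Let P_cont t z : 0 <= t <= 1 -> U z -> forall e : R, 0 < e ->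
  exists2 d : R, 0 < d & forall s x, 0 <= s <= 1 -> `|s - t| < d ->
    cabs (x - z) < d -> cabs (P s x - P t z) < e.
Proof.
move=> t01 Uz e e0.
pose G := filter_prod (within [set s : R | 0 <= s <= 1] (nbhs t)) (cnbhs z).
suff [[B C] /= [/nbhs_ballP[d1 /= d10 hB] [d2 d20 hC]] BC] :
    \forall x \near G, cabs (P x.1 x.2 - P t z) < e.
  exists (Num.min d1 d2); first by rewrite lt_min d10.
  move=> s x s1; rewrite !lt_min => /andP[st _] /andP[_ xz].
  by apply: (BC (s, x)); split=> /=; [apply: hB => //; rewrite /ball/= distrC|exact: hC].
have FG : Filter G by exact: filter_prod_filter.
have sndG : ccvg G snd z.
  move=> r r0; exists (setT, [set x | cabs (x - z) < r]) => /=.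
    by split; [exact: filterT|exact: near_cnbhs].
  by move=> [x y] [].
have zetaG : ccvg G (fun x => zeta x.1) (zeta t).
  move=> r r0; exists ([set s | cabs (zeta s - zeta t) < r], setT) => /=.
    split; last exact: filterT.
    exact: cvg_within (zeta_cvg t01 r0).
  by move=> [x y] [].
have fstG : ccvg G (fun x => x.1%:C) t%:C.
  move=> r r0; exists ([set s | cabs (s%:C - t%:C) < r], setT) => /=.
    split; last exact: filterT.
    have tt : ccvg (nbhs t) (fun s : R => s%:C) t%:C by apply: ccvg_real; exact: cvg_id.
    exact: cvg_within (tt r r0).
  by move=> [x y] [].
have fG : ccvg G (fun x => f x.2) (f z) by exact: ccvg_comp sndG (fc Uz).
have [zt|zt] := eqVneq z (zeta t); last first.
  have dG : ccvg G (fun x => x.2 - zeta x.1) (z - zeta t) by exact: ccvgB.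
  have z0' : z - zeta t != 0 by rewrite subr_eq0.
  have QG : ccvg G (fun x => (f x.2 - x.1%:C * a) / (x.2 - zeta x.1)) (P t z).
    rewrite /P (negbTE zt); apply: ccvgM; last exact: ccvgV.
    by apply: ccvgB => //; apply: ccvgM => //; exact: ccvg_cst.
  near=> x; rewrite {1}/P ifF; first by near: x; exact: QG.
  by apply/negbTE; rewrite -subr_eq0; near: x; exact: ccvg_neq0 dG.
(* [zeta 1 = w] lies outside [U], so [z = zeta t] excludes [t = 1]. For [s < 1] the point [s a] is
   visible and equals [f (zeta s)], hence [P s x] is a difference quotient of [f], or its
   derivative. *)
have t1 : t < 1.
  have /andP[_] := t01; rewrite le_eqVlt => /orP[/eqP t1|//].
  by exfalso; apply: wNU; rewrite -zeta1 -t1 -zt.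
have Pt : P t z = cder f z by rewrite /P -zt eqxx.
rewrite -zt in zetaG; have [q ql fq] := hol_sder hf Uz.
have qG : ccvg G (fun x => q (x.2, zeta x.1)) (P t z).
  by rewrite Pt; exact: ccvg_pair2 sndG zetaG ql.
have fqG : \forall x \near G, f x.2 - f (zeta x.1) = q (x.2, zeta x.1) * (x.2 - zeta x.1).
  exact: near_pair2 sndG zetaG fq.
have cG : ccvg G (fun x => cder f x.2) (P t z).
  rewrite Pt; apply: (ccvg_comp sndG).
  by apply: sder_cvg_deriv; apply: filterS (oU Uz) => x; exact: hol_sder hf.
have sG : \forall x \near G, 0 <= x.1 < 1.
  exists ([set s | 0 <= s < 1], setT) => /=; last by move=> [x y] [].
  split; last exact: filterT.
  have lt1 : \forall s \near t, s < 1 by exact: lt_nbhsl t1.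
  by apply: filterS lt1 => s s1 /= /andP[s0 _]; rewrite s0.
near=> x; rewrite {1}/P; case: (eqVneq x.2 (zeta x.1)) => [_|xz]; first by near: x; exact: cG.
have -> : x.1%:C * a = f (zeta x.1).
  by rewrite (ra _).2//; near: x; exact: sG.
rewrite (near fqG x)// mulfK ?subr_eq0//.
by near: x; exact: qG.
Unshelve. all: by end_near. Qed.

(** [f - a] is [P 1] times [z - w]: the first factor has a logarithm by continuation from [P 0], the
    second by the sector condition. *)
Lemma has_log_omitted : has_log U (fun z => f z - a).
Proof.
have [_ [_ [L Lc LE]]] := adm.
have zeta0 : zeta 0 = z0 by rewrite /zeta mul0r -f0 FK.
have H0 : has_log U (P 0).
  exists L => // z Uz; rewrite /P zeta0 mul0r subr0; case: eqVneq => [->|zz0]; last first.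
    by rewrite LE// mulrAC mulfV ?mul1r// subr_eq0.
  have [q ql fq] := hol_sder hf Uz0.
  have fq' := near_pairz fq; have ql' := ccvg_pairz ql.
  have Lc' : ccvg (cnbhs z0) (fun z => cexp (L z)) (cexp (L z0)).
    by apply: (ccvg_comp (Lc _ Uz0)); exact: sder_ccvg (sder_cexp _).
  (* At [z0] the exponential of the given logarithm has to be [f'(z0)]: it agrees with the
     difference quotient of [f] off [z0], and the two limits coincide. *)
  apply/eqP; rewrite -subr_eq0 -cabs_eq0 eq_le cabs_ge0 andbT.
  apply/ler_addgt0Pr => e e0; rewrite add0r; have e20 : 0 < e / 2 by rewrite divr_gt0.
  have [x xz [[h1 h2] [h3 h4]]] :=
    near_neq (filterI (filterI fq' (oU Uz0)) (filterI (ql' _ e20) (Lc' _ e20))).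
  have E : q (x, z0) = cexp (L x).
    have xz0 : x - z0 != 0 by rewrite subr_eq0.
    by apply: (mulIf xz0); rewrite /= in h1; rewrite -h1 f0 subr0 LE// mulrC.
  rewrite /= E in h3; have := cabs_distD (cexp (L x)) (cexp (L z0)) (cder f z0).
  by rewrite (cabsB (cexp (L z0)) (cexp (L x))); rewrite /= in h4; lra.
have H1 := log_homotopy oU P_neq0 P_cont H0.
apply: has_log_congr (has_logM H1 (sees_log (Us wNU))) => z Uz.
have zw : z != w by apply/eqP => zw; apply: wNU; rewrite -zw.
by rewrite /P zeta1 (negbTE zw) mul1r divfK// subr_eq0.
Qed.

Let p z := mob a (f z).

Let has_log_den : has_log U (fun z => 1 - conjc a * f z).
Proof.
apply: has_log_slit => z Uz; last exact/Re_gt0_slit/mob_den/f1.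
apply: ccvgB; first exact: ccvg_cst.
by apply: ccvgM; [exact: ccvg_cst|exact: fc].
Qed.

Let has_log_p : has_log U p.
Proof. exact: has_logM has_log_omitted (has_logV has_log_den). Qed.

Let p1 z : U z -> udisc (p z). Proof. by move=> Uz; apply: mob_lt1 => //; exact: f1. Qed.

Let hp : hol U p.
Proof. by apply: (hol_comp (V := udisc)) => //; exact: hol_mob. Qed.

Section Root.
Variable l : R[i] -> R[i].
Hypothesis lc : forall z, U z -> ccvg (cnbhs z) l (l z).
Hypothesis lE : forall z, U z -> cexp (l z) = p z.

Let s z := cexp (2^-1 * l z).

Let s2 z : U z -> s z ^+ 2 = p z.
Proof. by move=> Uz; rewrite expr2 /s -cexpD addr_half lE. Qed.

Let s0 z : s z != 0. Proof. exact: cexp_neq0. Qed.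

Let hlc z : U z -> ccvg (cnbhs z) (fun z => 2^-1 * l z) (2^-1 * l z).
Proof. by move=> Uz; apply: ccvgM; [exact: ccvg_cst|exact: lc]. Qed.

Let has_log_s : has_log U s. Proof. by exists (fun z => 2^-1 * l z). Qed.

Let sc z : U z -> ccvg (cnbhs z) s (s z).
Proof. by move=> Uz; apply: (ccvg_comp (hlc Uz)); exact: sder_ccvg (sder_cexp _). Qed.

Let s1 z : U z -> udisc (s z).
Proof.
move=> Uz; have := p1 Uz; rewrite /udisc /= -s2// cabsX.
by rewrite expr_lt1// cabs_ge0.
Qed.

Let sqr_sder z : sder (fun x : R[i] => x ^+ 2) z (2 * z).
Proof. by have := sderX 2 (sder_id z); rewrite mulr1 /= expr1. Qed.

Let hs : hol U s.
Proof.
apply: (hol_lift (V := setT) (g := fun x => x ^+ 2) (p := p)) => //.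
- by apply: holX; [exact: copenT|apply: hol_id; exact: copenT].
- by move=> z Uz; rewrite (cder_eq (sqr_sder _)) mulf_neq0// pnatr_eq0.
Qed.

Let b := s z0.

Let b1 : cabs b < 1. Proof. exact: s1. Qed.

Let b2 : b ^+ 2 = - a. Proof. by rewrite s2// /p f0 mob0. Qed.

Let Nb1 : cabs (- b) < 1. Proof. by rewrite cabsN. Qed.
Let Na1 : cabs (- a) < 1. Proof. by rewrite cabsN. Qed.

(** A Blaschke product of degree two with [B 0 = 0] that undoes the step: the new map [mob b (s z)]
    satisfies [f = B \o f2], so [F \o B] is its left inverse. *)
Let B z := mob (- a) (mob (- b) z ^+ 2).

Let BD z : udisc z -> udisc (B z).
Proof.
move=> z1; apply: mob_lt1 => //; rewrite cabsX expr_lt1 ?cabs_ge0//.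
exact: mob_lt1.
Qed.

Let hB : hol udisc B.
Proof.
have oD := @copen_udisc R.
apply: (hol_comp (V := udisc) (f := fun z => mob (- b) z ^+ 2)) => //.
- move=> z z1; rewrite /udisc /= cabsX expr_lt1 ?cabs_ge0//; exact: mob_lt1.
- by apply: holX => //; exact: hol_mob.
- exact: hol_mob.
Qed.

Let BK z : U z -> B (mob b (s z)) = f z.
Proof. by move=> Uz; rewrite /B mobK// ?s2 ?mobK//; [exact: f1|exact: s1]. Qed.

(* Along the slit [0, a) the quotient [s / b] is real and nonzero, with value 1 at 0. *)
Let s_slit t : 0 <= t < 1 -> 0 < complex.Re (s (zeta t) / b).
Proof.
move=> /andP[t0 t1].
pose g (r : R) := complex.Re (s (zeta r) / b).
have Uzeta r : 0 <= r <= t -> U (zeta r) /\ f (zeta r) = r%:C * a.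
  by move=> /andP[r0 rt]; apply: ra; rewrite r0 (le_lt_trans rt).
have g0 : g 0 = 1.
  have z00 : zeta 0 = z0 by rewrite /zeta mul0r -f0 FK.
  by rewrite /g z00 divff ?s0.
have gn0 r : 0 <= r <= t -> g r != 0.
  move=> rt; have [Uz fz] := Uzeta _ rt; have /andP[r0 rt'] := rt.
  have r1 : r < 1 := le_lt_trans rt' t1.
  have ca : cabs a ^+ 2 < 1 by rewrite expr_lt1// cabs_ge0.
  have cr : r * cabs a ^+ 2 < 1 by rewrite (le_lt_trans _ ca)// ler_piMl ?sqr_ge0// ltW.
  (* Here [p (zeta r) = - a (1 - r) / (1 - r |a|^2)] and [b^2 = - a], so the square is a positive
     real. A vanishing real part of the quotient would make it nonpositive. *)
  have E : (s (zeta r) / b) ^+ 2 = ((1 - r) / (1 - r * cabs a ^+ 2))%:C.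
    rewrite expr_div_n s2// b2 /p fz /mob mulrCA conjcMself.
    have dn : 1 - r%:C * (cabs a ^+ 2)%:C != 0 :> R[i].
      rewrite -rmorphM -(rmorph1 (real_complex R)) -rmorphB -cabs_gt0 cabs_real.
      by rewrite normr_gt0 gt_eqF// subr_gt0.
    have -> : ((1 - r) / (1 - r * cabs a ^+ 2))%:C =
        (1 - r%:C) / (1 - r%:C * (cabs a ^+ 2)%:C) :> R[i].
      by rewrite fmorph_div /= !rmorphB rmorphM rmorph1.
    by move: dn; move: (cabs a ^+ 2)%:C r%:C => n rc dn; field; rewrite dn a0.
  apply: contraTneq (divr_gt0 (_ : 0 < 1 - r) (_ : 0 < 1 - r * cabs a ^+ 2)) => [gr0||].
  - have := congr1 (@complex.Re R) E; rewrite expr2 cReM -/(g r) gr0 mul0r sub0r /= => <-.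
    by rewrite -leNgt oppr_le0 -expr2 sqr_ge0.
  - by rewrite subr_gt0.
  - by rewrite subr_gt0.
have gc : {within `[0, t], continuous g}.
  apply: continuous_in_subspaceT => r /set_mem; rewrite /= in_itv /= => rt.
  have [Uz _] := Uzeta _ rt; have /andP[r0 rt'] := rt.
  have r01 : 0 <= r <= 1 by rewrite r0 ltW// (le_lt_trans rt').
  apply: ccvg_Re; apply: ccvgM; last exact: ccvg_cst.
  exact: ccvg_comp (zeta_cvg r01) (sc Uz).
rewrite -/(g t) ltNge; apply/negP => gt.
have [|c] := @IVT _ g 0 t 0 t0 gc.
  by rewrite g0 ge_min le_max gt ler01 orbT.
rewrite in_itv /= => ct gc0; move: (gn0 _ ct); rewrite gc0 eqxx//.
Qed.

Let b0 : b != 0. Proof. exact: s0. Qed.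

(** This provides a logarithm of [s + b = s (1 + b / s)]. If [1 + b / s] were [- r] with [r >= 0],
    then [s = - tau b] with [0 < tau <= 1], which forces [f z] onto the segment [[0, a)]; there
    [s_slit] says that [s / b] has positive real part. *)
Let slit_quot z : U z -> slit (1 + b / s z).
Proof.
move=> Uz; apply: contrapT => /not_slit[r r0 hr].
have r1 : 1 + r != 0 by rewrite gt_eqF// ltr_pwDl.
have E : s z = - ((1 + r)^-1)%:C * b.
  have E1 : b / s z = - (1 + r)%:C by rewrite rmorphD rmorph1 opprD -hr; ring.
  have rC : (1 + r)%:C != 0 :> R[i] by rewrite -cabs_gt0 cabs_real normr_gt0.
  have -> : s z = b / (b / s z) by move: (s0 z) b0; move: (s z) b => q1 q2 h1 h2; field; rewrite h1 h2.
  by rewrite E1 invrN fmorphV mulrN mulNr mulrC.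
pose tau := (1 + r)^-1; rewrite -/tau in E.
have tau0 : 0 < tau by rewrite invr_gt0 ltr_pwDl.
have tau1 : tau <= 1 by rewrite invf_le1 ?lerDl// ltr_pwDl.
have pz : p z = - (tau ^+ 2)%:C * a by rewrite -s2// E exprMn sqrrN -rmorphXn b2 mulrN mulNr.
have ca : cabs a ^+ 2 < 1 by rewrite expr_lt1// cabs_ge0.
have tt1 : tau ^+ 2 <= 1 by rewrite expr_le1// ltW.
have tt0 : 0 < tau ^+ 2 by rewrite exprn_gt0.
have den : 0 < 1 - tau ^+ 2 * cabs a ^+ 2.
  by rewrite subr_gt0 (le_lt_trans _ ca)// ler_piMl ?sqr_ge0.
(* The solution of [mob a (t a) = - tau^2 a]. *)
pose t := (1 - tau ^+ 2) / (1 - tau ^+ 2 * cabs a ^+ 2).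
have fz : f z = t%:C * a.
  rewrite -[LHS](mobK a1 (f1 Uz)) -/(p z) pz /mob rmorphN mulNr mulrN mulNr !opprK mulrCA conjcMself.
  have -> : - ((tau ^+ 2)%:C * a) + a = (1 - tau ^+ 2)%:C * a by rewrite rmorphB rmorph1; ring.
  rewrite -rmorphM -(rmorph1 (real_complex R)) -rmorphB /t fmorph_div /=; ring.
have t01 : 0 <= t < 1.
  apply/andP; split; first by apply: divr_ge0; [lra|exact: ltW].
  by rewrite /t ltr_pdivrMr// mul1r ltrD2l ltrN2 gtr_pMr.
have := s_slit t01; rewrite /zeta -fz FK// E mulfK// -rmorphN /=.
by rewrite oppr_gt0 ltNge ltW.
Qed.

Let f2 z := mob b (s z).
Let F2 z := F (B z).

Lemma root_admissible : admissible U z0 f2 F2.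
Proof.
have oD := @copen_udisc R.
have hf2 : hol U f2 by apply: (hol_comp (V := udisc)) => //; exact: hol_mob.
have f2D z : U z -> udisc (f2 z) by move=> Uz; apply: mob_lt1 => //; exact: s1.
have hF2 : hol udisc F2 by apply: (hol_comp (V := udisc) (f := B)).
have F2K z : U z -> F2 (f2 z) = z by move=> Uz; rewrite /F2 BK// FK.
split; split=> //; first by rewrite /f2 mobb.
- move=> z Uz; have D1 := f2D _ Uz.
  have FU : \forall x \near cnbhs (f2 z), U (F2 x).
    by apply: (ccvg_near (hol_ccvg hF2 D1)); rewrite F2K//; exact: oU.
  have vB : \forall x \near cnbhs (f2 z), visible U f F (B x).
    apply: (ccvg_near (hol_ccvg hB D1)); rewrite BK//.
    exact: visible_near adm (visible_image adm Uz).
  have sF : ccvg (cnbhs (f2 z)) (fun x => s (F2 x)) (s z).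
    apply: (ccvg_comp (f := F2) (l := z)); last exact: sc.
    by have := hol_ccvg hF2 D1; rewrite F2K.
  have mF : ccvg (cnbhs (f2 z)) (mob (- b)) (s z).
    by have := hol_ccvg (hol_mob Nb1) D1; rewrite mobK//; exact: s1.
  have sz0 : 0 < cabs (s z) by rewrite cabs_gt0.
  near=> x.
  have x1 : udisc x by near: x; exact: oD.
  have UF : U (F2 x) by near: x; exact: FU.
  have [_ fB] : visible U f F (B x) by near: x; exact: vB.
  split=> //; suff E : s (F2 x) = mob (- b) x by rewrite /f2 E mobNK.
  (* The squares agree because [B] undoes the step. The sign is then settled by continuity: both
     roots are within [|s z|] of [s z], so they cannot be opposite. *)
  have : s (F2 x) ^+ 2 = mob (- b) x ^+ 2.
    rewrite s2// /p fB /B mobNK//.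
    by rewrite cabsX expr_lt1 ?cabs_ge0//; exact: mob_lt1.
  move=> /eqP; rewrite eqf_sqr => /orP[/eqP //|/eqP E].
  have h1 : cabs (s (F2 x) - s z) < cabs (s z) by near: x; exact: sF.
  have h2 : cabs (mob (- b) x - s z) < cabs (s z) by near: x; exact: mF.
  exfalso; have : cabs (s z + s z) <= cabs (s (F2 x) - s z) + cabs (mob (- b) x - s z).
    rewrite (cabsB (s (F2 x))) (cabsB (mob _ _)).
    have -> : s z + s z = (s z - s (F2 x)) + (s z - mob (- b) x) by rewrite E; ring.
    exact: cabsD.
  by rewrite -mulr2n -mulr_natl cabsM -(rmorph_nat (real_complex R)) cabs_realp//; lra.
- have [_ [_ [L Lc LE]]] := adm.
  (* The quotient [f2 z / (z - z0)] in factored form, from [(s - b) (s + b) = p + a = f (1 - |a|^2)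
     / (1 - conj a f)]. Every factor has a logarithm, [s + b] by [slit_quot]. *)
  have h : has_log U (fun z => cexp (L z) * ((1 - conjc a * a) / ((1 - conjc a * f z) *
      (s z * (1 + b / s z)) * (1 - conjc b * s z)))).
    apply: has_logM; first by exists L.
    apply: has_logM.
      by apply: has_log_cst; exact/Re_gt0_neq0/mob_den.
    apply: has_logV; apply: has_logM; last first.
      apply: has_log_slit => z Uz; last exact/Re_gt0_slit/mob_den/s1.
      apply: ccvgB; first exact: ccvg_cst.
      by apply: ccvgM; [exact: ccvg_cst|exact: sc].
    apply: has_logM => //; apply: has_logM => //.
    apply: has_log_slit => // z Uz; apply: ccvgD; first exact: ccvg_cst.
    by apply: ccvgM; [exact: ccvg_cst|apply: ccvgV => //; exact: sc].
  have [M Mc ME] := h; exists M => // z Uz; rewrite ME//.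
  have d1 : 1 - conjc a * f z != 0 by exact/Re_gt0_neq0/mob_den/f1.
  have d2 : 1 - conjc b * s z != 0 by exact/Re_gt0_neq0/mob_den/s1.
  have d3 : s z + b != 0.
    have := slit_neq0 (slit_quot Uz); apply: contraNneq => E.
    have -> : b = - s z by apply/eqP; rewrite -addr_eq0 addrC E.
    by rewrite mulNr divff// subrr.
  have E0 : (s z - b) * (s z + b) = f z * (1 - conjc a * a) / (1 - conjc a * f z).
    have -> : (s z - b) * (s z + b) = s z ^+ 2 - b ^+ 2 by ring.
    by rewrite s2// b2 /p /mob; field.
  have -> : s z * (1 + b / s z) = s z + b by field.
  rewrite /f2 /mob mulrA -LE//.
  apply: (mulIf d3); rewrite mulrAC E0; field.
  by rewrite d1 d2 d3.
Unshelve. all: by end_near. Qed.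

(** The chain rule in [f = B \o f2]: with [|b|^2 = |a|], [|B'(0)| = 2 |b| (1 - |b|^2) / (1 - |a|^2)
    = 2 sqrt |a| / (1 + |a|)], which is less than 1. The new derivative at [z0] is therefore
    larger. *)
Lemma root_derivative :
  (1 + cabs a) * cabs (cder f z0) = 2 * Num.sqrt (cabs a) * cabs (cder f2 z0).
Proof.
have [[hf2 f2D _ _ f20] _] := root_admissible.
have -> : cder f z0 = cder B 0 * cder f2 z0.
  rewrite -f20 -(cder_comp f2D hf2 hB Uz0); apply/esym/cder_eq.
  apply: sder_near (hol_sder hf Uz0).
  by apply: filterS (oU Uz0) => x Ux; rewrite /= BK.
have u0 : udisc (0 : R[i]) by rewrite /udisc /= cabs0.
have cb2 : cabs b ^+ 2 = cabs a by rewrite -cabsX b2 cabsN.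
have cb : cabs b = Num.sqrt (cabs a) by rewrite -cb2 sqrtr_sqr ger0_norm ?cabs_ge0.
have -> : cder B 0 = cder (mob (- a)) (- a) * (2 * b) * cder (mob (- b)) 0.
  apply: cder_eq.
  have D1 := hol_sder (hol_mob Nb1) u0.
  have D2 := sder_comp D1 (sqr_sder (mob (- b) 0)).
  have Eb : mob (- b) 0 = b by rewrite mob0 opprK.
  have D3 := hol_sder (hol_mob Na1) (_ : udisc (- a)).
  have := sder_comp D2 (_ : sder (mob (- a)) _ (cder (mob (- a)) (- a))).
  rewrite /= Eb b2 => H; rewrite -mulrA; apply: H; exact: D3.
rewrite cder_mob// cder_mob ?cabs0// mulr0 subr0 expr1n divr1.
have d1 : 1 - conjc (- a) * - a != 0 by exact/Re_gt0_neq0/mob_den.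
have -> : (1 - conjc (- a) * - a) / (1 - conjc (- a) * - a) ^+ 2 = (1 - conjc (- a) * - a)^-1.
  by move: d1; move: (1 - _) => d d1; field.
rewrite (cabsM _ (cder f2 z0)) (cabsM _ (1 - _)) (cabsM _ (2 * b)) (cabsM 2 b) cb.
rewrite !conjcMself !cabsN cb2 cabsV -(rmorph1 (real_complex R)) -!rmorphB.
rewrite -(rmorph_nat (real_complex R)) !cabs_real.
have ca0 : 0 < cabs a by rewrite cabs_gt0.
have ca1 : cabs a < 1 by [].
have ca2 : cabs a ^+ 2 < 1 by rewrite expr_lt1// cabs_ge0.
rewrite !ger0_norm//; [|lra|lra].
have n1 : 1 - cabs a ^+ 2 != 0 by rewrite gt_eqF// subr_gt0.
by field.
Qed.

End Root.

Lemma koebe_step_accessible : exists f2 F2, admissible U z0 f2 F2 /\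
  (1 + cabs a) * cabs (cder f z0) = 2 * Num.sqrt (cabs a) * cabs (cder f2 z0).
Proof.
have [l lc lE] := has_log_p.
exists (fun z => mob (cexp (2^-1 * l z0)) (cexp (2^-1 * l z))); eexists.
by split; [exact: root_admissible lc lE|exact: root_derivative lc lE].
Qed.

End Step.

(** The first omitted point on the segment may lie closer to 0 than [a], so the gain is expressed by
    its modulus [r]. *)
Lemma koebe_step U z0 f F a : copen U -> U z0 -> (forall w, ~ U w -> sees U w) ->
  admissible U z0 f F -> udisc a -> ~ visible U f F a ->
  exists f2 F2 r, [/\ admissible U z0 f2 F2, 0 < r <= cabs a &
    (1 + r) * cabs (cder f z0) = 2 * Num.sqrt r * cabs (cder f2 z0)].
Proof.
move=> oU Uz0 Us adm a1 na.
have [b [ba b0 nb rb]] := accessible_omitted Uz0 adm a1 na.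
have b1 : udisc b := le_lt_trans ba a1.
have [f2 [F2 [adm2 E]]] := koebe_step_accessible oU Uz0 Us adm b1 b0 nb rb.
by exists f2, F2, (cabs b); split=> //; rewrite cabs_gt0 b0.
Qed.

End KoebeStep.

(** * Near-extremal maps *)

Section Extremal.
Context {R : realType}.
Implicit Types (z w c e a : R[i]) (U : set R[i]) (f g F p q : R[i] -> R[i]).

Lemma admissible_cder_neq0 U z0 f F z : copen U -> admissible U z0 f F -> U z ->
  cder F (f z) * cder f z = 1.
Proof.
move=> oU [[hf f1 hF FK _] _] Uz; rewrite -(cder_comp f1 hf hF Uz).
apply: cder_eq; apply: sder_near (sder_id z).
by apply: filterS (oU z Uz) => x Ux; rewrite /= FK.
Qed.

(** Schwarz-Pick on a disc around [z0] bounds all competing derivatives. A map that omits a point of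
    modulus below [r] can be improved by the factor [1 / k] at least, with
    [k = 2 sqrt r / (1 + r) < 1]; one whose derivative exceeds [k] times the supremum omits no such
    point. *)
Lemma extremal_map U z0 (r : R) : copen U -> U z0 -> (forall w, ~ U w -> sees U w) ->
  (exists w, ~ U w) -> 0 < r < 1 ->
  exists f F, admissible U z0 f F /\ forall w, cabs w < r -> visible U f F w.
Proof.
move=> oU Uz0 Us [w0 /Us /(admissible_exists oU Uz0)[f0 [F0 adm0]]] /andP[r0 r1].
pose T := [set cabs (cder fF.1 z0) | fF in [set fF : (R[i] -> R[i]) * (R[i] -> R[i]) |
  admissible U z0 fF.1 fF.2]].
have T0 : T (cabs (cder f0 z0)) by exists (f0, F0).
have p0 : 0 < cabs (cder f0 z0).
  rewrite cabs_gt0; have := admissible_cder_neq0 oU adm0 Uz0.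
  by apply: contra_eq_neq => ->; rewrite mulr0 eq_sym oner_eq0.
have [d d0 hd] := oU _ Uz0.
have Tub : ubound T d^-1.
  move=> _ [[f F] /= [[hf f1 _ _ _] _] <-].
  have : d * cabs (cder f z0) <= 1 - cabs (f z0) ^+ 2.
    by apply: schwarz_pick => //; [apply: holS hf => x; exact: hd|move=> x /hd; exact: f1].
  have := sqr_ge0 (cabs (f z0)) => s0 dc.
  by rewrite -[leRHS]mulr1 ler_pdivlMl//; lra.
have sT : has_sup T by split; [exists (cabs (cder f0 z0))|exists d^-1].
have S0 : 0 < sup T by rewrite (lt_le_trans p0)//; apply: ub_le_sup => //; exists d^-1.
have [y [y0 y1 yr]] : exists y : R, [/\ 0 < y, y < 1 & y ^+ 2 = r].
  exists (Num.sqrt r); split; [by rewrite sqrtr_gt0| |by rewrite sqr_sqrtr// ltW].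
  by rewrite -sqrtr1 ltr_sqrt.
pose k : R := 2 * y / (1 + r).
have r10 : 0 < 1 + r by rewrite addr_gt0.
have k1 : k < 1.
  rewrite /k ltr_pdivrMr// mul1r -yr -subr_gt0.
  have -> : 1 + y ^+ 2 - 2 * y = (1 - y) ^+ 2 by ring.
  by rewrite exprn_gt0// subr_gt0.
have Sk : 0 < sup T - k * sup T by rewrite -{1}[sup T]mul1r -mulrBl mulr_gt0// subr_gt0.
have [_ [[f F] /= adm <-]] := sup_adherent Sk sT; rewrite subKr => lt_f.
exists f, F; split => // w wr; apply: contrapT => nw.
have w1 : udisc w := lt_trans wr r1.
have [f2 [F2 [s [adm2 /andP[s0 sw] E]]]] := koebe_step oU Uz0 Us adm w1 nw.
have le_f2 : cabs (cder f2 z0) <= sup T.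
  by apply: ub_le_sup; [exists d^-1|exists (f2, F2)].
have [x [Ex x0 xs]] : exists x : R, [/\ Num.sqrt s = x, 0 < x & x ^+ 2 = s].
  by exists (Num.sqrt s); rewrite sqrtr_gt0 sqr_sqrtr// ltW.
rewrite {}Ex in E.
have xy : x < y.
  by rewrite -(@ltr_pXn2r _ 2) ?nnegrE ?(ltW x0) ?(ltW y0)// xs yr (le_lt_trans sw).
(* [t / (1 + t^2)] increases on [(0, 1)], here taken at the roots [x < y] of [s] and [r]. *)
have A : (1 + r) * x <= (1 + s) * y.
  rewrite -subr_ge0 -xs -yr.
  have -> : (1 + x ^+ 2) * y - (1 + y ^+ 2) * x = (y - x) * (1 - y * x) by ring.
  rewrite mulr_ge0 ?subr_ge0 ?(ltW xy)// mulr_ile1 ?(ltW x0) ?(ltW y0) ?(ltW y1)//.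
  by rewrite ltW// (lt_trans xy).
have c0 := cabs_ge0 (cder f2 z0).
have s10 : 0 < 1 + s by rewrite addr_gt0.
have B : (1 + r) * cabs (cder f z0) <= 2 * y * cabs (cder f2 z0).
  rewrite -(ler_pM2l s10).
  have -> : (1 + s) * ((1 + r) * cabs (cder f z0)) =
     (1 + r) * x * (2 * cabs (cder f2 z0)).
    by rewrite mulrCA E; ring.
  have -> : (1 + s) * (2 * y * cabs (cder f2 z0)) = (1 + s) * y * (2 * cabs (cder f2 z0)).
    by ring.
  by rewrite ler_wpM2r// mulr_ge0.
move: lt_f; rewrite ltNge => /negP; apply; rewrite /k.
apply: (@le_trans _ _ (2 * y / (1 + r) * cabs (cder f2 z0))); last first.
  by rewrite ler_wpM2l// divr_ge0 ?ltW// mulr_gt0.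
by rewrite mulrAC ler_pdivlMr// mulrC.
Qed.

(** By Schwarz-Pick on discs of radius [r], the derivative of [log (1 - |f|^2)] along the segment
    from [z] to [w] is at most [2 |w - z| / r], hence at most 2. The point is that the resulting
    factor does not depend on [f]. *)
Lemma log_lipschitz U f z w (r : R) : 0 < r -> hol U f ->
  (forall x, U x -> cabs (f x) < 1) ->
  disc z (2 * r) `<=` U -> cabs (w - z) < r ->
  (1 - cabs (f z) ^+ 2) * expR (- 2) <= 1 - cabs (f w) ^+ 2 /\
  (1 - cabs (f w) ^+ 2) * expR (- 2) <= 1 - cabs (f z) ^+ 2.
Proof.
move=> r0 hf f1 DU wz; set e := w - z.
pose x (t : R) := z + t%:C * e.
have xz (t : R) : 0 <= t <= 1 -> cabs (x t - z) < r.
  move=> /andP[t0 t1]; rewrite /x addrAC subrr add0r cabsM cabs_realp//.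
  by rewrite (le_lt_trans _ wz)// ler_piMl ?cabs_ge0.
have Dx (t : R) : 0 <= t <= 1 -> disc (x t) r `<=` U.
  move=> t01 y yx; apply: DU; rewrite /disc /=; apply: le_lt_trans (cabs_distD (x t) _ _) _.
  by have := xz _ t01; rewrite /disc /= in yx; lra.
have Ux (t : R) : 0 <= t <= 1 -> U (x t).
  by move=> t01; apply: (Dx _ t01); rewrite /disc /= subrr cabs0.
pose u t := complex.Re (f (x t)); pose v t := complex.Im (f (x t)).
pose u1 t := complex.Re (cder f (x t) * e); pose v1 t := complex.Im (cder f (x t) * e).
pose g t : R := 1 - (u t ^+ 2 + v t ^+ 2).
pose g1 t : R := - (2 * (u t * u1 t + v t * v1 t)).
have gE (t : R) : g t = 1 - cabs (f (x t)) ^+ 2 by rewrite cabs_sq.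
have g0 (t : R) : 0 <= t <= 1 -> 0 < g t.
  by move=> /Ux /f1 ft; rewrite gE subr_gt0 expr_lt1// cabs_ge0.
have Dg (t : R) : 0 <= t <= 1 -> is_derive t 1 g (g1 t).
  move=> /Ux Ut; have [Du Dv] := is_derive_line (hol_sder hf Ut).
  rewrite -/(x _) -/u -/v -/(u1 t) -/(v1 t) in Du Dv.
  by apply: is_derive_eq; rewrite /g1 /GRing.scale /=; ring.
have Dl (t : R) : 0 <= t <= 1 -> is_derive t 1 (fun s => ln (g s)) (g1 t / g t).
  move=> t01; have Dgt := Dg _ t01; have gt0 := g0 _ t01.
  have Dln := is_derive1_ln gt0.
  have := @is_derive1_comp R (@ln R) g t _ _ Dln Dgt.
  by rewrite mulrC.
have Bd (t : R) : 0 <= t <= 1 -> `|g1 t / g t| <= 2.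
  move=> t01; have gt0 := g0 _ t01.
  rewrite normrM normfV (gtr0_norm gt0) ler_pdivrMr// normrN normrM (ger0_norm (ler0n _ 2)).
  rewrite ler_wpM2l//.
  have SP : r * cabs (cder f (x t)) <= g t.
    rewrite gE; apply: schwarz_pick => //; first exact: holS (Dx _ t01) hf.
    by move=> y /(Dx _ t01); exact: f1.
  have CS : `|u t * u1 t + v t * v1 t| <= cabs (f (x t)) * cabs (cder f (x t) * e).
    have -> : u t * u1 t + v t * v1 t = complex.Re (conjc (f (x t)) * (cder f (x t) * e)).
      by rewrite cReM cRe_conj cIm_conj mulNr opprK.
    by rewrite (le_trans (Re_le_cabs _))// cabsM cabs_conj.
  apply: (le_trans CS); apply: le_trans SP.
  rewrite cabsM; have := f1 _ (Ux _ t01) => ft.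
  have c0 := cabs_ge0 (cder f (x t)).
  rewrite mulrC mulrAC; apply: (@le_trans _ _ (cabs (cder f (x t)) * r)); last by rewrite mulrC.
  rewrite -mulrA ler_wpM2l// -[leRHS]mul1r ler_pM ?cabs_ge0// ltW//.
have c01 (t : R) : t \in `]0, 1[ -> 0 <= t <= 1.
  by rewrite in_itv /= => /andP[? ?]; rewrite !ltW.
have Cl : {within `[0, 1], continuous (fun s => ln (g s))}.
  apply: derivable_within_continuous => t; rewrite in_itv /= => /Dl ?.
  exact: ex_derive.
have [t tI E] := MVT ltr01 (fun t h => Dl t (c01 t h)) Cl.
have := Bd _ (c01 _ tI); move: E; rewrite subr0 mulr1 => <-; rewrite ler_norml => /andP[h1 h2].
have x0 : x 0 = z by rewrite /x mul0r addr0.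
have x1 : x 1 = w by rewrite /x mul1r /e addrC subrK.
have z01 : 0 <= (0 : R) <= 1 by rewrite lexx ler01.
have o01 : 0 <= (1 : R) <= 1 by rewrite lexx ler01.
have G0 := g0 _ z01; have G1 := g0 _ o01.
have N0 : 0 < 1 - cabs (f z) ^+ 2 by rewrite -x0 -gE.
have N1 : 0 < 1 - cabs (f w) ^+ 2 by rewrite -x1 -gE.
rewrite !gE x0 x1 in h1 h2.
have comp (a b : R) : 0 < a -> 0 < b -> ln a - 2 <= ln b -> a * expR (- 2) <= b.
  by move=> a0 b0 ab; rewrite -[leRHS]lnK ?posrE// -[X in X * _]lnK ?posrE// -expRD ler_expR.
by split; apply: comp => //; lra.
Qed.

End Extremal.

(** * The conformal metric and the distance to the boundary *)

Section ConformalMetric.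
Context {R : realType}.
Implicit Types (z w c e a : R[i]) (Omega K : set (R * R)).

Definition toplane Omega : set R[i] := [set z | Omega (ofC z)].

Lemma copen_toplane Omega : open Omega -> copen (toplane Omega).
Proof.
move=> oO z Oz; have := @cnbhs_ofC R (ofC z) Omega; rewrite ofCK; apply.
by move: oO; rewrite openE; apply.
Qed.

Lemma toplane_toC Omega x : toplane Omega (toC x) = Omega x.
Proof. by rewrite /toplane /= toCK. Qed.

(** The map used later depends on [r], which itself is chosen from this bound; so [c] must not
    depend on [f]. The common normalization [f z0 = 0] gives such a bound at [z0], and
    [log_lipschitz] spreads it. *)
Lemma admissible_bound Omega K z0 : open Omega -> connected Omega ->
  toplane Omega z0 -> compact K -> K `<=` Omega ->
  exists2 c : R, 0 < c & forall f F x, admissible (toplane Omega) z0 f F -> K x ->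
    c <= 1 - cabs (f (toC x)) ^+ 2.
Proof.
move=> oO cO Oz0 cK KO; set U := toplane Omega; have oU : copen U by exact: copen_toplane.
pose bounded_by (c : R) x := forall f F, admissible U z0 f F -> c <= 1 - cabs (f (toC x)) ^+ 2.
pose S := [set x | Omega x /\ exists2 c : R, 0 < c & bounded_by c x].
have ballU x : Omega x -> exists2 d : R, 0 < d & disc (toC x) (3 * d) `<=` U.
  rewrite -toplane_toC => /oU[d d0 hd]; exists (d / 3); first by rewrite divr_gt0.
  by rewrite mulrC divfK.
have lip x y (d c : R) : 0 < d -> disc (toC x) (2 * d) `<=` U ->
    cabs (toC y - toC x) < d ->
    (bounded_by c x -> bounded_by (c * expR (- 2)) y) /\
    (bounded_by c y -> bounded_by (c * expR (- 2)) x).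
  move=> d0 dU yx; split=> bc f F adm; have [[hf f1 _ _ _] _] := adm.
    have [h _] := log_lipschitz d0 hf f1 dU yx.
    by apply: le_trans h; rewrite ler_wpM2r ?expR_ge0//; exact: bc adm.
  have [_ h] := log_lipschitz d0 hf f1 dU yx.
  by apply: le_trans h; rewrite ler_wpM2r ?expR_ge0//; exact: bc adm.
have e2 : 0 < expR (- 2) :> R by exact: expR_gt0.
have near_toC x (d : R) : 0 < d -> \forall y \near x, cabs (toC y - toC x) < d.
  by move=> d0; exact: ccvg_toC.
have disc2 z (d : R) : 0 < d -> disc z (2 * d) `<=` disc z (3 * d).
  by move=> d0 y; rewrite /disc /= => h; lra.
(* [S] is nonempty, and relatively open and closed in [Omega]: a uniform bound passes between
   neighbouring points in both directions at the cost of a factor [expR (- 2)]. *)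
have SO : S = Omega.
  apply: cO.
  - exists (ofC z0); split=> //; exists 1 => // f F [[_ _ _ _ f0] _].
    by rewrite ofCK f0 cabs0 expr0n subr0.
  - exists S; last by apply/seteqP; split=> [x [Ox ?]|x []].
    rewrite openE => x [Ox [c c0 bc]]; have [d d0 dU] := ballU _ Ox.
    have dU2 := subset_trans (disc2 _ _ d0) dU.
    have d20 : 0 < 2 * d by rewrite mulr_gt0.
    change (nbhs x S); apply: filterS2 (near_toC x d d0) (near_toC x (2 * d) d20) => y yd y2d.
    split; first by rewrite -toplane_toC; apply: dU2.
    by exists (c * expR (- 2)); [exact: mulr_gt0|exact: (lip _ _ _ _ d0 dU2 yd).1].
  - exists (~` (Omega `\` S)); last first.
      apply/seteqP; split=> [x [Ox [c c0 bc]]|x [Ox nS]].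
        by split=> // -[_]; apply; split=> //; exists c.
      by apply: contrapT => nSx; apply: nS.
    apply: open_closedC; rewrite openE => x [Ox nS].
    have [d d0 dU] := ballU _ Ox; have dU2 := subset_trans (disc2 _ _ d0) dU.
    have d20 : 0 < 2 * d by rewrite mulr_gt0.
    change (nbhs x (Omega `\` S)); apply: filterS2 (near_toC x d d0) (near_toC x (2 * d) d20) => y yd y2d.
    split; first by rewrite -toplane_toC; apply: dU2.
    move=> [_ [c c0 bc]]; apply: nS; split=> //.
    by exists (c * expR (- 2)); [exact: mulr_gt0|exact: (lip _ _ _ _ d0 dU2 yd).2].
have /compact_near_coveringP cv := cK.
have H : \forall c \near (0 : R)^'+, K `<=` bounded_by c.
  apply: cv => x /KO Ox; have : S x by rewrite SO.
  move=> [_ [c c0 bc]]; have [d d0 dU] := ballU _ Ox.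
  have dU2 := subset_trans (disc2 _ _ d0) dU.
  exists ([set y | cabs (toC y - toC x) < d], [set r | r < c * expR (- 2)]) => /=.
    by split; [exact: near_toC|apply: nbhs_right_lt; exact: mulr_gt0].
  move=> [y r] /= [yd rc] f F adm.
  by apply: (le_trans (ltW rc)); exact: (lip _ _ _ _ d0 dU2 yd).1 bc _ _ adm.
have [c [hc c0]] : exists c : R, K `<=` bounded_by c /\ 0 < c.
  near (0 : R)^'+ => c; exists c; split; last by [].
  by near: c; exact: H.
by exists c => // f F x adm Kx; exact: hc adm.
Unshelve. all: by end_near. Qed.

Lemma sector_sees Omega w (theta phi : R) : theta <= pi ->
  (forall x, Omega x -> moved (sector theta) w phi (toC x)) ->
  forall z, toplane Omega z -> slit (cis (- phi) * (z - w)).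
Proof.
move=> tp h z Oz; have := h _ Oz; rewrite ofCK /moved /sector /= => -[z0 zt].
by apply: carg_slit => //; exact: lt_le_trans tp.
Qed.

(** Half-plane Schwarz-Pick for the power composed with [F], on the disc of radius [r] because only
    there is [F] known to land in [U]. The size of the power drops out, as [Re p <= |p|] and its
    logarithmic derivative is [al / (x - w)]; finally [|F'| = 1 / |f'|]. *)
Lemma sector_metric Omega z0 (theta phi r : R) (f F : R[i] -> R[i]) (x w : R * R) :
  0 < theta <= pi -> open Omega -> 0 < r < 1 ->
  (forall x, Omega x -> moved (sector theta) (toC w) phi (toC x)) ->
  admissible (toplane Omega) z0 f F ->
  (forall z, cabs z < r -> visible (toplane Omega) f F z) -> Omega x ->
  cabs (f (toC x)) < r ->
  pi / (2 * theta) * (r ^+ 2 - cabs (f (toC x)) ^+ 2) <=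
  2 * r * cabs (cder f (toC x)) * cabs (toC w - toC x).
Proof.
move=> /andP[t0 tp] oO /andP[r0 r1] sec adm vis Ox fr.
set U := toplane Omega in adm vis *.
have oU : copen U by exact: copen_toplane.
have Ux : U (toC x) by rewrite /U toplane_toC.
have [[hf f1 hF FK _] _] := adm.
set al := pi / (2 * theta); have al0 : 0 < al by rewrite divr_gt0 ?pi_gt0// mulr_gt0.
pose e : R[i] := cis (- phi).
have e0 : e != 0 by rewrite -cabs_gt0 cabs_cis.
pose lg z := cLog (e * (z - toC w)).
have sl z : U z -> slit (e * (z - toC w)) by exact: (sector_sees tp sec).
have argb z : U z -> `|complex.Im (lg z)| < theta.
  move=> Uz; rewrite -carg_cLog; last exact: sl.
  by have := sec _ Uz; rewrite ofCK /moved /sector /= => -[].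
have hlin : hol U (fun z => e * (z - toC w)).
  apply: holM => //; first exact: hol_cst.
  by apply: holB => //; [exact: hol_id|exact: hol_cst].
have hlg : hol U lg.
  by apply: (hol_comp (V := slit) (f := fun z => e * (z - toC w)) (g := cLog)) => //; exact: hol_cLog.
pose pw z := cexp (al%:C * lg z).
have hpw : hol U pw.
  apply: (hol_comp (V := setT) (f := fun z => al%:C * lg z) (g := cexp)) => //.
    by apply: holM => //; exact: hol_cst.
  by apply: hol_cexp; exact: copenT.
have pw0 z : U z -> 0 < complex.Re (pw z).
  move=> Uz; have := argb _ Uz; rewrite /pw; move: (lg z) => l lt.
  have : complex.Im (al%:C * l) = al * complex.Im l by rewrite cImM /= mul0r addr0.
  move: (al%:C * l) => v vE.
  rewrite /cexp cReM /= mul0r subr0 mulr_gt0 ?expR_gt0// cos_gt0_pihalf//.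
  rewrite vE -ltr_norml normrM (gtr0_norm al0).
  have -> : pi / 2 = al * theta by rewrite /al; field; rewrite gt_eqF.
  by rewrite ltr_pM2l.
have FU z : disc 0 r z -> U (F z) by rewrite /disc /= subr0 => /vis[].
have oD : copen (disc (0 : R[i]) r) by exact: copen_disc.
have hFr : hol (disc 0 r) F.
  by apply: holS hF => z; rewrite /disc /udisc /= subr0 => /lt_trans; apply.
have hpF : hol (disc 0 r) (pw \o F) by exact: hol_comp hpw.
have br : disc 0 r (f (toC x)) by rewrite /disc /= subr0.
have SP0 : (r ^+ 2 - cabs (f (toC x)) ^+ 2) * cabs (cder pw (toC x) * cder F (f (toC x))) <=
    2 * r * complex.Re (pw (toC x)).
  have := schwarz_pick_hplane r0 hpF (fun z h => pw0 _ (FU z h)) br.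
  by rewrite (cder_comp FU hFr hpw br) [(pw \o F) _]/comp FK.
have Dpw : cder pw (toC x) = pw (toC x) * (al%:C * (toC x - toC w)^-1).
  apply: cder_eq.
  have n0 : toC x - toC w != 0.
    by have := slit_neq0 (sl _ Ux); apply: contraNneq => ->; rewrite mulr0.
  have D1 : sder (fun z => e * (z - toC w)) (toC x) e.
    have := sderMl e (sderB (sder_id (toC x)) (sder_cst (toC w) _)).
    by rewrite subr0 mulr1.
  have D2 := hol_sder (hol_cLog (R := R)) (sl _ Ux).
  rewrite cder_cLog in D2; last exact: sl.
  have D3 := sderMl al%:C (sder_comp D1 D2).
  have := sder_comp D3 (sder_cexp _).
  have -> // : (e * (toC x - toC w))^-1 * e = (toC x - toC w)^-1.
  by rewrite invfM mulrAC mulVf ?mul1r.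
rewrite Dpw in SP0; have p0 : 0 < cabs (pw (toC x)) by rewrite cabs_gt0; exact: cexp_neq0.
move: (pw (toC x)) p0 SP0 => p p0; set k := cabs (toC w - toC x).
have Rp : complex.Re p <= cabs p by rewrite (le_trans (ler_norm _))// Re_le_cabs.
rewrite !cabsM cabsV (cabsB (toC x)) -/k (cabs_realp (ltW al0)).
have Ff : cabs (cder F (f (toC x))) * cabs (cder f (toC x)) = 1.
  by rewrite -cabsM (admissible_cder_neq0 oU adm Ux) cabs1.
have f0 : 0 < cabs (cder f (toC x)).
  rewrite lt_neqAle cabs_ge0 andbT; apply/eqP => h.
  by move: Ff; rewrite -h mulr0 => /esym/eqP; rewrite oner_eq0.
have k0 : 0 < k.
  rewrite /k cabsB cabs_gt0.
  by have := slit_neq0 (sl _ Ux); apply: contraNneq => ->; rewrite mulr0.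
move: Ff f0; set F1 := cabs (cder F _); set g := cabs (cder f _) => Ff f0 SP.
have SP2 : (r ^+ 2 - cabs (f (toC x)) ^+ 2) * (cabs p * (al / k) * F1) <= 2 * r * cabs p.
  by apply: (le_trans SP); rewrite ler_pM2l// mulr_gt0.
rewrite -(ler_pM2r (divr_gt0 p0 (mulr_gt0 f0 k0))).
have F1E : F1 = g^-1 by apply: (mulIf (lt0r_neq0 f0)); rewrite Ff mulVf ?gt_eqF.
have -> : al * (r ^+ 2 - cabs (f (toC x)) ^+ 2) * (cabs p / (g * k)) =
   (r ^+ 2 - cabs (f (toC x)) ^+ 2) * (cabs p * (al / k) * F1).
  by rewrite F1E; field; rewrite !gt_eqF.
have -> // : 2 * r * g * k * (cabs p / (g * k)) = 2 * r * cabs p.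
by field; rewrite !gt_eqF.
Qed.

(** [f] may depend on [eta] and [K]: [K] will be the support of [u], and [eta] tends to 0 only after
    integration. *)
Theorem conformal_metric Omega (theta eta : R) K : is_domain Omega -> Omega <> setT ->
  0 < theta <= pi ->
  (forall w : R * R, (~` Omega) w -> exists2 phi : R, - pi < phi <= pi &
     forall x, Omega x -> moved (sector theta) (toC w) phi (toC x)) ->
  compact K -> K `<=` Omega -> 0 < eta < 1 ->
  exists f, [/\ hol (toplane Omega) f, forall z, toplane Omega z -> cabs (f z) < 1 &
    forall x w : R * R, K x -> ~ Omega w ->
      (1 - eta) * (pi / (4 * theta)) * (1 - cabs (f (toC x)) ^+ 2) <=
      cabs (cder f (toC x)) * cabs (toC w - toC x)].
Proof.
move=> [[x0 Ox0] oO cO] OT /andP[t0 tp] sec cK KO /andP[eta0 eta1].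
have oU := copen_toplane oO; set U := toplane Omega in oU *.
have Uz0 : U (toC x0) by rewrite /U toplane_toC.
have Us w : ~ U w -> sees U w.
  move=> nw; have [phi _ h] := sec _ nw.
  exists (cis (- phi)); first exact: cabs_cis.
  by rewrite ofCK in h; exact: sector_sees tp h.
have [w0 nw0] : exists w, ~ U w.
  have [w nw] : exists w : R * R, ~ Omega w by apply/existsNP => h; apply: OT; apply/seteqP; split.
  by exists (toC w); rewrite /U toplane_toC.
have [c c0 hc] := admissible_bound oO cO Uz0 cK KO.
pose c1 := Num.min c (1 / 2).
have c10 : 0 < c1 by rewrite lt_min c0 divr_gt0.
have c1c : c1 <= c by rewrite ge_min lexx.
have c12 : c1 <= 1 / 2 by rewrite ge_min lexx orbT.
have ec : 0 < eta * c1 by rewrite mulr_gt0.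
have ec1 : eta * c1 < 1.
  by rewrite (@le_lt_trans _ _ c1)//; [rewrite ler_piMl// ltW|lra].
(* With [m = |f x|^2], the loss [1 - r^2 = eta c1] is at most [eta (1 - m)], so
   [r^2 - m >= (1 - eta) (1 - m)]. The cap 1/2 on [c1] keeps the radicand positive. *)
pose r := Num.sqrt (1 - eta * c1).
have r2 : r ^+ 2 = 1 - eta * c1 by rewrite sqr_sqrtr// subr_ge0 ltW.
have r0 : 0 < r by rewrite sqrtr_gt0 subr_gt0.
have r1 : r < 1 by rewrite -(@expr_lt1 _ 2) ?(ltW r0)// r2; lra.
have r01 : 0 < r < 1 by rewrite r0.
have [f [F [adm vis]]] := extremal_map oU Uz0 Us (ex_intro _ w0 nw0) r01.
have [[hf f1 hF FK _] _] := adm.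
exists f; split=> // x w Kx nw.
have Ox := KO _ Kx; have [phi _ sw] := sec _ nw.
have cx : c1 <= 1 - cabs (f (toC x)) ^+ 2 by apply: (le_trans c1c); exact: hc adm Kx.
have ex : eta * c1 <= eta * (1 - cabs (f (toC x)) ^+ 2) by rewrite ler_pM2l.
have fr2 : cabs (f (toC x)) ^+ 2 < r ^+ 2.
  have : eta * c1 < c1 by rewrite gtr_pMl.
  by rewrite r2; lra.
have fr : cabs (f (toC x)) < r by rewrite -(@ltr_pXn2r _ 2) ?nnegrE ?cabs_ge0// ltW.
have t0p : 0 < theta <= pi by rewrite t0.
have := sector_metric t0p oO r01 sw adm vis Ox fr.
set m := cabs (f (toC x)) ^+ 2 in ex fr2 *.
set g := cabs (cder f (toC x)); set k := cabs (toC w - toC x) => H.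
have al0 : 0 < pi / (2 * theta) by rewrite divr_gt0 ?pi_gt0// mulr_gt0.
have gk : 0 <= g * k by rewrite mulr_ge0 ?cabs_ge0.
have H2 : pi / (2 * theta) * (r ^+ 2 - m) <= 2 * (g * k).
  apply: (le_trans H); rewrite -!mulrA ler_wpM2l// ler_piMl// ltW//.
have H3 : pi / (2 * theta) * ((1 - eta) * (1 - m)) <= pi / (2 * theta) * (r ^+ 2 - m).
  by rewrite ler_pM2l// r2 mulrBl mul1r; lra.
have -> : (1 - eta) * (pi / (4 * theta)) * (1 - m) =
    (pi / (2 * theta) * ((1 - eta) * (1 - m))) / 2 by field; rewrite gt_eqF.
by rewrite ler_pdivrMr// [leRHS]mulrC (le_trans H3).
Qed.

End ConformalMetric.

(** * Integration over the plane *)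

Section PlaneMeasure.
Context {R : realType}.
Implicit Types (x : R * R) (U K Omega : set (R * R)) (g h : R * R -> R).

(** The measurable structure is the product one, so open sets have to be exhausted by countably many
    boxes, here with rational centres and half-widths. *)
Lemma open_measurable_plane U : open U -> measurable U.
Proof.
move=> oU.
pose box (p : rat * (rat * rat)) : set (R * R) :=
  `]ratr p.1 - ratr p.2.2, ratr p.1 + ratr p.2.2[ `*`
  `]ratr p.2.1 - ratr p.2.2, ratr p.2.1 + ratr p.2.2[.
have -> : U = \bigcup_p (if `[< box p `<=` U >] then box p else set0).
  apply/seteqP; split=> [x Ux|x [p _]]; last first.
    by case: ifPn => // /asboolP; apply.
  have : nbhs x U by move: oU; rewrite openE; apply.
  move=> /nbhs_ballP[e /= e0 eU].
  have e20 : 0 < e / 2 by rewrite divr_gt0.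
  have [r] := rat_in_itvoo e20; rewrite in_itv /= => /andP[r0 re].
  have [q1] := @rat_in_itvoo R (x.1 - ratr r) (x.1 + ratr r) ltac:(lra).
  have [q2] := @rat_in_itvoo R (x.2 - ratr r) (x.2 + ratr r) ltac:(lra).
  rewrite !in_itv /= => /andP[b1 b2] /andP[a1 a2].
  exists (q1, (q2, r)) => //; rewrite ifT.
    by split; rewrite /= in_itv /=; apply/andP; split; lra.
  apply/asboolP => y [/=]; rewrite !in_itv /= => /andP[c1 c2] /andP[d1 d2].
  by apply: eU; split; rewrite /ball /= ltr_norml; apply/andP; split; lra.
apply: countable_bigcupT_measurable; first exact: countableP.
by move=> p; case: ifPn => // _; apply: measurableX; exact: measurable_itv.
Qed.

Lemma continuous_measurable_plane g : continuous g -> measurable_fun setT g.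
Proof.
move=> gc.
apply: (measurability _ (measurable_realfun.RGenOInfty.measurableE R)) => _ [_ [a ->] <-].
rewrite setTI; apply: open_measurable_plane.
by move/continuousP : gc; apply; exact: interval_open.
Qed.

Lemma compact_box K : compact K -> exists2 b : R, 0 < b &
  forall x, K x -> (x.1 \in `](- b), b[) && (x.2 \in `](- b), b[).
Proof.
move=> cK.
have bnd (h : R * R -> R) : continuous h -> exists2 b : R, 0 < b & forall x, K x -> `|h x| < b.
  move=> hc.
  have /compact_bounded : compact (h @` K).
    by apply: continuous_compact => //; exact: continuous_subspaceT.
  move=> /ex_strict_bound_gt0[b b0 hb]; exists b => // x Kx.
  by apply: hb; exists x.
have [b1 b10 h1] := bnd fst (fun x => cvg_fst).
have [b2 b20 h2] := bnd snd (fun x => cvg_snd).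
exists (Num.max b1 b2); first by rewrite lt_max b10.
move=> x Kx; rewrite !in_itv /= -!ltr_norml !lt_max h1// h2// orbT//.
Qed.

Lemma integrable_plane g K : compact K -> continuous g -> (forall x, ~ K x -> g x = 0) ->
  leb2.-integrable setT (EFin \o g).
Proof.
move=> cK gc g0; have [b b0 hb] := compact_box cK.
pose B : set (R * R) := `](- b), b[%classic `*` `](- b), b[%classic.
have mB : measurable B by apply: measurableX; exact: measurable_itv.
have gB : g = g \_ B.
  apply/funext => x; rewrite patchE; case: ifPn => // xB; apply: g0 => /hb /andP[h1 h2].
  by move/negP : xB; apply; rewrite inE.
rewrite gB -restrict_EFin; apply/integrable_restrict => //; rewrite setTI.
apply: measurable_bounded_integrable => //.
- have mI : measurable (`](- b), b[%classic : set R) by exact: measurable_itv.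
  have L : lebesgue_measure (`](- b), b[%classic : set R) = (2 * b)%:E.
    rewrite lebesgue_measure_itv /= lte_fin ifT; last lra.
    by rewrite -EFinB opprK mulr_natl mulr2n.
  have E : ((@lebesgue_measure R \x @lebesgue_measure R) B = (2 * b)%:E * (2 * b)%:E)%E.
    rewrite -[X in (X * _)%E]L -[X in (_ * X)%E]L.
    exact: (product_measure1E (@lebesgue_measure R) (@lebesgue_measure R) mI mI).
  have : ((@lebesgue_measure R \x @lebesgue_measure R) B < +oo)%E; last by [].
  by rewrite [X in (X < _)%E]E -EFinM ltry.
- by apply: measurable_funTS; exact: continuous_measurable_plane.
- have /compact_bounded : compact (g @` K).
    by apply: continuous_compact => //; exact: continuous_subspaceT.
  move=> /ex_strict_bound_gt0[M M0 hM]; exists M; split; first exact: num_real.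
  move=> N MN x _ /=; apply: (@le_trans _ _ M); last exact: ltW.
  have [Kx|nK] := pselect (K x); first by rewrite ltW// hM//; exists x.
  by rewrite g0// normr0 ltW.
Qed.

Lemma integral_derive_eq0 (G dG : R -> R) (b : R) : 0 < b ->
  (forall t : R, is_derive t 1 G (dG t)) -> continuous dG ->
  (forall t, b <= `|t| -> G t = 0 /\ dG t = 0) ->
  (\int[lebesgue_measure]_t (dG t)%:E = 0)%E.
Proof.
move=> b0 DG cG G0; have bb : - b < b by lra.
have Gc : continuous G.
  by move=> t; apply: differentiable_continuous; apply/derivable1_diffP; exact: ex_derive.
have E : (\int[lebesgue_measure]_t (dG t)%:E = \int[lebesgue_measure]_(t in `[(- b)%R, b]) (dG t)%:E)%E.
  rewrite [RHS]integral_mkcond; apply: eq_integral => t _; rewrite patchE.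
  case: ifPn => // /negP tb; have [_ -> //] : G t = 0 /\ dG t = 0.
  apply: G0; rewrite leNgt; apply/negP => /ltW; rewrite ler_norml => tb'.
  by apply: tb; rewrite inE /= in_itv.
rewrite E (@continuous_FTC2 _ dG G)//.
- have [-> _] : G b = 0 /\ dG b = 0 by apply: G0; rewrite gtr0_norm.
  have [-> _] : G (- b) = 0 /\ dG (- b) = 0 by apply: G0; rewrite normrN gtr0_norm.
  by rewrite subee.
- exact: continuous_subspaceT.
- split.
  + by move=> t _; exact: ex_derive.
  + by apply: cvg_at_right_filter; exact: Gc.
  + by apply: cvg_at_left_filter; exact: Gc.
- by move=> t _; rewrite derive1E; exact: derive_val.
Qed.

(** One half of the divergence theorem for a compactly supported field: Fubini reduces it to the
    fundamental theorem of calculus on horizontal lines. *)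
Lemma integral_partial1_eq0 (G dG : R * R -> R) K : compact K -> continuous dG ->
  (forall x : R * R, is_derive x.1 1 (fun t => G (t, x.2)) (dG x)) ->
  (forall x, ~ K x -> G x = 0 /\ dG x = 0) ->
  (\int[leb2]_x (dG x)%:E = 0)%E.
Proof.
move=> cK cd DG G0; have [b b0 hb] := compact_box cK.
have intd : leb2.-integrable setT (EFin \o dG).
  by apply: (integrable_plane cK) => // x /G0[].
rewrite -(integral21_prod_meas1 intd) /fubini_G integral0_eq// => y _.
apply: (@integral_derive_eq0 (fun t => G (t, y)) (fun t => dG (t, y)) b) => //.
- by move=> t; exact: (DG (t, y)).
- move=> t; apply: (@continuous_comp _ _ _ (fun t => (t, y)) dG); last exact: cd.
  have h1 : (fun s : R => s) @ t --> t by exact: cvg_id.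
  have h2 : (fun _ : R => y) @ t --> y by exact: cvg_cst.
  exact: (cvg_pair h1 h2).
- move=> t tb; apply: G0 => /hb /= /andP[+ _].
  by rewrite in_itv /= -ltr_norml ltNge tb.
Qed.

Lemma integral_partial2_eq0 (G dG : R * R -> R) K : compact K -> continuous dG ->
  (forall x : R * R, is_derive x.2 1 (fun t => G (x.1, t)) (dG x)) ->
  (forall x, ~ K x -> G x = 0 /\ dG x = 0) ->
  (\int[leb2]_x (dG x)%:E = 0)%E.
Proof.
move=> cK cd DG G0; have [b b0 hb] := compact_box cK.
have intd : leb2.-integrable setT (EFin \o dG).
  by apply: (integrable_plane cK) => // x /G0[].
rewrite -(integral12_prod_meas1 intd) /fubini_F integral0_eq// => y _.
apply: (@integral_derive_eq0 (fun t => G (y, t)) (fun t => dG (y, t)) b) => //.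
- by move=> t; exact: (DG (y, t)).
- move=> t; apply: (@continuous_comp _ _ _ (fun t => (y, t)) dG); last exact: cd.
  have h1 : (fun s : R => s) @ t --> t by exact: cvg_id.
  have h2 : (fun _ : R => y) @ t --> y by exact: cvg_cst.
  exact: (cvg_pair h2 h1).
- move=> t tb; apply: G0 => /hb /= /andP[_].
  by rewrite in_itv /= -ltr_norml ltNge tb.
Qed.

End PlaneMeasure.

(** * Weighted inequality from a vector field *)

Section Weight.
Context {R : realType}.
Implicit Types (x : R * R) (K Omega : set (R * R)) (g h : R * R -> R) (u : R * R -> R[i]).

Lemma compact_nbhs_compl K x : compact K -> ~ K x -> \forall y \near x, ~ K y.
Proof.
move=> cK nK; have hR : hausdorff_space (R * R)%type by exact: norm_hausdorff.
have /closed_openC := compact_closed hR cK.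
by rewrite openE => /(_ x nK).
Qed.

(* A constant rather than [{for x, continuous g}], so that the rules below unify syntactically. *)
Definition cont_at g x : Prop := {for x, continuous g}.

Lemma cont_atX g x n : cont_at g x -> cont_at (fun y => g y ^+ n) x.
Proof.
move=> gc; apply: (@continuous_comp _ _ _ g (fun t : R => t ^+ n)) => //.
exact: exprn_continuous.
Qed.

Lemma cont_atD g h x : cont_at g x -> cont_at h x -> cont_at (fun y => g y + h y) x.
Proof. by move=> gc hc; exact: (continuousD gc hc). Qed.

Lemma cont_atM g h x : cont_at g x -> cont_at h x -> cont_at (fun y => g y * h y) x.
Proof. by move=> gc hc; exact: (continuousM gc hc). Qed.

Lemma cont_atN g x : cont_at g x -> cont_at (fun y => - g y) x.
Proof. by move=> gc; exact: (continuousN gc). Qed.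

Lemma cont_at_cst (c : R) x : cont_at (fun=> c) x.
Proof. exact: cst_continuous. Qed.
Arguments cont_at_cst : clear implicits.

Lemma cont_atV g x : g x != 0 -> cont_at g x -> cont_at (fun y => (g y)^-1) x.
Proof. by move=> g0 gc; exact: (continuousV g0 gc). Qed.

(** Values off [Omega] are arbitrary, hence the cut-off by 0. It creates no jump: a point off
    [Omega] has a neighbourhood missing the closed set [K]. *)
Lemma restrict_continuous Omega K g : open Omega -> compact K -> K `<=` Omega ->
  (forall x, Omega x -> cont_at g x) ->
  (forall x, Omega x -> ~ K x -> g x = 0) -> continuous (g \_ Omega).
Proof.
move=> oO cK KO gc g0 x.
have [Ox|nO] := pselect (Omega x).
  have nO : \forall y \near x, Omega y by move: oO; rewrite openE; apply.
  have E : {near x, g =1 g \_ Omega}.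
    by apply: filterS nO => y Oy; rewrite patchE mem_set.
  rewrite /continuous_at patchE mem_set//.
  by apply: cvg_trans (near_eq_cvg E) _; exact: gc.
have nK : ~ K x by move=> /KO.
have E : {near x, (fun=> 0) =1 g \_ Omega}.
  apply: filterS (compact_nbhs_compl cK nK) => y nKy; rewrite patchE.
  by case: ifPn => // /set_mem Oy; rewrite g0.
rewrite /continuous_at patchE memNset//.
by apply: cvg_trans (near_eq_cvg E) _; exact: cvg_cst.
Qed.

Lemma is_derive_partial1 g x : derivable g x (1, 0) ->
  is_derive x.1 1 (fun t => g (t, x.2)) ('D_(1, 0) g x).
Proof.
move=> dg.
have E : (fun h : R => h^-1 *: (((fun t => g (t, x.2)) \o shift x.1) (h *: (1 : R)) - g (x.1, x.2))) =
         (fun h : R => h^-1 *: ((g \o shift x) (h *: (1, 0)) - g x)).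
  apply/funext => h; congr (_ *: (_ - _)); last by case: (x).
  by rewrite /=; congr g; case: (x) => a b; congr pair; rewrite /= scaler0 add0r.
split; first by rewrite /derivable E.
by rewrite /derive E.
Qed.

Lemma is_derive_partial2 g x : derivable g x (0, 1) ->
  is_derive x.2 1 (fun t => g (x.1, t)) ('D_(0, 1) g x).
Proof.
move=> dg.
have E : (fun h : R => h^-1 *: (((fun t => g (x.1, t)) \o shift x.2) (h *: (1 : R)) - g (x.1, x.2))) =
         (fun h : R => h^-1 *: ((g \o shift x) (h *: (0, 1)) - g x)).
  apply/funext => h; congr (_ *: (_ - _)); last by case: (x).
  by rewrite /=; congr g; case: (x) => a b; congr pair; rewrite /= scaler0 add0r.
split; first by rewrite /derivable E.
by rewrite /derive E.
Qed.

Lemma derive_near0 g x v : (\forall y \near x, g y = 0) -> 'D_v g x = 0.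
Proof.
move=> g0; rewrite (@near_eq_derive _ _ _ g (cst 0) x v)//.
exact: derive_cst.
Qed.

Lemma near_slice1 (P : set (R * R)) x : (\forall y \near x, P y) ->
  \forall t \near x.1, P (t, x.2).
Proof.
move=> hP; have h1 : (fun s : R => s) @ x.1 --> x.1 by exact: cvg_id.
have h2 : (fun _ : R => x.2) @ x.1 --> x.2 by exact: cvg_cst.
by have := cvg_pair h1 h2; rewrite /cvg_to /=; apply; case: (x) hP.
Qed.

Lemma near_slice2 (P : set (R * R)) x : (\forall y \near x, P y) ->
  \forall t \near x.2, P (x.1, t).
Proof.
move=> hP; have h1 : (fun s : R => s) @ x.2 --> x.2 by exact: cvg_id.
have h2 : (fun _ : R => x.1) @ x.2 --> x.1 by exact: cvg_cst.
by have := cvg_pair h2 h1; rewrite /cvg_to /=; apply; case: (x) hP.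
Qed.

Lemma supp_in_out Omega u x : Omega x -> ~ supp_in Omega u x -> u x = 0.
Proof.
move=> Ox nS; apply/eqP; apply: contrapT => /negP ux; apply: nS.
by apply: subset_closure; split.
Qed.

Section Hardy.
Variables (Omega : set (R * R)) (u : R * R -> R[i]) (Y1 Y2 d1 d2 : R * R -> R).
Hypothesis oO : open Omega.
Hypothesis hu : C1_0 Omega u.
Hypothesis Y1c : forall x, Omega x -> cont_at Y1 x.
Hypothesis Y2c : forall x, Omega x -> cont_at Y2 x.
Hypothesis d1c : forall x, Omega x -> cont_at d1 x.
Hypothesis d2c : forall x, Omega x -> cont_at d2 x.
Hypothesis DY1 : forall x, Omega x -> is_derive x.1 1 (fun t => Y1 (t, x.2)) (d1 x).
Hypothesis DY2 : forall x, Omega x -> is_derive x.2 1 (fun t => Y2 (x.1, t)) (d2 x).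

Let K := supp_in Omega u.
Let cK : compact K. Proof. by case: hu. Qed.
Let KO : K `<=` Omega. Proof. by case: hu. Qed.

Let p := re u.
Let q := im u.

Let u0 x : Omega x -> ~ K x -> p x = 0 /\ q x = 0.
Proof. by move=> Ox nK; rewrite /p /q /re /im (supp_in_out Ox nK). Qed.

Let p0_near x : Omega x -> ~ K x -> \forall y \near x, p y = 0.
Proof.
move=> Ox nK; have nO : \forall y \near x, Omega y by move: oO; rewrite openE; apply.
by apply: filterS2 nO (compact_nbhs_compl cK nK) => y Oy /(u0 Oy)[].
Qed.

Let q0_near x : Omega x -> ~ K x -> \forall y \near x, q y = 0.
Proof.
move=> Ox nK; have nO : \forall y \near x, Omega y by move: oO; rewrite openE; apply.
by apply: filterS2 nO (compact_nbhs_compl cK nK) => y Oy /(u0 Oy)[].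
Qed.

Let pC x : Omega x -> [/\ differentiable p x, {for x, continuous (fun y => 'D_(1, 0) p y)} &
  {for x, continuous (fun y => 'D_(0, 1) p y)}].
Proof. by case: hu => h _ _ _; exact: h. Qed.

Let qC x : Omega x -> [/\ differentiable q x, {for x, continuous (fun y => 'D_(1, 0) q y)} &
  {for x, continuous (fun y => 'D_(0, 1) q y)}].
Proof. by case: hu => _ h _ _; exact: h. Qed.

Let p1 x : R := 'D_(1, 0) p x.
Let p2 x : R := 'D_(0, 1) p x.
Let q1 x : R := 'D_(1, 0) q x.
Let q2 x : R := 'D_(0, 1) q x.

Let conts x : Omega x -> [/\ cont_at p x, cont_at q x,
  cont_at p1 x & cont_at p2 x] /\
  cont_at q1 x /\ cont_at q2 x.
Proof.
move=> Ox; have [dp p1c p2c] := pC Ox; have [dq q1c q2c] := qC Ox.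
split; last by split; [exact: q1c|exact: q2c].
by split; [exact: differentiable_continuous dp|exact: differentiable_continuous dq|exact: p1c|exact: p2c].
Qed.

Let n2 x : R := p x ^+ 2 + q x ^+ 2.
Let A x : R := p1 x ^+ 2 + q1 x ^+ 2 + (p2 x ^+ 2 + q2 x ^+ 2).
Let W x : R := - (d1 x + d2 x) - (Y1 x ^+ 2 + Y2 x ^+ 2).
(** [g1] and [g2] are the two terms of the divergence of [|u|^2 Y], whose integrals vanish. *)
Let g1 x : R := 2 * (p x * p1 x + q x * q1 x) * Y1 x + n2 x * d1 x.
Let g2 x : R := 2 * (p x * p2 x + q x * q2 x) * Y2 x + n2 x * d2 x.

Let n2c x : Omega x -> cont_at n2 x.
Proof. by move=> /conts[[h1 h2 _ _] _]; exact: (cont_atD (cont_atX h1) (cont_atX h2)). Qed.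

Let cA : continuous (A \_ Omega).
Proof.
apply: (restrict_continuous oO cK KO) => x Ox.
  have [[h1 h2 h3 h4] [h5 h6]] := conts Ox.
  exact: (cont_atD (cont_atD (cont_atX h3) (cont_atX h5)) (cont_atD (cont_atX h4) (cont_atX h6))).
move=> nK; rewrite /A /p1 /p2 /q1 /q2 !derive_near0 ?expr0n ?addr0//;
  by [exact: p0_near|exact: q0_near].
Qed.

Let cg1 : continuous (g1 \_ Omega).
Proof.
apply: (restrict_continuous oO cK KO) => x Ox.
  have [[h1 h2 h3 h4] [h5 h6]] := conts Ox.
  have hs := cont_atM (cont_at_cst 2 x) (cont_atD (cont_atM h1 h3) (cont_atM h2 h5)).
  exact: (cont_atD (cont_atM hs (Y1c Ox)) (cont_atM (n2c Ox) (d1c Ox))).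
move=> nK; have [pE qE] := u0 Ox nK.
by rewrite /g1 /n2 pE qE expr0n !mul0r !addr0 mulr0 !mul0r addr0.
Qed.

Let cg2 : continuous (g2 \_ Omega).
Proof.
apply: (restrict_continuous oO cK KO) => x Ox.
  have [[h1 h2 h3 h4] [h5 h6]] := conts Ox.
  have hs := cont_atM (cont_at_cst 2 x) (cont_atD (cont_atM h1 h4) (cont_atM h2 h6)).
  exact: (cont_atD (cont_atM hs (Y2c Ox)) (cont_atM (n2c Ox) (d2c Ox))).
move=> nK; have [pE qE] := u0 Ox nK.
by rewrite /g2 /n2 pE qE expr0n !mul0r !addr0 mulr0 !mul0r addr0.
Qed.

Let out (g : R * R -> R) : (forall x, Omega x -> ~ K x -> g x = 0) ->
  forall x, ~ K x -> (g \_ Omega) x = 0.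
Proof. by move=> g0 x nK; rewrite patchE; case: ifPn => // /set_mem Ox; exact: g0. Qed.

Let A0 x : Omega x -> ~ K x -> A x = 0.
Proof.
move=> Ox nK; rewrite /A /p1 /p2 /q1 /q2 !derive_near0 ?expr0n ?addr0//;
  by [exact: p0_near|exact: q0_near].
Qed.

Let n20 x : Omega x -> ~ K x -> n2 x = 0.
Proof. by move=> Ox nK; have [pE qE] := u0 Ox nK; rewrite /n2 pE qE expr0n addr0. Qed.

Let g10 x : Omega x -> ~ K x -> g1 x = 0.
Proof. by move=> Ox nK; have [pE qE] := u0 Ox nK; rewrite /g1 n20// pE qE !mul0r !addr0 mulr0 mul0r. Qed.

Let g20 x : Omega x -> ~ K x -> g2 x = 0.
Proof. by move=> Ox nK; have [pE qE] := u0 Ox nK; rewrite /g2 n20// pE qE !mul0r !addr0 mulr0 mul0r. Qed.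

Let near_restrict (g : R * R -> R) x : Omega x -> \forall y \near x, g y = (g \_ Omega) y.
Proof.
move=> Ox; have nO : \forall y \near x, Omega y by move: oO; rewrite openE; apply.
by apply: filterS nO => y Oy; rewrite patchE mem_set.
Qed.

Let near_restrict0 (g : R * R -> R) x : (forall x, Omega x -> ~ K x -> g x = 0) ->
  ~ Omega x -> \forall y \near x, 0 = (g \_ Omega) y.
Proof.
move=> g0 nO; have nK : ~ K x by move=> /KO.
by apply: filterS (compact_nbhs_compl cK nK) => y nKy; rewrite out.
Qed.

Let Ig1 : (\int[leb2]_x ((g1 \_ Omega) x)%:E = 0)%E.
Proof.
apply: (@integral_partial1_eq0 R ((fun x => n2 x * Y1 x) \_ Omega) (g1 \_ Omega) K) => //.
- move=> x; have [Ox|nO] := pselect (Omega x).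
    apply: (near_eq_is_derive (near_slice1 (near_restrict (fun x => n2 x * Y1 x) Ox))).
    rewrite patchE mem_set//; have [dp _ _] := pC Ox; have [dq _ _] := qC Ox.
    have Dp : is_derive x.1 1 (fun t => p (t, x.2)) (p1 x).
      by apply: is_derive_partial1; exact: diff_derivable.
    have Dq : is_derive x.1 1 (fun t => q (t, x.2)) (q1 x).
      by apply: is_derive_partial1; exact: diff_derivable.
    have D1 := DY1 Ox; rewrite /n2.
    by apply: is_derive_eq; rewrite /g1 /n2 /GRing.scale /=; case: (x) => a b /=; ring.
  rewrite patchE memNset//.
  have n0 : \forall y \near x, 0 = ((fun x => n2 x * Y1 x) \_ Omega) y.
    by apply: near_restrict0 => // y Oy nK; rewrite n20// mul0r.
  by apply: (near_eq_is_derive (near_slice1 n0)); exact: is_derive_cst.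
- move=> x nK; split; apply: out => // y Oy nKy; first by rewrite n20// mul0r.
Qed.

Let Ig2 : (\int[leb2]_x ((g2 \_ Omega) x)%:E = 0)%E.
Proof.
apply: (@integral_partial2_eq0 R ((fun x => n2 x * Y2 x) \_ Omega) (g2 \_ Omega) K) => //.
- move=> x; have [Ox|nO] := pselect (Omega x).
    apply: (near_eq_is_derive (near_slice2 (near_restrict (fun x => n2 x * Y2 x) Ox))).
    rewrite patchE mem_set//; have [dp _ _] := pC Ox; have [dq _ _] := qC Ox.
    have Dp : is_derive x.2 1 (fun t => p (x.1, t)) (p2 x).
      by apply: is_derive_partial2; exact: diff_derivable.
    have Dq : is_derive x.2 1 (fun t => q (x.1, t)) (q2 x).
      by apply: is_derive_partial2; exact: diff_derivable.
    have D2 := DY2 Ox; rewrite /n2.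
    by apply: is_derive_eq; rewrite /g2 /n2 /GRing.scale /=; case: (x) => a b /=; ring.
  rewrite patchE memNset//.
  have n0 : \forall y \near x, 0 = ((fun x => n2 x * Y2 x) \_ Omega) y.
    by apply: near_restrict0 => // y Oy nK; rewrite n20// mul0r.
  by apply: (near_eq_is_derive (near_slice2 n0)); exact: is_derive_cst.
- move=> x nK; split; apply: out => // y Oy nKy; first by rewrite n20// mul0r.
Qed.

Let grad_sqE x : grad_sq u x = A x.
Proof. by rewrite /grad_sq /cpartial !cabs_sq. Qed.

Let cabs_sqE x : cabs (u x) ^+ 2 = n2 x.
Proof. by rewrite cabs_sq. Qed.

(* Completing the square: [|grad u - u Y|^2 >= 0]. *)
Lemma hardy_field (V : R * R -> R) :
  (forall x, K x -> V x <= - (d1 x + d2 x) - (Y1 x ^+ 2 + Y2 x ^+ 2)) ->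
  leb2.-integrable setT (EFin \o ((fun x => V x * cabs (u x) ^+ 2) \_ Omega)) ->
  ((\int[leb2]_(x in Omega) (V x * cabs (u x) ^+ 2)%:E) <=
  \int[leb2]_(x in Omega) (grad_sq u x)%:E)%E.
Proof.
set B := (X in X \_ Omega) => VW iB.
have iA := integrable_plane cK cA (out A0).
have i1 := integrable_plane cK cg1 (out g10).
have i2 := integrable_plane cK cg2 (out g20).
rewrite integral_mkcond [leRHS]integral_mkcond.
rewrite [X in (_ <= X)%E](_ : _ = \int[leb2]_x (EFin \o (A \_ Omega)) x)%E; last first.
  by apply: eq_integral => x _; rewrite -restrict_EFin !patchE; case: ifP => //; rewrite /= grad_sqE.
rewrite [X in (X <= _)%E](_ : _ = \int[leb2]_x (EFin \o (B \_ Omega)) x)%E; last first.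
  by apply: eq_integral => x _; rewrite -restrict_EFin.
(* Adding the divergence of [|u|^2 Y] does not change the integral and reduces the claim to a
   pointwise inequality. *)
have -> : (\int[leb2]_x (EFin \o (B \_ Omega)) x =
    \int[leb2]_x ((EFin \o (B \_ Omega)) x +
     ((EFin \o (g1 \_ Omega)) x + (EFin \o (g2 \_ Omega)) x)))%E.
  rewrite integralD//; last exact: integrableD.
  by rewrite integralD// Ig1 Ig2 adde0 adde0.
apply: le_integral => //; first by apply: integrableD => //; exact: integrableD.
move=> x _; rewrite /= -!EFinD lee_fin !patchE; case: ifPn => [/set_mem Ox|_]; last by rewrite !addr0.
have BW : B x <= W x * n2 x.
  rewrite /B cabs_sqE; have [Kx|nK] := pselect (K x); last by rewrite n20// !mulr0.
  by rewrite ler_wpM2r ?VW// -cabs_sqE sqr_ge0.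
apply: (le_trans (lerD BW (lexx _))).
rewrite -subr_ge0 /A /W /g1 /g2 /n2.
set y1 := Y1 x; set y2 := Y2 x; set a := p x; set b := q x.
set a1 := p1 x; set a2 := p2 x; set b1 := q1 x; set b2 := q2 x.
have -> : forall e1 e2 : R, a1 ^+ 2 + b1 ^+ 2 + (a2 ^+ 2 + b2 ^+ 2) -
  ((- (e1 + e2) - (y1 ^+ 2 + y2 ^+ 2)) * (a ^+ 2 + b ^+ 2) +
   (2 * (a * a1 + b * b1) * y1 + (a ^+ 2 + b ^+ 2) * e1 +
    (2 * (a * a2 + b * b2) * y2 + (a ^+ 2 + b ^+ 2) * e2))) =
  (a1 - a * y1) ^+ 2 + (b1 - b * y1) ^+ 2 + ((a2 - a * y2) ^+ 2 + (b2 - b * y2) ^+ 2).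
  by move=> e1 e2; ring.
by rewrite !addr_ge0 ?sqr_ge0.
Qed.

End Hardy.
End Weight.

(** * The vector field of a holomorphic map into the disc *)

Section Field.
Context {R : realType}.
Implicit Types (x : R * R) (Omega : set (R * R)) (g : R[i] -> R[i]) (l : R[i]).

Lemma is_derive_toC1 g x l : sder g (toC x) l ->
  is_derive x.1 1 (fun t => complex.Re (g (toC (t, x.2)))) (complex.Re l) /\
  is_derive x.1 1 (fun t => complex.Im (g (toC (t, x.2)))) (complex.Im l).
Proof.
have E (t : R) : toC (t, x.2) = (0 +i* x.2) + t%:C * 1.
  by rewrite mulr1; apply/eqP; rewrite eq_complex /= add0r addr0 !eqxx.
have Ex : toC x = (0 +i* x.2) + (x.1)%:C * 1 by rewrite -E; case: (x).
rewrite Ex => /is_derive_line[]; rewrite mulr1 => h1 h2.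
by split; under eq_fun do rewrite E.
Qed.

Lemma is_derive_toC2 g x l : sder g (toC x) l ->
  is_derive x.2 1 (fun t => complex.Re (g (toC (x.1, t)))) (- complex.Im l) /\
  is_derive x.2 1 (fun t => complex.Im (g (toC (x.1, t)))) (complex.Re l).
Proof.
have E (t : R) : toC (x.1, t) = (x.1 +i* 0) + t%:C * 'i.
  by apply/eqP; rewrite eq_complex /= !(mul0r, mulr0, mulr1, subr0, add0r, addr0) !eqxx.
have Ex : toC x = (x.1 +i* 0) + (x.2)%:C * 'i by rewrite -E; case: (x).
rewrite Ex => /is_derive_line[]; rewrite cReM cImM /= !(mulr0, mulr1, sub0r, add0r, addr0) => h1 h2.
by split; under eq_fun do rewrite E.
Qed.

(** Both components of the field have this shape, with [A], [B] the parts of [f]: [(C, D)] is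
    [(Re f', Im f')] for [- Y1] and [(Im f', - Re f')] for [Y2]. *)
Lemma is_derive_dot_quot (A B C D : R -> R) (s da db dc dd : R) :
  is_derive s 1 A da -> is_derive s 1 B db -> is_derive s 1 C dc -> is_derive s 1 D dd ->
  1 + - (A s ^+ 2 + B s ^+ 2) != 0 ->
  is_derive s 1 (fun t => (A t * C t + B t * D t) * (1 + - (A t ^+ 2 + B t ^+ 2))^-1)
    ((da * C s + A s * dc + (db * D s + B s * dd)) * (1 + - (A s ^+ 2 + B s ^+ 2))^-1 +
     2 * ((A s * C s + B s * D s) * (A s * da + B s * db) *
          (1 + - (A s ^+ 2 + B s ^+ 2))^-1 ^+ 2)).
Proof.
move=> DA DB DC DD nz.
have DN : is_derive s 1 (fun t => 1 + - (A t ^+ 2 + B t ^+ 2)) (- 2 * (A s * da + B s * db)).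
  by apply: is_derive_eq; rewrite /GRing.scale /=; ring.
have DV : is_derive s 1 (fun t => (1 + - (A t ^+ 2 + B t ^+ 2))^-1)
    (2 * (A s * da + B s * db) * (1 + - (A s ^+ 2 + B s ^+ 2))^-1 ^+ 2).
  apply: is_derive_eq (@is_deriveV _ (fun t : R => 1 + - (A t ^+ 2 + B t ^+ 2)) s _ 1 nz DN) _.
  by rewrite /GRing.scale /= -exprVn; ring.
have DP : is_derive s 1 (fun t => A t * C t + B t * D t)
    (da * C s + A s * dc + (db * D s + B s * dd)).
  by apply: is_derive_eq; rewrite /GRing.scale /=; ring.
apply: is_derive_eq (is_deriveM DP DV) _.
by rewrite /GRing.scale /=; ring.
Qed.

(* [Y] is half the gradient of [log (1 - |f|^2)], and [d1], [d2] are the two terms of its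
   divergence: [- div Y - |Y|^2 = |f'|^2 (2 - |f|^2) / (1 - |f|^2)^2]. *)
Lemma disc_map_field Omega f : open Omega -> hol (toplane Omega) f ->
  (forall z, toplane Omega z -> cabs (f z) < 1) ->
  exists Y1 Y2 d1 d2 : R * R -> R, [/\
    forall x, Omega x -> [/\ cont_at Y1 x, cont_at Y2 x, cont_at d1 x & cont_at d2 x],
    forall x, Omega x -> is_derive x.1 1 (fun t => Y1 (t, x.2)) (d1 x),
    forall x, Omega x -> is_derive x.2 1 (fun t => Y2 (x.1, t)) (d2 x) &
    forall x, Omega x -> (cabs (cder f (toC x)) / (1 - cabs (f (toC x)) ^+ 2)) ^+ 2 <=
      - (d1 x + d2 x) - (Y1 x ^+ 2 + Y2 x ^+ 2)].
Proof.
move=> oO hf f1.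
pose a x : R := complex.Re (f (toC x)); pose b x : R := complex.Im (f (toC x)).
pose a1 x : R := complex.Re (cder f (toC x)); pose b1 x : R := complex.Im (cder f (toC x)).
pose a2 x : R := complex.Re (cder (cder f) (toC x)).
pose b2 x : R := complex.Im (cder (cder f) (toC x)).
pose N x : R := 1 + - (a x ^+ 2 + b x ^+ 2).
pose P x : R := a x * a1 x + b x * b1 x.
pose Q x : R := a x * b1 x + - (b x * a1 x).
pose S x : R := a1 x ^+ 2 + b1 x ^+ 2.
pose T x : R := a x * a2 x + b x * b2 x.
pose Y1 x : R := - (P x * (N x)^-1).
pose Y2 x : R := Q x * (N x)^-1.
(* [T] carries the second derivative of [f]. It enters [d1] and [d2] with opposite signs, by the
   Cauchy-Riemann equations, and leaves the divergence. *)
pose d1 x : R := - ((S x + T x) * (N x)^-1 + 2 * (P x ^+ 2 * (N x)^-1 ^+ 2)).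
pose d2 x : R := - ((S x + - T x) * (N x)^-1 + 2 * (Q x ^+ 2 * (N x)^-1 ^+ 2)).
have N0 x : Omega x -> 0 < N x.
  rewrite -toplane_toC => /f1 h; rewrite /N subr_gt0 -cabs_sq.
  by rewrite expr_lt1 // cabs_ge0.
have cc g x : ccvg (cnbhs (toC x)) g (g (toC x)) ->
    cont_at (fun y => complex.Re (g (toC y))) x /\ cont_at (fun y => complex.Im (g (toC y))) x.
  move=> h; have H : ccvg (nbhs x) (g \o toC) (g (toC x)) by exact: ccvg_comp (@ccvg_toC _ x) h.
  by split; rewrite /cont_at /continuous_at; [exact: (ccvg_Re H)|exact: (ccvg_Im H)].
exists Y1, Y2, d1, d2; split=> x Ox.
- have Ux : toplane Omega (toC x) by rewrite toplane_toC.
  have [ca cb] := cc f x (hol_ccvg hf Ux).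
  have [ca1 cb1] := cc _ x (sder_ccvg (hol_sder2 hf Ux)).
  have c2 : ccvg (cnbhs (toC x)) (cder (cder f)) (cder (cder f) (toC x)).
    apply: sder_cvg_deriv; apply: filterS (copen_toplane oO Ux) => z Uz.
    exact: hol_sder2 hf Uz.
  have [ca2 cb2] := cc _ x c2.
  have cN : cont_at N x.
    by apply: cont_atD; [exact: cont_at_cst|apply: cont_atN; apply: cont_atD; exact: cont_atX].
  have cV : cont_at (fun y => (N y)^-1) x by apply: cont_atV => //; rewrite gt_eqF// N0.
  have cP : cont_at P x by exact: (cont_atD (cont_atM ca ca1) (cont_atM cb cb1)).
  have cQ : cont_at Q x by exact: (cont_atD (cont_atM ca cb1) (cont_atN (cont_atM cb ca1))).
  have cS : cont_at S x by apply: cont_atD; exact: cont_atX.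
  have cT : cont_at T x by exact: (cont_atD (cont_atM ca ca2) (cont_atM cb cb2)).
  have cd (G H : R * R -> R) : cont_at G x -> cont_at H x ->
      cont_at (fun y => - (G y * (N y)^-1 + 2 * (H y ^+ 2 * (N y)^-1 ^+ 2))) x.
    move=> cG cH; apply: cont_atN; apply: cont_atD; first exact: cont_atM.
    apply: cont_atM; first exact: cont_at_cst.
    by apply: cont_atM; exact: cont_atX.
  split.
  + exact: (cont_atN (cont_atM cP cV)).
  + exact: (cont_atM cQ cV).
  + by apply: cd => //; exact: cont_atD.
  + by apply: cd => //; exact: (cont_atD cS (cont_atN cT)).
- have Ux : toplane Omega (toC x) by rewrite toplane_toC.
  have [Da Db] := is_derive_toC1 (hol_sder hf Ux).
  have [Da1 Db1] := is_derive_toC1 (hol_sder2 hf Ux).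
  have nz : 1 + - (complex.Re (f (toC (x.1, x.2))) ^+ 2 + complex.Im (f (toC (x.1, x.2))) ^+ 2) != 0.
    by move: (N0 _ Ox); rewrite /N /a /b; case: (x) => s t h; rewrite gt_eqF.
  have D := is_deriveN (is_derive_dot_quot Da Db Da1 Db1 nz); apply: is_derive_eq D _.
  by rewrite /d1 /S /T /P /N /a /b /a1 /b1 /a2 /b2; case: (x) => s t /=; ring.
- have Ux : toplane Omega (toC x) by rewrite toplane_toC.
  have [Da Db] := is_derive_toC2 (hol_sder hf Ux).
  have [Da1 Db1] := is_derive_toC2 (hol_sder2 hf Ux).
  have nz : 1 + - (complex.Re (f (toC (x.1, x.2))) ^+ 2 + complex.Im (f (toC (x.1, x.2))) ^+ 2) != 0.
    by move: (N0 _ Ox); rewrite /N /a /b; case: (x) => s t h; rewrite gt_eqF.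
  have DNa1 : is_derive x.2 1 (fun t : R => - complex.Re (cder f (toC (x.1, t))))
      (complex.Im (cder (cder f) (toC x))) by apply: is_derive_eq (is_deriveN Da1) _; rewrite opprK.
  have D := is_derive_dot_quot Da Db Db1 DNa1 nz.
  have -> : (fun t => Y2 (x.1, t)) = (fun t : R => (complex.Re (f (toC (x.1, t))) * complex.Im (cder f (toC (x.1, t))) +
      complex.Im (f (toC (x.1, t))) * - complex.Re (cder f (toC (x.1, t)))) *
      (1 + - (complex.Re (f (toC (x.1, t))) ^+ 2 + complex.Im (f (toC (x.1, t))) ^+ 2))^-1).
    by apply/funext => t; rewrite /Y2 /Q mulrN.
  apply: is_derive_eq D _.
  by rewrite /d2 /S /T /Q /N /a /b /a1 /b1 /a2 /b2; case: (x) => s t /=; ring.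
- have /gt_eqF/negbT nz := N0 _ Ox.
  have fE : 1 - cabs (f (toC x)) ^+ 2 = N x by rewrite cabs_sq.
  have dE : cabs (cder f (toC x)) ^+ 2 = S x by rewrite cabs_sq.
  have nE : a x ^+ 2 + b x ^+ 2 = 1 - N x by rewrite /N; ring.
  have N1 : N x <= 1 by rewrite /N gerDl oppr_le0 addr_ge0 ?sqr_ge0.
  (* [P] and [Q] are, up to sign, the real and imaginary parts of [conj f * f'], so the sum of
     squares is [|f|^2 |f'|^2]. *)
  have PQ : P x ^+ 2 + Q x ^+ 2 = (1 - N x) * S x by rewrite -nE /P /Q /S; ring.
  have -> : - (d1 x + d2 x) - (Y1 x ^+ 2 + Y2 x ^+ 2) =
      2 * S x * (N x)^-1 + (P x ^+ 2 + Q x ^+ 2) * (N x)^-1 ^+ 2.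
    by rewrite /d1 /d2 /Y1 /Y2; ring.
  rewrite PQ expr_div_n fE dE -subr_ge0.
  have -> : 2 * S x * (N x)^-1 + (1 - N x) * S x * (N x)^-1 ^+ 2 - S x / N x ^+ 2 = S x / N x.
    by field.
  by rewrite mulr_ge0 ?invr_ge0 ?(ltW (N0 _ Ox))// /S addr_ge0 ?sqr_ge0.
Qed.

End Field.

(** * The Hardy inequality *)

Section Distance.
Context {R : realType}.
Implicit Types (x y w : R * R) (Omega : set (R * R)).

Let has_dists Omega x : Omega <> setT ->
  has_inf [set cabs (toC y - toC x) | y in ~` Omega].
Proof.
move=> /eqP/setTPn[w nw]; split; first by exists (cabs (toC w - toC x)); exists w.
by exists 0 => _ [y _ <-]; exact: cabs_ge0.
Qed.

Lemma bdist_le Omega x w : Omega <> setT -> ~ Omega w -> bdist Omega x <= cabs (toC w - toC x).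
Proof. by move=> /(has_dists x)[_ h] nw; apply: ge_inf => //; exists w. Qed.

Lemma le_bdist Omega x (c : R) : Omega <> setT ->
  (forall w, ~ Omega w -> c <= cabs (toC w - toC x)) -> c <= bdist Omega x.
Proof.
move=> /(has_dists x)[h _] hc; apply: lb_le_inf => // _ [w nw <-]; exact: hc.
Qed.

Lemma bdist_gt0 Omega x : Omega <> setT -> open Omega -> Omega x -> 0 < bdist Omega x.
Proof.
move=> nT oO; rewrite -toplane_toC => /(copen_toplane oO)[e e0 he].
apply: (lt_le_trans e0); apply: le_bdist => // w nw.
rewrite leNgt; apply/negP => /he; by rewrite toplane_toC.
Qed.

Lemma cont_bdist Omega x : Omega <> setT -> cont_at (bdist Omega) x.
Proof.
move=> nT; have lip y z : bdist Omega y - bdist Omega z <= cabs (toC y - toC z).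
  rewrite lerBlDl -lerBlDr; apply: le_bdist => // w nw; rewrite lerBlDr.
  by apply: (le_trans (bdist_le y nT nw)); rewrite (cabsB (toC y)); exact: cabs_distD.
apply/cvgrPdist_lt => e e0; apply: filterS (@ccvg_toC R x e e0) => y h.
rewrite ltr_norml; have := lip x y; have := lip y x.
rewrite (cabsB (toC x)) => h1 h2; apply/andP; split; lra.
Qed.

End Distance.

Section Main.
Context {R : realType}.
Implicit Types (x w : R * R) (Omega : set (R * R)) (u : R * R -> R[i]).

Lemma cont_at_cabs u Omega x : C1_0 Omega u -> Omega x -> cont_at (fun y => cabs (u y) ^+ 2) x.
Proof.
move=> [hp hq _ _] Ox; have [dp _ _] := hp _ Ox; have [dq _ _] := hq _ Ox.
have cp : cont_at (re u) x by exact: differentiable_continuous dp.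
have cq : cont_at (im u) x by exact: differentiable_continuous dq.
have E : (fun y => cabs (u y) ^+ 2) = (fun y => re u y ^+ 2 + im u y ^+ 2).
  by apply/funext => y; rewrite cabs_sq.
by rewrite E; exact: (cont_atD (cont_atX cp) (cont_atX cq)).
Qed.

Lemma hardy_integrable Omega u : Omega <> setT -> open Omega -> C1_0 Omega u ->
  leb2.-integrable setT (EFin \o ((fun x => cabs (u x) ^+ 2 / bdist Omega x ^+ 2) \_ Omega)).
Proof.
move=> nT oO hu; have [_ _ cK KO] := hu.
have g0 x : Omega x -> ~ supp_in Omega u x -> cabs (u x) ^+ 2 / bdist Omega x ^+ 2 = 0.
  by move=> Ox nK; rewrite (supp_in_out Ox nK) cabs0 expr0n mul0r.
apply: (integrable_plane cK).
  apply: (restrict_continuous oO cK KO) => // x Ox.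
  have cb : cont_at (fun y => (bdist Omega y ^+ 2)^-1) x.
    apply: cont_atV; first by rewrite expf_neq0// gt_eqF// bdist_gt0.
    by apply: cont_atX; exact: cont_bdist.
  exact: (cont_atM (cont_at_cabs hu Ox) cb).
by move=> x nK; rewrite patchE; case: ifPn => // /set_mem Ox; exact: g0.
Qed.

Lemma hardy_approx Omega (theta eta : R) u : is_domain Omega -> Omega <> setT ->
  0 < theta <= pi ->
  (forall w, (~` Omega) w -> exists2 phi : R, - pi < phi <= pi &
     forall x, Omega x -> moved (sector theta) (toC w) phi (toC x)) ->
  C1_0 Omega u -> 0 < eta < 1 ->
  ((((1 - eta) * (pi / (4 * theta))) ^+ 2)%:E *
     \int[leb2]_(x in Omega) (cabs (u x) ^+ 2 / bdist Omega x ^+ 2)%:E <=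
   \int[leb2]_(x in Omega) (grad_sq u x)%:E)%E.
Proof.
move=> dom nT ht sec hu he; have [_ _ cK KO] := hu; have [_ oO _] := dom.
have [f [hf f1 hc]] := conformal_metric dom nT ht sec cK KO he.
have [Y1 [Y2 [d1 [d2 [cts DY1 DY2 hW]]]]] := disc_map_field oO hf f1.
set c := (1 - eta) * _ in hc *.
have c0 : 0 < c.
  move: he ht => /andP[_ e1] /andP[t0 _].
  by rewrite /c mulr_gt0 ?subr_gt0// divr_gt0 ?pi_gt0// mulr_gt0.
have metric x : supp_in Omega u x ->
    c ^+ 2 / bdist Omega x ^+ 2 <= - (d1 x + d2 x) - (Y1 x ^+ 2 + Y2 x ^+ 2).
  move=> Kx; have Ox := KO _ Kx; apply: le_trans (hW _ Ox).
  set N := 1 - _; have N0 : 0 < N.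
    by rewrite subr_gt0 expr_lt1// ?cabs_ge0// f1// toplane_toC.
  have b0 := bdist_gt0 nT oO Ox.
  (* The metric inequality itself excludes a critical point, since its left side is positive for any
     omitted [w]. *)
  have g0 : 0 < cabs (cder f (toC x)).
    move: nT => /eqP/setTPn[w nw]; have := hc x w Kx nw.
    rewrite lt_neqAle cabs_ge0 andbT => h; apply/eqP => E; move: h.
    by rewrite -E mul0r leNgt mulr_gt0.
  rewrite -expr_div_n ler_sqr ?nnegrE ?divr_ge0 ?(ltW c0) ?(ltW b0) ?(ltW g0) ?(ltW N0)//.
  rewrite ler_pdivrMr// mulrAC ler_pdivlMr// -ler_pdivrMl//.
  by apply: le_bdist => // w nw; rewrite ler_pdivrMl//; exact: hc.
have iH := hardy_integrable nT oO hu.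
set h := (X in X \_ Omega) in iH; pose V x := c ^+ 2 / bdist Omega x ^+ 2.
have E x : (((fun x => V x * cabs (u x) ^+ 2) \_ Omega) x)%:E = ((c ^+ 2)%:E * ((h \_ Omega) x)%:E)%E.
  by rewrite -EFinM !patchE; case: ifP => _; rewrite ?mulr0//; congr EFin; rewrite /V /h; ring.
have iV : leb2.-integrable setT (EFin \o ((fun x => V x * cabs (u x) ^+ 2) \_ Omega)).
  have iZ := integrableZl measurableT (c ^+ 2) iH.
  by rewrite (_ : EFin \o _ = (fun x => ((c ^+ 2)%:E * (EFin \o (h \_ Omega)) x)%E))//; apply/funext.
suff -> : ((c ^+ 2)%:E * \int[leb2]_(x in Omega) (cabs (u x) ^+ 2 / bdist Omega x ^+ 2)%:E =
    \int[leb2]_(x in Omega) (V x * cabs (u x) ^+ 2)%:E)%E.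
  by apply: (hardy_field oO hu _ _ _ _ DY1 DY2 metric iV) => x /cts[].
rewrite [in LHS]integral_mkcond [RHS]integral_mkcond.
rewrite [X in (_ * X)%E](_ : _ = \int[leb2]_x (EFin \o (h \_ Omega)) x)%E; last first.
  by apply: eq_integral => x _; rewrite -restrict_EFin.
rewrite -(integralZl measurableT iH); apply: eq_integral => x _.
by have := restrict_EFin (fun x => V x * cabs (u x) ^+ 2) Omega => /(congr1 (fun k => k x)) ->; rewrite /= E.
Qed.

End Main.

Theorem theorem1p2 (R : realType) (Omega : set (R * R))
  (hdom : is_domain Omega) (hne : Omega <> setT)
  (theta : R) (htheta : pi / 2 <= theta <= pi)
  (hsector : forall w : R * R, (~` Omega) w ->
     exists2 phi : R, - pi < phi <= pi &
       forall x, Omega x -> moved (sector theta) (toC w) phi (toC x))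
  (u : R * R -> R[i]) (hu : C1_0 Omega u) :
  ((\int[leb2]_(x in Omega) (grad_sq u x)%:E) >=
   (((pi / (4 * theta)) ^+ 2)%:E *
      \int[leb2]_(x in Omega) ((cabs (u x)) ^+ 2 / (bdist Omega x) ^+ 2)%:E))%E.
Proof.
have ht : 0 < theta <= pi.
  by move: htheta (pi_gt0 R) => /andP[h ->] p0; rewrite andbT (lt_le_trans _ h)// divr_gt0.
have [_ oO _] := hdom; set r := pi / (4 * theta).
have approx (e : R) := hardy_approx hdom hne ht hsector hu (eta := e).
(* Finiteness of the weighted integral allows [eta] to tend to 0 in real arithmetic. *)
have [j jE] : exists j : R,
    (\int[leb2]_(x in Omega) ((cabs (u x)) ^+ 2 / (bdist Omega x) ^+ 2)%:E = j%:E)%E.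
  have := integrable_fin_num measurableT (hardy_integrable hne oO hu).
  rewrite -restrict_EFin -integral_mkcond => /fineK jE.
  exact: (ex_intro _ _ (esym jE)).
have j0 : 0 <= j.
  by rewrite -lee_fin -jE; apply: integral_ge0 => x _; rewrite lee_fin divr_ge0 ?sqr_ge0.
rewrite jE -/r in approx *.
(* The gradient integral is treated as an arbitrary extended real: [+oo] is trivial, and [-oo] is
   excluded by one instance of [approx]. *)
move: (\int[leb2]_(x in Omega) (grad_sq u x)%:E)%E approx => [g||] approx.
- rewrite -EFinM lee_fin; apply/ler_addgt0Pr => e e0.
  have d0 : 0 < e + 2 * (r ^+ 2 * j) + 1.
    by rewrite addr_gt0// ltr_wpDr// mulr_ge0// mulr_ge0// sqr_ge0.
  set c := r ^+ 2 * j in d0 *; have c0 : 0 <= c by rewrite mulr_ge0 ?sqr_ge0.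
  (* As [(1 - eta)^2 >= 1 - 2 eta], the loss is at most [2 c eta <= e]; the summand 1 keeps
     [eta < 1] even when [c = 0]. *)
  pose eta := e / (e + 2 * c + 1).
  have eta0 : 0 < eta by rewrite divr_gt0.
  have eta1 : eta < 1 by rewrite ltr_pdivrMr// mul1r; lra.
  have cE : 2 * c * eta <= e by rewrite /eta mulrCA ger_pMr// ler_pdivrMr// mul1r; lra.
  have : ((1 - eta) * r) ^+ 2 * j <= g.
    by rewrite -lee_fin EFinM; apply: approx; rewrite eta0.
  have -> : ((1 - eta) * r) ^+ 2 * j = c - 2 * c * eta + c * eta ^+ 2 by rewrite /c; ring.
  have : 0 <= c * eta ^+ 2 by rewrite mulr_ge0 ?sqr_ge0.
  lra.
- by rewrite leey.
- have h12 : 0 < (1 / 2 : R) < 1 by apply/andP; split; lra.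
  by have := approx _ h12; rewrite leeNy_eq.
Qed.
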